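(* Let $\lambda\in(0,1)$ and let $f$ be a univalent analytic function in $\mathbb{D}$. Then for all $z\in\mathbb{D}$ and all $n\geq 1$, $$(1-|z|^2)^n\,|\Phi_{\lambda,n}(f;z)|\leq\sum_{j=0}^{n}\left|\binom{\lambda}{n-j}\right|\sum_{k=0}^{j}\binom{j-1}{j-k}\frac{\sqrt{\lambda}}{\sqrt{|k-\lambda|}}\,|z|^{n-k}.$$
   Context: $\mathbb{D}=\{z\in\mathbb{C}:|z|<1\}$. ''Univalent'' means one-to-one. Mixed Aharonov sequence: for $f$ analytic in $\mathbb{D}$ with $f'\neq 0$ in $\mathbb{D}$, $\lambda>0$ and $z\in\mathbb{D}$, the numbers $\Phi_n(f;z)=\Phi_{\lambda,n}(f;z)$, $n\ge 0$, are defined by the expansion, for $w$ close to $z$, $$\left[\frac{f'(z)(w-z)}{f(w)-f(z)}\right]^{\lambda}=\sum_{n=0}^{\infty}\Phi_{\lambda,n}(f;z)(w-z)^n,$$ where the quotient is given the value $1$ at $w=z$ and the branch of the power is the one equal to $1$ at $w=z$ (so $\Phi_{0}\equiv 1$). For real $\alpha$ and integer $m\ge 0$, $\binom{\alpha}{m}=\frac{\alpha(\alpha-1)\cdots(\alpha-m+1)}{m!}$, with $\binom{\alpha}{0}=1$ (in particular $\binom{-1}{0}=1$). The convention $0^0=1$ is used. *)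

(* Defs.v *)
From Stdlib Require Import Reals Factorial ClassicalEpsilon.
From Coquelicot Require Import Coquelicot.
Open Scope R_scope.

Definition in_disk (z : C) : Prop := Cmod z < 1.

(* Functions on the disk are total functions [C -> C] whose values outside the
   disk are irrelevant. *)
Definition analytic_in_disk (f : C -> C) : Prop :=
  forall z : C, in_disk z ->
  exists (a : nat -> C) (r : R), 0 < r /\
    forall w : C, Cmod (w - z) < r ->
      is_pseries (K := C_AbsRing) (V := C_NormedModule) a (w - z)%C (f w).

Definition univalent_in_disk (f : C -> C) : Prop :=
  forall z w : C, in_disk z -> in_disk w -> f z = f w -> z = w.

Definition Cexp (z : C) : C :=
  (exp (Re z) * cos (Im z), exp (Re z) * sin (Im z)).

Definition aharonov_quotient (f : C -> C) (z w : C) : C :=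
  if Ceq_dec w z then RtoC 1
  else (C_derive f z * (w - z) / (f w - f z))%C.

(* The branch of [q ^ lambda] equal to 1 at [z] is [exp (lambda L)], where [L] is
   the continuous logarithm of [q = aharonov_quotient f z] near [z] with
   [L z = 0]. *)
Definition mixed_aharonov_expansion
    (lambda : R) (f : C -> C) (z : C) (a : nat -> C) : Prop :=
  exists (r : R) (L : C -> C), 0 < r /\ L z = RtoC 0 /\
    forall w : C, Cmod (w - z) < r ->
      continuous (T := C_UniformSpace) (U := C_UniformSpace) L w /\
      Cexp (L w) = aharonov_quotient f z w /\
      is_pseries (K := C_AbsRing) (V := C_NormedModule)
        a (w - z)%C (Cexp (RtoC lambda * L w)%C).

(* The sequence satisfying [mixed_aharonov_expansion] is unique when it exists,
   and it exists as soon as [f] is analytic at [z] with nonzero derivative. *)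
Definition mixed_aharonov (lambda : R) (n : nat) (f : C -> C) (z : C) : C :=
  epsilon (inhabits (fun _ : nat => RtoC 0))
    (mixed_aharonov_expansion lambda f z) n.

Fixpoint falling (alpha : R) (m : nat) : R :=
  match m with
  | O => 1
  | S m' => falling alpha m' * (alpha - INR m')
  end.

Definition gbinom (alpha : R) (m : nat) : R := falling alpha m / INR (fact m).

(* Main.v *)
(** By a Koebe transform the expansion at [z] becomes the expansion
    [sum c_k xi^k] of [(F'(0) xi / F(xi))^lambda] at 0, for [F] univalent with [F(0) = 0],
    evaluated at [xi = t / (1 - conj z t)] and multiplied by [(1 - conj z t)^lambda]; the
    bound follows from Prawitz' inequality [(k - lambda) |c_k|^2 <= lambda].

    Prawitz' inequality follows by Parseval once the circle means of [|F|^(-2 lambda)] are known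
    to decrease with the radius.  Jensen's formula and univalence show that the
    circle mean of [ln |F - w|] grows at most like [ln r].  Averaging this over the points [w]
    with [w^p = W], where [p] is a power of two and [W] is kept at distance of order [1 / p] from
    the [p]-th powers of the curves, gives in the limit the same for [ln (max |F| rho)]; and
    [|F|^(-s)] is, up to an affine function of [ln |F|], a superposition of such functions. *)

Require Import Defs.
From Stdlib Require Import Reals Arith Lra Lia Psatz List ClassicalEpsilon.
From Coquelicot Require Import Coquelicot.
Open Scope R_scope.

(** * Complex differentiability and the exponential *)

(** The mean of [ln |v - w|] over the unit circle in [w] is [ln (max |v| 1)]. Replacing that circle
    by the [p] roots of [w^p = W] turns it into [ln |v^p - W| / p], which equals [ln (max |v| 1)] up
    to [O(ln p / p)] once [|v^p - W|] is at least of order [1 / p]. The same lower bound keeps every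
    root off both curves, so all integrands stay continuous. Such a [W] is found by counting: where
    they are bounded, the power curves have length [O(p)], hence at scale [1 / n] they come near
    [O(p n)] points of a grid of [n^2] points, and [n] of order [p] suffices.

    The mean of [ln |F|] itself grows exactly like [ln r], because 0 is the only zero of [F]. By
    subtraction the mean of [min (ln |F|) tau] increases with [r] for every [tau], and so negative
    powers decrease.

    With [r = exp x], Parseval writes the mean of [|F|^(-2 lambda)] as a positive multiple of the
    sum of [|c_k|^2 exp (2 (k - lambda) x)]. As [0 < lambda < 1], the term [k = 0] is the only
    decreasing one, so no other term can grow faster than it falls; the slopes at [x = 0] give the
    inequality. *)

Lemma Cmod_0_minus (z : C) : Cmod (z - z) = 0.
Proof. replace (z - z)%C with (RtoC 0) by ring; apply Cmod_0. Qed.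

Lemma Cmod_le_shift (w z : C) : Cmod w <= Cmod (w - z) + Cmod z.
Proof.
replace w with (w - z + z)%C at 1 by ring; apply Cmod_triangle.
Qed.

Lemma Cminus_neq_0 (a b : C) : a <> b -> (a - b)%C <> 0.
Proof. intros H E; apply H; replace a with (a - b + b)%C by ring; rewrite E; ring. Qed.

(** Continuity measured by the modulus, whereas the balls of [C_UniformSpace] are squares;
    [ccont_continuous] compares the two. *)
Definition ccont (f : C -> C) (z : C) : Prop :=
  forall eps : R, 0 < eps -> exists d : R, 0 < d /\
    forall w : C, Cmod (w - z) < d -> Cmod (f w - f z) < eps.

Lemma ccont_const (c z : C) : ccont (fun _ => c) z.
Proof.
intros eps He; exists 1; split; [lra|]; intros w _.
now rewrite Cmod_0_minus.
Qed.

Lemma ccont_id (z : C) : ccont (fun w => w) z.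
Proof. intros eps He; exists eps; auto. Qed.

Lemma ccont_plus (f g : C -> C) (z : C) :
  ccont f z -> ccont g z -> ccont (fun w => f w + g w)%C z.
Proof.
intros Hf Hg eps He.
destruct (Hf (eps / 2)) as [d1 [Hd1 H1]]; [lra|].
destruct (Hg (eps / 2)) as [d2 [Hd2 H2]]; [lra|].
exists (Rmin d1 d2); split; [now apply Rmin_glb_lt|]; intros w Hw.
specialize (H1 w (Rlt_le_trans _ _ _ Hw (Rmin_l _ _))).
specialize (H2 w (Rlt_le_trans _ _ _ Hw (Rmin_r _ _))).
replace (f w + g w - (f z + g z))%C with ((f w - f z) + (g w - g z))%C by ring.
pose proof (Cmod_triangle (f w - f z) (g w - g z)); lra.
Qed.

Lemma ccont_bounded (f : C -> C) (z : C) : ccont f z ->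
  exists d M : R, 0 < d /\ 0 < M /\
    forall w : C, Cmod (w - z) < d -> Cmod (f w) <= M.
Proof.
intros Hf; destruct (Hf 1) as [d [Hd H]]; [lra|].
pose proof (Cmod_ge_0 (f z)).
exists d, (Cmod (f z) + 1); repeat split; [easy|lra|]; intros w Hw.
specialize (H w Hw); pose proof (Cmod_le_shift (f w) (f z)); lra.
Qed.

Lemma ccont_mult (f g : C -> C) (z : C) :
  ccont f z -> ccont g z -> ccont (fun w => f w * g w)%C z.
Proof.
intros Hf Hg eps He.
destruct (ccont_bounded f z Hf) as [d0 [M [Hd0 [HM H0]]]].
pose proof (Cmod_ge_0 (g z)) as Hgz.
set (B := M + Cmod (g z)).
assert (HB : 0 < B) by (unfold B; lra).
destruct (Hf (eps / (2 * B))) as [d1 [Hd1 H1]]; [apply Rdiv_lt_0_compat; lra|].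
destruct (Hg (eps / (2 * B))) as [d2 [Hd2 H2]]; [apply Rdiv_lt_0_compat; lra|].
exists (Rmin d0 (Rmin d1 d2)); split; [repeat apply Rmin_glb_lt; easy|]; intros w Hw.
assert (Hw0 : Cmod (w - z) < d0) by (eapply Rlt_le_trans; [exact Hw|apply Rmin_l]).
assert (Hw1 : Cmod (w - z) < d1).
{ eapply Rlt_le_trans; [exact Hw|]; eapply Rle_trans; [apply Rmin_r|apply Rmin_l]. }
assert (Hw2 : Cmod (w - z) < d2).
{ eapply Rlt_le_trans; [exact Hw|]; eapply Rle_trans; [apply Rmin_r|apply Rmin_r]. }
specialize (H0 w Hw0); specialize (H1 w Hw1); specialize (H2 w Hw2).
replace (f w * g w - f z * g z)%C with (f w * (g w - g z) + (f w - f z) * g z)%C by ring.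
eapply Rle_lt_trans; [apply Cmod_triangle|]; rewrite !Cmod_mult.
set (e := eps / (2 * B)) in *.
assert (Hee : e * B = eps / 2) by (unfold e; field; lra).
assert (Cmod (f w) * Cmod (g w - g z) <= M * e) by
  (apply Rmult_le_compat; try lra; apply Cmod_ge_0).
assert (Cmod (f w - f z) * Cmod (g z) <= e * Cmod (g z)) by
  (apply Rmult_le_compat_r; lra).
assert (M * e + e * Cmod (g z) = e * B) by (unfold B; ring).
lra.
Qed.

Lemma ccont_comp (f g : C -> C) (z : C) :
  ccont g z -> ccont f (g z) -> ccont (fun w => f (g w)) z.
Proof.
intros Hg Hf eps He; destruct (Hf eps He) as [d [Hd H]].
destruct (Hg d Hd) as [d' [Hd' H']]; exists d'; split; auto.
Qed.

Lemma Cmod_minus_sym (a b : C) : Cmod (a - b) = Cmod (b - a).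
Proof. rewrite <- Cmod_opp; f_equal; ring. Qed.

Lemma Cmod_rev_triangle (a b : C) : Cmod a - Cmod b <= Cmod (a - b).
Proof. pose proof (Cmod_le_shift a b); lra. Qed.

Lemma Cinv_diff (a b : C) : a <> 0 -> b <> 0 ->
  (/ a - / b = - (a - b) * (/ a * / b))%C.
Proof. intros Ha Hb; field; auto. Qed.

Lemma ccont_neq_0 (f : C -> C) (z : C) : ccont f z -> f z <> 0 ->
  exists d : R, 0 < d /\ forall w : C, Cmod (w - z) < d -> Cmod (f z) / 2 <= Cmod (f w).
Proof.
intros Hf Hz; apply Cmod_gt_0 in Hz.
destruct (Hf (Cmod (f z) / 2)) as [d [Hd H]]; [lra|].
exists d; split; [easy|]; intros w Hw; specialize (H w Hw).
pose proof (Cmod_rev_triangle (f z) (f w)); rewrite Cmod_minus_sym in H; lra.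
Qed.

Lemma ccont_inv (z : C) : z <> 0 -> ccont Cinv z.
Proof.
intros Hz eps He; assert (Hz' := proj1 (Cmod_gt_0 z) Hz).
set (m := Cmod z) in *.
exists (Rmin (m / 2) (eps * (m / 2 * m))); split.
{ apply Rmin_glb_lt; [lra|]; repeat apply Rmult_lt_0_compat; lra. }
intros w Hw.
destruct (Rmin_Rgt_l _ _ _ Hw) as [Hw1 Hw2].
assert (Hm : m / 2 <= Cmod w).
{ pose proof (Cmod_rev_triangle z w) as Ht; rewrite Cmod_minus_sym in Ht; fold m in Ht; lra. }
assert (Hwn : w <> 0) by (apply Cmod_gt_0; lra).
rewrite Cinv_diff, !Cmod_mult, Cmod_opp, !Cmod_inv by easy; fold m.
assert (0 < Cmod w * m) by (apply Rmult_lt_0_compat; lra).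
rewrite <- Rinv_mult; apply Rmult_lt_reg_r with (Cmod w * m); [easy|].
rewrite Rmult_assoc, Rinv_l, Rmult_1_r by lra.
eapply Rlt_le_trans; [exact Hw2|]; apply Rmult_le_compat_l; [lra|].
apply Rmult_le_compat_r; lra.
Qed.

Lemma ccont_ext_loc (f g : C -> C) (z : C) (d : R) : 0 < d ->
  (forall w : C, Cmod (w - z) < d -> f w = g w) -> ccont f z -> ccont g z.
Proof.
intros Hd H Hf eps He; destruct (Hf eps He) as [d' [Hd' H']].
exists (Rmin d d'); split; [now apply Rmin_glb_lt|]; intros w Hw.
rewrite <- !H.
- apply H'; eapply Rlt_le_trans; [exact Hw|apply Rmin_r].
- now rewrite Cmod_0_minus.
- eapply Rlt_le_trans; [exact Hw|apply Rmin_l].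
Qed.

(* Carathéodory's form of complex differentiability: [l] is the value at [z] of a
   difference quotient that extends continuously to [z]. *)
Definition cdiff (f : C -> C) (z l : C) : Prop :=
  exists phi : C -> C, ccont phi z /\ phi z = l /\
    forall w : C, (f w = f z + phi w * (w - z))%C.

(** The identity in [cdiff] is demanded for every [w], so outside the disk of agreement [phi] is
    replaced by the difference quotient of [g]. *)
Lemma cdiff_ext_loc (f g : C -> C) (z l : C) (d : R) : 0 < d ->
  (forall w : C, Cmod (w - z) < d -> f w = g w) -> cdiff f z l -> cdiff g z l.
Proof.
intros Hd H [phi [Hc [Hz Hf]]].
assert (H0 : Cmod (z - z) < d) by now rewrite Cmod_0_minus.
exists (fun w => if Rlt_dec (Cmod (w - z)) d then phi w else ((g w - g z) / (w - z))%C).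
split; [|split].
- apply ccont_ext_loc with phi d; [easy| |easy].
  intros w Hw; now destruct (Rlt_dec (Cmod (w - z)) d).
- now destruct (Rlt_dec (Cmod (z - z)) d).
- intros w; destruct (Rlt_dec (Cmod (w - z)) d) as [Hw|Hw].
  + rewrite <- !H by easy; apply Hf.
  + field; intros E; rewrite E, Cmod_0 in Hw; lra.
Qed.

Lemma cdiff_cont (f : C -> C) (z l : C) : cdiff f z l -> ccont f z.
Proof.
intros [phi [Hc [Hz Hf]]].
apply ccont_ext_loc with (fun w => f z + phi w * (w + - z))%C 1; [lra|now intros; rewrite (Hf w)|].
apply ccont_plus; [apply ccont_const|apply ccont_mult; [easy|]].
apply ccont_plus; [apply ccont_id|apply ccont_const].
Qed.

Lemma cdiff_const (c z : C) : cdiff (fun _ => c) z 0.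
Proof. exists (fun _ => RtoC 0); repeat split; [apply ccont_const|intros; ring]. Qed.

Lemma cdiff_id (z : C) : cdiff (fun w => w) z 1.
Proof. exists (fun _ => RtoC 1); repeat split; [apply ccont_const|intros; ring]. Qed.

Lemma cdiff_plus (f g : C -> C) (z l m : C) :
  cdiff f z l -> cdiff g z m -> cdiff (fun w => f w + g w)%C z (l + m).
Proof.
intros [phi [Hc [Hz Hf]]] [psi [Hc' [Hz' Hg]]].
exists (fun w => phi w + psi w)%C; repeat split.
- now apply ccont_plus.
- now rewrite Hz, Hz'.
- intros w; rewrite (Hf w), (Hg w); ring.
Qed.

Lemma cdiff_mult (f g : C -> C) (z l m : C) :
  cdiff f z l -> cdiff g z m -> cdiff (fun w => f w * g w)%C z (l * g z + f z * m).
Proof.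
intros Hf0 Hg0; assert (Hgc := cdiff_cont g z m Hg0).
destruct Hf0 as [phi [Hc [Hz Hf]]]; destruct Hg0 as [psi [Hc' [Hz' Hg]]].
exists (fun w => phi w * g w + f z * psi w)%C; repeat split.
- apply ccont_plus; apply ccont_mult; try easy; apply ccont_const.
- now rewrite Hz, Hz'.
- intros w; rewrite (Hf w), (Hg w); ring.
Qed.

Lemma cdiff_comp (f g : C -> C) (z l m : C) :
  cdiff g z m -> cdiff f (g z) l -> cdiff (fun w => f (g w)) z (l * m).
Proof.
intros Hg0 [phi [Hc [Hz Hf]]]; assert (Hgc := cdiff_cont g z m Hg0).
destruct Hg0 as [psi [Hc' [Hz' Hg]]].
exists (fun w => phi (g w) * psi w)%C; repeat split.
- apply ccont_mult; [|easy]; now apply ccont_comp.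
- now rewrite Hz, Hz'.
- intros w; rewrite (Hf (g w)).
  replace (g w - g z)%C with (psi w * (w - z))%C by (rewrite (Hg w); ring); ring.
Qed.

Lemma cdiff_inv (z : C) : z <> 0 -> cdiff Cinv z (- (/ z * / z)).
Proof.
intros Hz; assert (Hz' := proj1 (Cmod_gt_0 z) Hz).
(* The quotient [- (/ w * / z)] is wrong at [w = 0], where [/ w] is a default value; away from [z]
   the function is therefore replaced by one for which the identity holds by definition. *)
apply cdiff_ext_loc with
  (fun w => if Rlt_dec (Cmod (w - z)) (Cmod z) then / w else / z + - (/ w * / z) * (w - z))%C
  (Cmod z); [easy|intros w Hw; now destruct (Rlt_dec (Cmod (w - z)) (Cmod z))|].
exists (fun w => - (/ w * / z))%C; repeat split.
- apply ccont_ext_loc with (fun w => (- / z) * / w)%C 1; [lra|intros; ring|].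
  apply ccont_mult; [apply ccont_const|now apply ccont_inv].
- assert (H0 : Cmod (z - z) < Cmod z) by now rewrite Cmod_0_minus.
  intros w; destruct (Rlt_dec (Cmod (z - z)) (Cmod z)); [|easy].
  destruct (Rlt_dec (Cmod (w - z)) (Cmod z)) as [Hw|Hw]; [|easy].
  field; split; [easy|]; intros E; rewrite E in Hw.
  replace (0 - z)%C with (- z)%C in Hw by ring; rewrite Cmod_opp in Hw; lra.
Qed.

Lemma cdiff_eq (f : C -> C) (z l m : C) : l = m -> cdiff f z l -> cdiff f z m.
Proof. now intros ->. Qed.

Lemma cdiff_scal (c : C) (f : C -> C) (z l : C) :
  cdiff f z l -> cdiff (fun w => c * f w)%C z (c * l).
Proof.
intros Hf; eapply cdiff_eq; [|apply cdiff_mult; [apply cdiff_const|exact Hf]]; cbv beta; ring.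
Qed.

Lemma cdiff_minus (f g : C -> C) (z l m : C) :
  cdiff f z l -> cdiff g z m -> cdiff (fun w => f w - g w)%C z (l - m).
Proof.
intros Hf Hg; apply cdiff_ext_loc with (fun w => f w + - (1) * g w)%C 1; [lra|intros; ring|].
eapply cdiff_eq; [|apply cdiff_plus; [exact Hf|apply cdiff_scal, Hg]]; cbv beta; ring.
Qed.

Lemma ccont_minus (f g : C -> C) (z : C) :
  ccont f z -> ccont g z -> ccont (fun w => f w - g w)%C z.
Proof.
intros Hf Hg; apply ccont_ext_loc with (fun w => f w + - (1) * g w)%C 1; [lra|intros; ring|].
apply ccont_plus; [easy|apply ccont_mult; [apply ccont_const|easy]].
Qed.

Lemma ccont_div (f g : C -> C) (z : C) :
  ccont f z -> ccont g z -> g z <> 0 -> ccont (fun w => f w / g w)%C z.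
Proof.
intros Hf Hg H0; apply ccont_mult; [easy|].
apply (ccont_comp Cinv g); [easy|now apply ccont_inv].
Qed.

Lemma cdiff_div (f g : C -> C) (z l m : C) :
  cdiff f z l -> cdiff g z m -> g z <> 0 ->
  cdiff (fun w => f w / g w)%C z ((l * g z - f z * m) / (g z * g z)).
Proof.
intros Hf Hg H0.
eapply cdiff_eq; [|apply cdiff_mult; [exact Hf|apply (cdiff_comp Cinv g); [exact Hg|now apply cdiff_inv]]].
cbv beta; field; easy.
Qed.

Lemma cdiff_lim_eps (f : C -> C) (z l : C) : cdiff f z l ->
  forall eps : R, 0 < eps -> exists d : R, 0 < d /\
    forall w : C, Cmod (w - z) < d -> Cmod (f w - f z - l * (w - z)) <= eps * Cmod (w - z).
Proof.
intros [phi [Hc [Hz Hf]]] eps He; destruct (Hc eps He) as [d [Hd H]].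
exists d; split; [easy|]; intros w Hw; specialize (H w Hw).
rewrite (Hf w), <- Hz.
replace (f z + phi w * (w - z) - f z - phi z * (w - z))%C with ((phi w - phi z) * (w - z))%C by ring.
rewrite Cmod_mult; apply Rmult_le_compat_r; [apply Cmod_ge_0|lra].
Qed.

Lemma cdiff_of_eps (f : C -> C) (z l : C) :
  (forall eps : R, 0 < eps -> exists d : R, 0 < d /\
    forall w : C, Cmod (w - z) < d -> Cmod (f w - f z - l * (w - z)) <= eps * Cmod (w - z)) ->
  cdiff f z l.
Proof.
intros H; exists (fun w => if Ceq_dec w z then l else ((f w - f z) / (w - z))%C).
split; [|split].
- intros eps He; destruct (H (eps / 2)) as [d [Hd H']]; [lra|].
  exists d; split; [easy|]; intros w Hw; specialize (H' w Hw).
  destruct (Ceq_dec z z) as [_|]; [|easy].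
  destruct (Ceq_dec w z) as [->|Hwz].
  + now rewrite Cmod_0_minus.
  + assert (Hn := Cminus_neq_0 w z Hwz).
    replace ((f w - f z) / (w - z) - l)%C with ((f w - f z - l * (w - z)) / (w - z))%C by (field; easy).
    rewrite Cmod_div by easy; apply Cmod_gt_0 in Hn.
    apply Rle_lt_trans with (eps / 2); [|lra].
    apply Rmult_le_reg_r with (Cmod (w - z)); [easy|].
    unfold Rdiv at 1; rewrite Rmult_assoc, Rinv_l; lra.
- now destruct (Ceq_dec z z).
- intros w; destruct (Ceq_dec w z) as [->|Hwz]; [ring|].
  field; now apply Cminus_neq_0.
Qed.

Lemma cdiff_unique (f : C -> C) (z l m : C) : cdiff f z l -> cdiff f z m -> l = m.
Proof.
intros Hl Hm; destruct (Ceq_dec l m) as [|Hn]; [easy|exfalso].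
assert (Hp : 0 < Cmod (l - m)) by now apply Cmod_gt_0, Cminus_neq_0.
destruct (cdiff_lim_eps f z l Hl (Cmod (l - m) / 3)) as [d1 [Hd1 H1]]; [lra|].
destruct (cdiff_lim_eps f z m Hm (Cmod (l - m) / 3)) as [d2 [Hd2 H2]]; [lra|].
set (h := Rmin d1 d2 / 2).
assert (Hmin : 0 < Rmin d1 d2) by now apply Rmin_glb_lt.
assert (Hh : 0 < h) by (unfold h; lra).
assert (Hd : Cmod (z + RtoC h - z) = h).
{ replace (z + RtoC h - z)%C with (RtoC h) by ring; rewrite Cmod_R, Rabs_pos_eq; lra. }
pose proof (Rmin_l d1 d2); pose proof (Rmin_r d1 d2).
specialize (H1 (z + h)%C); specialize (H2 (z + h)%C); rewrite Hd in H1, H2.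
specialize (H1 ltac:(unfold h in *; lra)); specialize (H2 ltac:(unfold h in *; lra)).
pose proof (Cmod_triangle (f (z + h) - f z - m * (z + h - z))%C (- (f (z + h) - f z - l * (z + h - z)))%C) as Ht.
rewrite Cmod_opp in Ht.
replace (f (z + h) - f z - m * (z + h - z) + - (f (z + h) - f z - l * (z + h - z)))%C
  with ((l - m) * RtoC h)%C in Ht by ring.
rewrite Cmod_mult, Cmod_R, (Rabs_pos_eq h) in Ht by lra.
nra.
Qed.

Lemma Cexp_0 : Cexp 0 = 1.
Proof. unfold Cexp; simpl; rewrite exp_0, cos_0, sin_0; apply injective_projections; simpl; ring. Qed.

Lemma Cexp_plus (a b : C) : Cexp (a + b) = (Cexp a * Cexp b)%C.
Proof.
unfold Cexp, Cplus, Cmult, Re, Im; simpl; rewrite exp_plus, cos_plus, sin_plus.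
apply injective_projections; simpl; ring.
Qed.

Lemma Cmod_Cexp (z : C) : Cmod (Cexp z) = exp (Re z).
Proof.
unfold Cmod, Cexp; simpl.
replace (_ + _) with (Rsqr (exp (Re z))).
- apply sqrt_Rsqr, Rlt_le, exp_pos.
- unfold Rsqr; pose proof (sin2_cos2 (Im z)) as H; unfold Rsqr in H; nra.
Qed.

Lemma Cexp_neq_0 (z : C) : Cexp z <> 0.
Proof. apply Cmod_gt_0; rewrite Cmod_Cexp; apply exp_pos. Qed.

Lemma Cexp_opp (z : C) : Cexp (- z) = (/ Cexp z)%C.
Proof.
assert (H : (Cexp (- z) * Cexp z)%C = 1).
{ rewrite <- Cexp_plus; replace (- z + z)%C with (RtoC 0) by ring; apply Cexp_0. }
pose proof (Cexp_neq_0 z) as Hn.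
rewrite <- (Cmult_1_l (/ Cexp z)), <- H; field; easy.
Qed.

Lemma Cexp_minus (a b : C) : Cexp (a - b) = (Cexp a / Cexp b)%C.
Proof. unfold Cminus; now rewrite Cexp_plus, Cexp_opp. Qed.

(** The upper bound comes from [exp (- x) >= 1 - x]: then [exp x - 1 - x <= x^2 / (1 - x)]. *)
Lemma exp_sub_1_bounds (x : R) : Rabs x <= 1 / 2 -> 0 <= exp x - 1 - x <= 2 * x ^ 2.
Proof.
intros Hx; apply Rabs_le_between in Hx.
pose proof (exp_ineq1_le x); pose proof (exp_ineq1_le (- x)).
split; [lra|].
assert (H3 : exp x * exp (- x) = 1) by (rewrite <- exp_plus, Rplus_opp_r; apply exp_0).
nra.
Qed.

Lemma Cmod_le_sum (z : C) : Cmod z <= Rabs (Re z) + Rabs (Im z).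
Proof.
replace z with (RtoC (Re z) + Ci * RtoC (Im z))%C at 1
  by (apply injective_projections; simpl; unfold Re, Im; ring).
eapply Rle_trans; [apply Cmod_triangle|]; rewrite Cmod_mult, Cmod_Ci, !Cmod_R; lra.
Qed.

Lemma im_le_Cmod (z : C) : Rabs (Im z) <= Cmod z.
Proof. eapply Rle_trans; [apply Rmax_r|apply Rmax_Cmod]. Qed.

Lemma Rabs_sin_le (y : R) : Rabs (sin y) <= Rabs y.
Proof.
destruct (MVT_abs sin cos 0 y) as [c [Hc _]].
{ intros; apply derivable_pt_lim_sin. }
rewrite sin_0, !Rminus_0_r in Hc; rewrite Hc.
pose proof (COS_bound c); pose proof (Rabs_pos y).
assert (Rabs (cos c) <= 1) by (apply Rabs_le; lra); nra.
Qed.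

Lemma cos_ge_quad (y : R) : 1 - y ^ 2 / 2 <= cos y <= 1.
Proof.
split; [|apply COS_bound].
replace y with (2 * (y / 2)) at 2 by field.
rewrite cos_2a_sin.
pose proof (Rabs_sin_le (y / 2)) as H; apply Rsqr_le_abs_1 in H; unfold Rsqr in H; nra.
Qed.

Lemma Rabs_sin_sub (y : R) : Rabs (sin y - y) <= y ^ 2 * Rabs y.
Proof.
destruct (MVT_abs (fun x => sin x - x) (fun x => cos x - 1) 0 y) as [c [Hc Hcy]].
{ intros c _; apply derivable_pt_lim_minus; [apply derivable_pt_lim_sin|apply derivable_pt_lim_id]. }
rewrite sin_0, !Rminus_0_r in Hc; rewrite Hc.
apply Rmult_le_compat_r; [apply Rabs_pos|].
pose proof (cos_ge_quad c).
assert (c ^ 2 <= y ^ 2).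
{ unfold Rmin, Rmax in Hcy; destruct (Rle_dec 0 y); nra. }
apply Rabs_le; nra.
Qed.

Lemma Cexp_quad (h : C) : Cmod h <= 1 / 2 -> Cmod (Cexp h - 1 - h) <= 8 * Cmod h ^ 2.
Proof.
intros Hh; eapply Rle_trans; [apply Cmod_le_sum|].
pose proof (re_le_Cmod h) as Hx; pose proof (im_le_Cmod h) as Hy.
rewrite Cmod2_alt.
destruct h as [x y]; unfold Cexp, Re, Im in *; simpl fst in *; simpl snd in *.
set (m := Cmod (x, y)) in *.
assert (Hx' : Rabs x <= 1 / 2) by lra; assert (Hy' : Rabs y <= 1 / 2) by lra.
pose proof (exp_sub_1_bounds x Hx') as He; pose proof (cos_ge_quad y) as Hc.
pose proof (Rabs_sin_sub y) as Hs.
assert (Hs' : Rabs (sin y - y) <= y ^ 2) by (nra).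
apply Rabs_le_between in Hx'; apply Rabs_le_between in Hy'; apply Rabs_le_between in Hs'.
assert (Hexp : exp x <= 2) by nra.
assert (A : Rabs (exp x * cos y + - (1) + - x) <= 2 * x ^ 2 + y ^ 2).
{ apply Rabs_le; nra. }
assert (B : Rabs (exp x * sin y + - 0 + - y) <= 4 * x ^ 2 + 4 * y ^ 2).
(* Each of the three products is of second order. The real part costs [2 x^2 + y^2] and the
   imaginary part [4 x^2 + 4 y^2], so the constant 8 leaves room. *)
{ replace (exp x * sin y + - 0 + - y) with (exp x * (sin y - y) + (exp x - 1 - x) * y + x * y) by ring.
  assert (- (2 * y ^ 2) <= exp x * (sin y - y) <= 2 * y ^ 2) by (split; nra).
  assert (- x ^ 2 <= (exp x - 1 - x) * y <= x ^ 2) by (split; nra).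
  assert (- (x ^ 2 + y ^ 2) <= x * y <= x ^ 2 + y ^ 2) by (split; nra).
  apply Rabs_le; lra. }
simpl in *; lra.
Qed.

Lemma cdiff_Cexp (z : C) : cdiff Cexp z (Cexp z).
Proof.
apply cdiff_of_eps; intros eps He.
assert (Hz : 0 < Cmod (Cexp z)) by (apply Cmod_gt_0, Cexp_neq_0).
set (K := 8 * Cmod (Cexp z)); assert (HK : 0 < K) by (unfold K; lra).
exists (Rmin (1 / 2) (eps / K)); split.
{ apply Rmin_glb_lt; [lra|now apply Rdiv_lt_0_compat]. }
intros w Hw; destruct (Rmin_Rgt_l _ _ _ Hw) as [Hw1 Hw2].
replace (Cexp w) with (Cexp z * Cexp (w - z))%C by (rewrite <- Cexp_plus; f_equal; ring).
replace (_ - _ - _)%C with (Cexp z * (Cexp (w - z) - 1 - (w - z)))%C by ring.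
rewrite Cmod_mult.
pose proof (Cexp_quad (w - z)%C ltac:(lra)) as Hq; pose proof (Cmod_ge_0 (w - z)).
apply Rle_trans with (K * Cmod (w - z) * Cmod (w - z)); [unfold K; nra|].
apply Rmult_le_compat_r; [easy|].
apply Rlt_le in Hw2; apply (Rmult_le_compat_l K) in Hw2; [|lra].
replace (K * (eps / K)) with eps in Hw2 by (field; lra); lra.
Qed.

Lemma ccont_Cexp (z : C) : ccont Cexp z.
Proof. apply cdiff_cont with (Cexp z), cdiff_Cexp. Qed.

Lemma polar_form (c : C) : c <> 0 ->
  exists t : R, 0 <= t <= 2 * PI /\ c = (Cmod c * cos t, Cmod c * sin t).
Proof.
intros Hc; assert (Hm := proj1 (Cmod_gt_0 c) Hc).
pose proof (Cmod2_alt c) as H2; pose proof (re_le_Cmod c) as Hre.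
destruct c as [x y]; set (m := Cmod (x, y)) in *; unfold Re, Im in *; simpl fst in *; simpl snd in *.
set (u := x / m).
assert (Hu : -1 <= u <= 1).
{ apply Rabs_le_between; unfold u; rewrite Rabs_div, (Rabs_pos_eq m) by lra.
  apply Rmult_le_reg_r with m; [easy|]; unfold Rdiv; rewrite Rmult_assoc, Rinv_l; lra. }
assert (Hxu : x = m * u) by (unfold u; field; lra).
assert (Hs : (m * sqrt (1 - u²)) ^ 2 = y ^ 2).
{ rewrite Rpow_mult_distr, pow2_sqrt; unfold Rsqr; nra. }
assert (Hy : y = m * sqrt (1 - u²) \/ y = m * - sqrt (1 - u²)).
{ assert (Hp : (y - m * sqrt (1 - u²)) * (y + m * sqrt (1 - u²)) = 0) by (simpl in Hs; nra).
  apply Rmult_integral in Hp; destruct Hp; [left|right]; lra. }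
pose proof (acos_bound u); destruct Hy as [Hy|Hy].
- exists (acos u); split; [lra|]; rewrite cos_acos, sin_acos by easy; now f_equal.
- exists (- acos u + 2 * PI); split; [lra|].
  rewrite cos_plus, sin_plus, cos_2PI, sin_2PI, cos_neg, sin_neg, cos_acos, sin_acos by easy.
  f_equal; lra.
Qed.

Lemma Cexp_surj (c : C) : c <> 0 -> exists b : C, Cexp b = c.
Proof.
intros Hc; destruct (polar_form c Hc) as [t [_ Ht]]; exists (ln (Cmod c), t).
rewrite Ht at 2; unfold Cexp, Re, Im; simpl; rewrite exp_ln by now apply Cmod_gt_0.
reflexivity.
Qed.

Lemma Cexp_eq_1 (d : C) : Cexp d = 1 -> Rabs (Im d) < 2 * PI -> d = 0.
Proof.
intros H Hd; pose proof (Cmod_Cexp d) as Hm; rewrite H, Cmod_1 in Hm.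
assert (Hr : Re d = 0) by (apply exp_inv; rewrite <- Hm, exp_0; reflexivity).
destruct d as [x y]; unfold Re, Im in *; simpl in *; subst x.
assert (Hc : cos y = 1).
{ apply (f_equal fst) in H; unfold Cexp, Re, Im in H; simpl in H; rewrite exp_0 in H; lra. }
assert (Hs : sin (y / 2) = 0).
{ replace y with (2 * (y / 2)) in Hc by field; rewrite cos_2a_sin in Hc; nra. }
apply Rabs_lt_between in Hd.
assert (y = 0); [|subst; reflexivity].
destruct (Rtotal_order y 0) as [Hy|[|Hy]]; [|easy|].
- pose proof (sin_lt_0_var (y / 2) ltac:(lra) ltac:(lra)); lra.
- pose proof (sin_gt_0 (y / 2) ltac:(lra) ltac:(lra)); lra.
Qed.

(** The imaginary parts differ by less than 2, hence by less than a period. This is what makes a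
    continuous logarithm unique near a point where it vanishes. *)
Lemma Cexp_inj (a b : C) : Cexp a = Cexp b -> Cmod a < 1 -> Cmod b < 1 -> a = b.
Proof.
intros H Ha Hb.
assert (Hd : (a - b)%C = 0).
{ apply Cexp_eq_1.
  - rewrite Cexp_minus, H; field; apply Cexp_neq_0.
  - eapply Rle_lt_trans; [apply im_le_Cmod|].
    pose proof (Cmod_triangle a (- b)) as Ht; rewrite Cmod_opp in Ht; fold (Cminus a b) in Ht.
    pose proof PI2_1; unfold PI2 in *; lra. }
replace a with (a - b + b)%C by ring; rewrite Hd; ring.
Qed.

(** * Power series *)

(** The upper bound is excluded: [csum u (S n)] is what [sum_n u n] denotes in Coquelicot. *)
Fixpoint csum (u : nat -> C) (n : nat) : C :=
  match n with O => 0 | S m => (csum u m + u m)%C end.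

Notation psum a z := (csum (fun k : nat => (a k * z ^ k)%C)) (only parsing).

Lemma csum_ext (u v : nat -> C) (n : nat) :
  (forall k : nat, (k < n)%nat -> u k = v k) -> csum u n = csum v n.
Proof.
induction n as [|n IH]; intros H; simpl; [easy|].
rewrite IH by (intros; apply H; lia); now rewrite H by lia.
Qed.

Lemma csum_plus (u v : nat -> C) (n : nat) :
  csum (fun k => u k + v k)%C n = (csum u n + csum v n)%C.
Proof. induction n as [|n IH]; simpl; [ring|rewrite IH; ring]. Qed.

Lemma csum_scal (c : C) (u : nat -> C) (n : nat) :
  csum (fun k => c * u k)%C n = (c * csum u n)%C.
Proof. induction n as [|n IH]; simpl; [ring|rewrite IH; ring]. Qed.

Lemma csum_shift (u : nat -> C) (n : nat) :
  csum u (S n) = (u O + csum (fun k => u (S k)) n)%C.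
Proof.
induction n as [|n IH]; [simpl; ring|].
change (csum u (S (S n))) with (csum u (S n) + u (S n))%C; rewrite IH; simpl; ring.
Qed.

Lemma csum_geom (q M : R) (u : nat -> C) (m p : nat) : 0 <= q < 1 ->
  (forall k : nat, Cmod (u k) <= M * q ^ k) ->
  Cmod (csum u (m + p) - csum u m) <= M * q ^ m * / (1 - q).
Proof.
intros Hq Hu.
assert (Hi : 0 < / (1 - q)) by (apply Rinv_0_lt_compat; lra).
assert (HM : 0 <= M) by (specialize (Hu O); simpl in Hu; pose proof (Cmod_ge_0 (u O)); lra).
(* The factor [1 - q ^ p] makes the bound inductive in [p]; it is dropped afterwards. *)
assert (H : Cmod (csum u (m + p) - csum u m) <= M * q ^ m * (1 - q ^ p) * / (1 - q)).
{ induction p as [|p IH].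
  - rewrite Nat.add_0_r; simpl; rewrite Cmod_0_minus; lra.
  - rewrite Nat.add_succ_r; simpl csum.
    replace (csum u (m + p) + u (m + p)%nat - csum u m)%C
      with ((csum u (m + p) - csum u m) + u (m + p)%nat)%C by ring.
    eapply Rle_trans; [apply Cmod_triangle|].
    specialize (Hu (m + p)%nat).
    eapply Rle_trans; [apply Rplus_le_compat; [exact IH|exact Hu]|].
    rewrite pow_add; simpl; right; field; lra. }
eapply Rle_trans; [exact H|]; apply Rmult_le_compat_r; [lra|].
assert (0 <= q ^ p) by (apply pow_le; lra).
assert (0 <= M * q ^ m) by (apply Rmult_le_pos; [easy|apply pow_le; lra]).
nra.
Qed.

Lemma csum_geom_bound (q M : R) (u : nat -> C) (n : nat) : 0 <= q < 1 ->
  (forall k : nat, Cmod (u k) <= M * q ^ k) -> Cmod (csum u n) <= M * / (1 - q).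
Proof.
intros Hq Hu; pose proof (csum_geom q M u 0 n Hq Hu) as H.
simpl in H; replace (csum u n - 0)%C with (csum u n) in H by ring; lra.
Qed.

Definition clim (u : nat -> C) (l : C) : Prop :=
  forall eps : R, 0 < eps -> exists N : nat, forall n : nat, (N <= n)%nat -> Cmod (u n - l) < eps.

Lemma clim_bound (u : nat -> C) (l c : C) (B : R) : clim u l ->
  (exists N : nat, forall n : nat, (N <= n)%nat -> Cmod (u n - c) <= B) -> Cmod (l - c) <= B.
Proof.
intros Hu [N HN].
destruct (Rle_dec (Cmod (l - c)) B) as [|Hn]; [easy|exfalso].
destruct (Hu (Cmod (l - c) - B)) as [N' HN']; [lra|].
specialize (HN (Nat.max N N') ltac:(lia)); specialize (HN' (Nat.max N N') ltac:(lia)).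
pose proof (Cmod_triangle (u (Nat.max N N') - c) (l - u (Nat.max N N'))) as Ht.
rewrite (Cmod_minus_sym l) in Ht.
replace (u (Nat.max N N') - c + (l - u (Nat.max N N')))%C with (l - c)%C in Ht by ring; lra.
Qed.

Lemma clim_unique (u : nat -> C) (l m : C) : clim u l -> clim u m -> l = m.
Proof.
intros Hl Hm; assert (H : Cmod (l - m) <= 0).
{ apply le_epsilon; intros eps He; rewrite Rplus_0_l; apply clim_bound with u; [easy|].
  destruct (Hm eps He) as [N HN]; exists N; intros n Hn; left; auto. }
destruct (Ceq_dec l m) as [|Hn]; [easy|exfalso].
assert (0 < Cmod (l - m)) by now apply Cmod_gt_0, Cminus_neq_0.
lra.
Qed.

Lemma clim_complete (u : nat -> C) :
  (forall eps : R, 0 < eps -> exists N : nat, forall n : nat, (N <= n)%nat -> Cmod (u n - u N) < eps) ->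
  exists l : C, clim u l.
Proof.
intros H.
assert (HC : forall p : C -> R, (forall a b, Rabs (p a - p b) <= Cmod (a - b)) ->
  exists l : R, Un_cv (fun n : nat => p (u n)) l).
{ intros p Hp; destruct (Rcomplete.R_complete (fun n : nat => p (u n))) as [l Hl]; [|now exists l].
  intros eps He; destruct (H (eps / 2)) as [N HN]; [lra|]; exists N; intros n m Hn Hm.
  unfold R_dist; eapply Rle_lt_trans; [apply Hp|].
  replace (u n - u m)%C with ((u n - u N) - (u m - u N))%C by ring.
  pose proof (HN n Hn); pose proof (HN m Hm).
  pose proof (Cmod_triangle (u n - u N) (- (u m - u N))) as Ht; rewrite Cmod_opp in Ht.
  unfold Cminus in *; lra. }
destruct (HC Re) as [x Hx].
{ intros a b; replace (Re a - Re b) with (Re (a - b)) by (unfold Re; simpl; ring); apply re_le_Cmod. }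
destruct (HC Im) as [y Hy].
{ intros a b; replace (Im a - Im b) with (Im (a - b)) by (unfold Im; simpl; ring); apply im_le_Cmod. }
exists (x, y); intros eps He.
destruct (Hx (eps / 2)) as [N1 H1]; [lra|]; destruct (Hy (eps / 2)) as [N2 H2]; [lra|].
exists (Nat.max N1 N2); intros n Hn; specialize (H1 n ltac:(lia)); specialize (H2 n ltac:(lia)).
eapply Rle_lt_trans; [apply Cmod_le_sum|]; unfold R_dist, Re, Im in *; simpl in *.
unfold Rminus in *; lra.
Qed.

Definition pser (rad : R) (a : nat -> C) (f : C -> C) : Prop :=
  forall z : C, Cmod z < rad -> clim (psum a z) (f z).

Lemma Cpow_0_l (n : nat) : (0 < n)%nat -> Cpow 0 n = 0.
Proof. destruct n; [lia|]; intros _; rewrite Cpow_S; ring. Qed.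

Lemma clim_bounded (u : nat -> C) (l : C) : clim u l ->
  exists M : R, 0 < M /\ forall n : nat, Cmod (u n) <= M.
Proof.
intros H; destruct (H 1 Rlt_0_1) as [N HN].
assert (HB : forall m : nat, exists M : R, 0 < M /\ forall n : nat, (n < m)%nat -> Cmod (u n) <= M).
{ induction m as [|m [M [HM IH]]]; [exists 1; split; [lra|lia]|].
  exists (Rmax M (Cmod (u m))); split; [eapply Rlt_le_trans; [exact HM|apply Rmax_l]|].
  intros n Hn; destruct (Nat.eq_dec n m) as [->|]; [apply Rmax_r|].
  eapply Rle_trans; [apply IH; lia|apply Rmax_l]. }
destruct (HB N) as [M [HM HM']]; exists (Rmax M (Cmod l + 1)); split.
{ eapply Rlt_le_trans; [exact HM|apply Rmax_l]. }
intros n; destruct (Nat.lt_ge_cases n N) as [Hn|Hn].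
- eapply Rle_trans; [now apply HM'|apply Rmax_l].
- eapply Rle_trans; [|apply Rmax_r]; specialize (HN n Hn).
  pose proof (Cmod_rev_triangle (u n) l); lra.
Qed.

(** Each term is a difference of two consecutive partial sums, and these form a convergent, hence
    bounded, sequence. *)
Lemma pser_coef_bound (rad rho : R) (a : nat -> C) (f : C -> C) : pser rad a f -> 0 <= rho < rad ->
  exists M : R, 0 < M /\ forall k : nat, Cmod (a k) * rho ^ k <= M.
Proof.
intros H Hr.
assert (Hm : Cmod (RtoC rho) < rad) by (rewrite Cmod_R, Rabs_pos_eq; lra).
destruct (clim_bounded _ _ (H _ Hm)) as [M [HM HB]].
exists (2 * M); split; [lra|]; intros k.
assert (E : (a k * RtoC rho ^ k)%C =
  (psum a (RtoC rho) (S k) - psum a (RtoC rho) k)%C) by (simpl; ring).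
replace (Cmod (a k) * rho ^ k) with (Cmod (a k * RtoC rho ^ k)).
- rewrite E; unfold Cminus; eapply Rle_trans; [apply Cmod_triangle|]; rewrite Cmod_opp.
  pose proof (HB (S k)); pose proof (HB k); lra.
- rewrite Cmod_mult, Cmod_pow, Cmod_R, Rabs_pos_eq by lra; easy.
Qed.

Lemma term_bound (rho M : R) (a : nat -> C) (z : C) : 0 < rho ->
  (forall k : nat, Cmod (a k) * rho ^ k <= M) ->
  forall k : nat, Cmod (a k * z ^ k) <= M * (Cmod z / rho) ^ k.
Proof.
intros Hr H k; rewrite Cmod_mult, Cmod_pow.
unfold Rdiv; rewrite Rpow_mult_distr, pow_inv.
assert (0 < rho ^ k) by now apply pow_lt.
replace (Cmod (a k) * Cmod z ^ k) with (Cmod (a k) * rho ^ k * (Cmod z ^ k * / rho ^ k)) by (field; lra).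
apply Rmult_le_compat_r; [|easy].
apply Rmult_le_pos; [apply pow_le, Cmod_ge_0|left; now apply Rinv_0_lt_compat].
Qed.

Lemma ratio_bounds (rho : R) (z : C) : Cmod z < rho -> 0 <= Cmod z / rho < 1.
Proof.
intros H; pose proof (Cmod_ge_0 z); assert (0 < rho) by lra; split.
- apply Rmult_le_pos; [easy|left; now apply Rinv_0_lt_compat].
- apply Rmult_lt_reg_r with rho; [easy|]; unfold Rdiv; rewrite Rmult_assoc, Rinv_l; lra.
Qed.

Lemma pser_remainder (rad rho M : R) (a : nat -> C) (f : C -> C) (z : C) (n : nat) :
  pser rad a f -> rho <= rad -> Cmod z < rho -> (forall k : nat, Cmod (a k) * rho ^ k <= M) ->
  Cmod (f z - psum a z n) <= M * (Cmod z / rho) ^ n * / (1 - Cmod z / rho).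
Proof.
intros H HR Hz HM; pose proof (Cmod_ge_0 z).
apply clim_bound with (psum a z); [apply H; lra|].
exists n; intros m Hm; replace m with (n + (m - n))%nat by lia.
apply csum_geom; [now apply ratio_bounds|]; apply term_bound; [lra|easy].
Qed.

Lemma pow_lim_0 (q eps : R) : 0 <= q < 1 -> 0 < eps ->
  exists N : nat, forall n : nat, (N <= n)%nat -> q ^ n < eps.
Proof.
intros Hq He; destruct (pow_lt_1_zero q ltac:(rewrite Rabs_pos_eq; lra) eps He) as [N HN].
exists N; intros n Hn; specialize (HN n Hn); rewrite Rabs_pos_eq in HN; [easy|apply pow_le; lra].
Qed.

Lemma pser_exists (rad : R) (a : nat -> C) :
  (forall rho : R, 0 < rho < rad -> exists M : R, forall k : nat, Cmod (a k) * rho ^ k <= M) ->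
  exists f : C -> C, pser rad a f.
Proof.
intros H; exists (fun z => epsilon (inhabits (RtoC 0)) (clim (psum a z))).
intros z Hz; apply epsilon_spec, clim_complete; intros eps He.
pose proof (Cmod_ge_0 z).
destruct (H ((Cmod z + rad) / 2)) as [M HM]; [lra|].
set (rho := (Cmod z + rad) / 2) in *; assert (Hzr : Cmod z < rho) by (unfold rho; lra).
pose proof (ratio_bounds rho z Hzr) as Hq; set (q := Cmod z / rho) in *.
assert (HM0 : 0 <= M) by (specialize (HM O); simpl in HM; pose proof (Cmod_ge_0 (a O)); lra).
assert (Hi : 0 < / (1 - q)) by (apply Rinv_0_lt_compat; lra).
destruct (pow_lim_0 q (eps / ((M + 1) * / (1 - q)))) as [N HN]; [easy| |].
{ apply Rdiv_lt_0_compat; [easy|apply Rmult_lt_0_compat; lra]. }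
exists N; intros n Hn; replace n with (N + (n - N))%nat by lia.
eapply Rle_lt_trans; [apply (csum_geom q M)|]; [easy|apply term_bound; [lra|easy]|].
specialize (HN N (Nat.le_refl N)).
assert (HK : 0 < (M + 1) * / (1 - q)) by (apply Rmult_lt_0_compat; lra).
apply (Rmult_lt_compat_r ((M + 1) * / (1 - q))) in HN; [|easy].
unfold Rdiv in HN; rewrite (Rmult_assoc eps), Rinv_l, Rmult_1_r in HN by lra.
eapply Rle_lt_trans; [|exact HN].
assert (0 <= q ^ N) by (apply pow_le; lra).
nra.
Qed.

Definition dcoef (a : nat -> C) (k : nat) : C := (RtoC (INR (S k)) * a (S k))%C.

(** Lets a polynomial factor in [k] be absorbed by a slight increase of the radius. *)
Lemma bernoulli_bound (h : R) (k : nat) : 0 < h -> INR k <= (1 + h) ^ k / h.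
Proof.
intros Hh; apply Rmult_le_reg_r with h; [easy|].
unfold Rdiv; rewrite Rmult_assoc, Rinv_l, Rmult_1_r by lra.
induction k as [|k IH]; [simpl; lra|]; rewrite S_INR; simpl.
assert (1 <= (1 + h) ^ k) by (apply pow_R1_Rle; lra); nra.
Qed.

(** Second-order Taylor remainder of the [k]-th power. Multiplying by [sigma ^ 2] avoids the
    exponent [k - 2]. The induction rests on: new remainder = [w] times the old one plus
    [k z^(k-1) (w - z)^2]. *)
Lemma pow_increment_quad (sigma : R) (z w : C) (k : nat) : Cmod z <= sigma -> Cmod w <= sigma ->
  sigma ^ 2 * Cmod (w ^ k - z ^ k - RtoC (INR k) * z ^ pred k * (w - z)) <=
  INR k ^ 2 * sigma ^ k * Cmod (w - z) ^ 2.
Proof.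
intros Hz Hw; pose proof (Cmod_ge_0 z) as H0; assert (Hs : 0 <= sigma) by lra.
set (d := Cmod (w - z)).
assert (Hd : 0 <= d) by apply Cmod_ge_0.
induction k as [|k IH].
- simpl; replace (1 - 1 - 0 * 1 * (w - z))%C with (RtoC 0) by ring; rewrite Cmod_0; lra.
- set (E := (w ^ k - z ^ k - RtoC (INR k) * z ^ pred k * (w - z))%C) in *.
  assert (HE : (w ^ S k - z ^ S k - RtoC (INR (S k)) * z ^ pred (S k) * (w - z) =
    w * E + RtoC (INR k) * z ^ pred k * (w - z) ^ 2)%C).
  { unfold E; rewrite S_INR, RtoC_plus; destruct k as [|k]; simpl pred.
    - simpl; ring.
    - rewrite !Cpow_S; ring. }
  rewrite HE; set (P := INR k).
  assert (HP : 0 <= P) by apply pos_INR.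
  assert (Hz2 : sigma ^ 2 * Cmod (RtoC P * z ^ pred k * (w - z) ^ 2) <= P * sigma ^ S k * d ^ 2).
  { rewrite !Cmod_mult, !Cmod_pow, Cmod_R, Rabs_pos_eq by easy; fold d.
    destruct k as [|k].
    - unfold P; simpl; nra.
    - simpl pred; assert (Hp : Cmod z ^ k <= sigma ^ k) by (apply pow_incr; lra).
      replace (sigma ^ 2 * (P * Cmod z ^ k * d ^ 2)) with ((P * d ^ 2 * sigma ^ 2) * Cmod z ^ k) by ring.
      replace (P * sigma ^ S (S k) * d ^ 2) with ((P * d ^ 2 * sigma ^ 2) * sigma ^ k) by (simpl; ring).
      apply Rmult_le_compat_l; [|easy].
      apply Rmult_le_pos; [apply Rmult_le_pos; [easy|apply pow_le; easy]|apply pow_le; easy]. }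
  assert (Hz1 : sigma ^ 2 * Cmod (w * E) <= P ^ 2 * sigma ^ S k * d ^ 2).
  { rewrite Cmod_mult.
    replace (sigma ^ 2 * (Cmod w * Cmod E)) with (Cmod w * (sigma ^ 2 * Cmod E)) by ring.
    replace (P ^ 2 * sigma ^ S k * d ^ 2) with (sigma * (P ^ 2 * sigma ^ k * d ^ 2)) by (simpl; ring).
    apply Rmult_le_compat; try easy; [apply Cmod_ge_0|].
    apply Rmult_le_pos; [apply pow_le; easy|apply Cmod_ge_0]. }
  pose proof (Cmod_triangle (w * E) (RtoC P * z ^ pred k * (w - z) ^ 2)) as Ht.
  apply (Rmult_le_compat_l (sigma ^ 2)) in Ht; [|apply pow_le; easy].
  fold P; rewrite S_INR; fold P.
  assert (0 <= sigma ^ S k * d ^ 2) by (apply Rmult_le_pos; apply pow_le; easy).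
  nra.
Qed.

Lemma dcoef_bound (rad rho : R) (a : nat -> C) (f : C -> C) : pser rad a f -> 0 < rho < rad ->
  exists M : R, forall k : nat, Cmod (dcoef a k) * rho ^ k <= M.
Proof.
intros H Hr.
(* Chosen so that [rho * (1 + h)] is the midpoint of [rho] and [rad]. *)
set (h := (rad - rho) / (2 * rho)); assert (Hh : 0 < h) by (apply Rdiv_lt_0_compat; lra).
destruct (pser_coef_bound rad (rho * (1 + h)) a f H) as [M [HM HB]].
{ replace (rho * (1 + h)) with ((rad + rho) / 2) by (unfold h; field; lra); lra. }
exists (M / (h * rho)); intros k; unfold dcoef.
rewrite Cmod_mult, Cmod_R, Rabs_pos_eq by apply pos_INR.
specialize (HB (S k)); rewrite Rpow_mult_distr in HB.
pose proof (bernoulli_bound h (S k) Hh) as Hb.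
pose proof (Cmod_ge_0 (a (S k))); assert (0 < rho ^ k) by (apply pow_lt; lra).
apply Rle_trans with ((1 + h) ^ S k / h * Cmod (a (S k)) * rho ^ k).
{ apply Rmult_le_compat_r; [lra|]; apply Rmult_le_compat_r; easy. }
replace ((1 + h) ^ S k / h * Cmod (a (S k)) * rho ^ k)
  with (Cmod (a (S k)) * (rho ^ S k * (1 + h) ^ S k) * / (h * rho)) by (simpl; field; lra).
apply Rmult_le_compat_r; [|easy].
left; apply Rinv_0_lt_compat, Rmult_lt_0_compat; lra.
Qed.

(** The series itself has one term more than its derivative, because [dcoef a k] stems from
    [a (S k)]. *)
Lemma csum_cdiff_expand (a : nat -> C) (z w : C) (n : nat) :
  (psum a w (S n) - psum a z (S n)
    - csum (fun k => dcoef a k * z ^ k) n * (w - z) =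
  csum (fun k => a k * (w ^ k - z ^ k - RtoC (INR k) * z ^ pred k * (w - z))) (S n))%C.
Proof.
induction n as [|n IH]; [simpl; ring|].
change (csum (fun k => a k * (w ^ k - z ^ k - RtoC (INR k) * z ^ pred k * (w - z)))%C (S (S n)))
  with (csum (fun k => a k * (w ^ k - z ^ k - RtoC (INR k) * z ^ pred k * (w - z)))%C (S n) +
    a (S n) * (w ^ S n - z ^ S n - RtoC (INR (S n)) * z ^ n * (w - z)))%C.
rewrite <- IH.
change (psum a w (S (S n))) with (psum a w (S n) + a (S n) * w ^ S n)%C.
change (psum a z (S (S n))) with (psum a z (S n) + a (S n) * z ^ S n)%C.
change (csum (fun k => dcoef a k * z ^ k)%C (S n)) with (csum (fun k => dcoef a k * z ^ k) n + dcoef a n * z ^ n)%C.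
unfold dcoef; ring.
Qed.

Lemma clim_plus (u v : nat -> C) (l m : C) :
  clim u l -> clim v m -> clim (fun n => u n + v n)%C (l + m).
Proof.
intros Hu Hv eps He; destruct (Hu (eps / 2)) as [N1 H1]; [lra|].
destruct (Hv (eps / 2)) as [N2 H2]; [lra|].
exists (Nat.max N1 N2); intros n Hn; specialize (H1 n ltac:(lia)); specialize (H2 n ltac:(lia)).
replace (u n + v n - (l + m))%C with ((u n - l) + (v n - m))%C by ring.
pose proof (Cmod_triangle (u n - l) (v n - m)); lra.
Qed.

Lemma clim_scal (c : C) (u : nat -> C) (l : C) : clim u l -> clim (fun n => c * u n)%C (c * l).
Proof.
intros Hu eps He; pose proof (Cmod_ge_0 c).
destruct (Hu (eps / (Cmod c + 1))) as [N HN]; [apply Rdiv_lt_0_compat; lra|].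
exists N; intros n Hn; specialize (HN n Hn).
replace (c * u n - c * l)%C with (c * (u n - l))%C by ring; rewrite Cmod_mult.
apply (Rmult_lt_compat_l (Cmod c + 1)) in HN; [|lra].
replace ((Cmod c + 1) * (eps / (Cmod c + 1))) with eps in HN by (field; lra).
nra.
Qed.

Lemma clim_shift (u : nat -> C) (l : C) : clim u l -> clim (fun n => u (S n)) l.
Proof. intros Hu eps He; destruct (Hu eps He) as [N HN]; exists N; intros; apply HN; lia. Qed.

Lemma clim_ext (u v : nat -> C) (l : C) : (forall n, u n = v n) -> clim u l -> clim v l.
Proof. intros E Hu eps He; destruct (Hu eps He) as [N HN]; exists N; intros; rewrite <- E; auto. Qed.

Lemma pser_cdiff (rad : R) (a : nat -> C) (f f' : C -> C) (z : C) :
  pser rad a f -> pser rad (dcoef a) f' -> Cmod z < rad -> cdiff f z (f' z).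
Proof.
intros Hf Hf' Hz; pose proof (Cmod_ge_0 z).
(* [sigma] bounds the points near [z] and [rho] serves for the coefficients; the gap between them
   pays for the factor [k ^ 2] of [pow_increment_quad]. *)
set (sigma := (2 * Cmod z + rad) / 3); set (rho := (Cmod z + 2 * rad) / 3).
assert (Hs : Cmod z < sigma) by (unfold sigma; lra).
assert (Hsr : 0 < sigma < rho) by (unfold sigma, rho; lra).
assert (HrR : 0 <= rho < rad) by (unfold rho; lra).
destruct (pser_coef_bound rad rho a f Hf HrR) as [M [HM HB]].
set (t := sqrt (sigma / rho)).
assert (Ht2 : t * t = sigma / rho) by (apply sqrt_sqrt, Rmult_le_pos; [lra|left; apply Rinv_0_lt_compat; lra]).
assert (Hsr1 : 0 < sigma / rho < 1).
{ split; [apply Rdiv_lt_0_compat; lra|]; apply Rmult_lt_reg_r with rho; [lra|].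
  unfold Rdiv; rewrite Rmult_assoc, Rinv_l; lra. }
assert (Ht : 0 < t < 1) by (split; [apply sqrt_lt_R0; lra|rewrite <- sqrt_1; apply sqrt_lt_1; lra]).
(* [(1 + h)^2 sigma / rho = q < 1], so the factor [k^2] is absorbed by a geometric sequence. *)
set (h := (1 - t) / (2 * t)); assert (Hh : 0 < h) by (apply Rdiv_lt_0_compat; lra).
set (q := (1 + t) ^ 2 / 4); assert (Hq : 0 <= q < 1) by (unfold q; split; nra).
assert (Hhq : (1 + h) ^ 2 * (sigma / rho) = q) by (rewrite <- Ht2; unfold h, q; field; lra).
set (B := M * / h ^ 2 * / sigma ^ 2 * / (1 - q)).
assert (HBp : 0 < B).
{ unfold B; repeat apply Rmult_lt_0_compat; try lra; apply Rinv_0_lt_compat; try lra; apply pow_lt; lra. }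
assert (Hmain : forall w : C, Cmod w < sigma -> Cmod (f w - f z - f' z * (w - z)) <= B * Cmod (w - z) ^ 2).
{ intros w Hw.
  replace (f w - f z - f' z * (w - z))%C with (f w - f z - f' z * (w - z) - 0)%C by ring.
  apply clim_bound with (fun n => psum a w (S n) + - (1) * psum a z (S n)
    + (- (w - z)) * csum (fun k => dcoef a k * z ^ k) n)%C.
  - replace (f w - f z - f' z * (w - z))%C with (f w + - (1) * f z + (- (w - z)) * f' z)%C by ring.
    apply clim_plus; [apply clim_plus; [|apply clim_scal]|apply clim_scal].
    + apply (clim_shift (psum a w)), Hf; lra.
    + apply (clim_shift (psum a z)), Hf; lra.
    + now apply Hf'.
  - exists O; intros n _.
    replace (_ - 0)%C with (psum a w (S n) - psum a z (S n)
      - csum (fun k => dcoef a k * z ^ k) n * (w - z))%C by ring.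
    rewrite csum_cdiff_expand.
    replace (B * Cmod (w - z) ^ 2) with ((M * / h ^ 2 * / sigma ^ 2 * Cmod (w - z) ^ 2) * / (1 - q)) by (unfold B; ring).
    apply csum_geom_bound; [easy|]; intros k; rewrite Cmod_mult.
    set (D := Cmod (w ^ k - z ^ k - RtoC (INR k) * z ^ pred k * (w - z))).
    assert (HD : D <= INR k ^ 2 * sigma ^ k * Cmod (w - z) ^ 2 * / sigma ^ 2).
    { assert (0 < sigma ^ 2) by (apply pow_lt; lra).
      apply Rmult_le_reg_l with (sigma ^ 2); [easy|].
      replace (sigma ^ 2 * (INR k ^ 2 * sigma ^ k * Cmod (w - z) ^ 2 * / sigma ^ 2))
        with (INR k ^ 2 * sigma ^ k * Cmod (w - z) ^ 2) by (field; lra).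
      apply pow_increment_quad; lra. }
    assert (Hk : INR k ^ 2 <= ((1 + h) ^ k / h) ^ 2).
    { apply pow_incr; split; [apply pos_INR|now apply bernoulli_bound]. }
    specialize (HB k); assert (0 < rho ^ k) by (apply pow_lt; lra); assert (0 < sigma ^ k) by (apply pow_lt; lra).
    pose proof (Cmod_ge_0 (a k)).
    assert (Ha : Cmod (a k) <= M * / rho ^ k).
    { apply Rmult_le_reg_r with (rho ^ k); [easy|]; rewrite Rmult_assoc, Rinv_l; lra. }
    assert (Hsp : 0 < / sigma ^ 2) by (apply Rinv_0_lt_compat, pow_lt; lra).
    assert (Hc2 : 0 <= Cmod (w - z) ^ 2) by apply pow2_ge_0.
    apply Rle_trans with (M * / rho ^ k * (((1 + h) ^ k / h) ^ 2 * sigma ^ k * Cmod (w - z) ^ 2 * / sigma ^ 2)).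
    { apply Rmult_le_compat; [easy|apply Cmod_ge_0|easy|].
      eapply Rle_trans; [exact HD|].
      repeat (apply Rmult_le_compat_r; [lra|]); easy. }
    right; rewrite <- Hhq; unfold Rdiv; rewrite !Rpow_mult_distr, !pow_inv, <- !pow_mult.
    rewrite (Nat.mul_comm k 2); field; repeat split; try lra; try (apply pow_nonzero; lra). }
apply cdiff_of_eps; intros eps He.
exists (Rmin (sigma - Cmod z) (eps / B)); split.
{ apply Rmin_glb_lt; [lra|now apply Rdiv_lt_0_compat]. }
intros w Hw; destruct (Rmin_Rgt_l _ _ _ Hw) as [Hw1 Hw2].
eapply Rle_trans; [apply Hmain|].
- pose proof (Cmod_le_shift w z); lra.
- replace (B * Cmod (w - z) ^ 2) with (B * Cmod (w - z) * Cmod (w - z)) by ring.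
  apply Rmult_le_compat_r; [apply Cmod_ge_0|].
  apply Rlt_le in Hw2; apply (Rmult_le_compat_l B) in Hw2; [|lra].
  replace (B * (eps / B)) with eps in Hw2 by (field; lra); easy.
Qed.

(** Continuity of the derivative is built in because [cauchy_homotopy] differentiates under the
    integral sign; power series supply it. *)
Definition hol (rad : R) (f f' : C -> C) : Prop :=
  forall z : C, Cmod z < rad -> cdiff f z (f' z) /\ ccont f' z.

Lemma pser_dcoef (rad : R) (a : nat -> C) (f : C -> C) : pser rad a f ->
  exists f' : C -> C, pser rad (dcoef a) f'.
Proof. intros H; apply pser_exists; intros rho Hr; now apply dcoef_bound with rad f. Qed.

Lemma pser_hol (rad : R) (a : nat -> C) (f f' : C -> C) :
  pser rad a f -> pser rad (dcoef a) f' -> hol rad f f'.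
Proof.
intros H H' z Hz; split; [now apply pser_cdiff with rad a|].
destruct (pser_dcoef rad (dcoef a) f' H') as [f'' H''].
apply cdiff_cont with (f'' z); now apply pser_cdiff with rad (dcoef a).
Qed.

(** A Taylor expansion with [n] terms and error [O(t^n)]. Uniqueness of power series coefficients is
    proved at this level, one coefficient at a time. *)
Definition jet (n : nat) (f : C -> C) (a : nat -> C) : Prop :=
  exists d M : R, 0 < d /\ forall t : C, Cmod t < d ->
    Cmod (f t - psum a t n) <= M * Cmod t ^ n.

Lemma pser_jet (rad : R) (a : nat -> C) (f : C -> C) (n : nat) : 0 < rad -> pser rad a f -> jet n f a.
Proof.
intros HR H; destruct (pser_coef_bound rad (rad / 2) a f H) as [M [HM HB]]; [lra|].
exists (rad / 4), (M * / (rad / 2) ^ n * 2); split; [lra|]; intros t Ht; pose proof (Cmod_ge_0 t).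
eapply Rle_trans; [apply (pser_remainder rad (rad / 2) M)|]; try easy; try lra.
unfold Rdiv at 1; rewrite Rpow_mult_distr, pow_inv.
replace (M * / (rad / 2) ^ n * 2 * Cmod t ^ n) with (M * (Cmod t ^ n * / (rad / 2) ^ n) * 2) by ring.
assert (0 <= Cmod t ^ n) by (apply pow_le; lra).
assert (0 < (rad / 2) ^ n) by (apply pow_lt; lra).
apply Rmult_le_compat_l.
- apply Rmult_le_pos; [lra|apply Rmult_le_pos; [easy|left; now apply Rinv_0_lt_compat]].
- replace 2 with (/ (1 / 2)) at 2 by field.
  apply Rinv_le_contravar; [lra|].
  assert (Cmod t / (rad / 2) <= 1 / 2); [|lra].
  apply Rmult_le_reg_r with (rad / 2); [lra|]; unfold Rdiv at 1; rewrite Rmult_assoc, Rinv_l; lra.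
Qed.

Lemma small_linear_zero (x M d : R) : 0 < d -> 0 <= x ->
  (forall s : R, 0 < s < d -> x <= M * s) -> x = 0.
Proof.
intros Hd Hx H; destruct (Rle_lt_or_eq_dec 0 x Hx) as [Hp|]; [exfalso|easy].
pose proof (Rabs_pos M); pose proof (Rle_abs M).
set (s := Rmin (d / 2) (x / (2 * (Rabs M + 1)))).
assert (Hs0 : 0 < s) by (apply Rmin_glb_lt; [lra|apply Rdiv_lt_0_compat; lra]).
assert (Hs1 : s <= d / 2) by apply Rmin_l; assert (Hs2 : s <= x / (2 * (Rabs M + 1))) by apply Rmin_r.
specialize (H s ltac:(lra)).
apply (Rmult_le_compat_l (2 * (Rabs M + 1))) in Hs2; [|lra].
replace (2 * (Rabs M + 1) * (x / (2 * (Rabs M + 1)))) with x in Hs2 by (field; lra).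
nra.
Qed.

Lemma jet_pred (n : nat) (f : C -> C) (a : nat -> C) : jet (S n) f a -> jet n f a.
Proof.
intros [d [M [Hd H]]]; exists (Rmin d 1), (Rabs M + Cmod (a n)); split; [apply Rmin_glb_lt; lra|].
intros t Ht; destruct (Rmin_Rgt_l _ _ _ Ht) as [Ht1 Ht2].
specialize (H t Ht1); simpl csum in H.
replace (f t - psum a t n)%C
  with (f t - (psum a t n + a n * t ^ n) + a n * t ^ n)%C by ring.
eapply Rle_trans; [apply Cmod_triangle|]; rewrite (Cmod_mult (a n)), Cmod_pow.
pose proof (Cmod_ge_0 t); assert (0 <= Cmod t ^ n) by (apply pow_le; lra).
pose proof (Rle_abs M); pose proof (Rabs_pos M); simpl in H.
assert (M * (Cmod t * Cmod t ^ n) <= Rabs M * Cmod t ^ n); [|lra].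
apply Rle_trans with (Rabs M * (Cmod t * Cmod t ^ n)); [apply Rmult_le_compat_r; nra|].
apply Rmult_le_compat_l; [easy|nra].
Qed.

(** Once the first [n] coefficients agree, subtracting the two expansions at a small real [s] gives
    [|a n - b n| s^n <= (M1 + M2) s^(n+1)]. *)
Lemma jet_unique (n : nat) (f : C -> C) (a b : nat -> C) : jet n f a -> jet n f b ->
  forall k : nat, (k < n)%nat -> a k = b k.
Proof.
induction n as [|n IH]; [lia|]; intros Ha Hb.
assert (IH' := IH (jet_pred _ _ _ Ha) (jet_pred _ _ _ Hb)).
intros k Hk; destruct (Nat.eq_dec k n) as [->|]; [|apply IH'; lia].
destruct Ha as [d1 [M1 [Hd1 H1]]]; destruct Hb as [d2 [M2 [Hd2 H2]]].
assert (E : Cmod (a n - b n) = 0).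
{ apply small_linear_zero with (M1 + M2) (Rmin d1 d2); [now apply Rmin_glb_lt|apply Cmod_ge_0|].
  intros s Hs; assert (Hms : Cmod (RtoC s) = s) by (rewrite Cmod_R, Rabs_pos_eq; lra).
  specialize (H1 (RtoC s)); specialize (H2 (RtoC s)); rewrite Hms in H1, H2.
  pose proof (Rmin_l d1 d2); pose proof (Rmin_r d1 d2).
  assert (Hp : 0 < s ^ n) by (apply pow_lt; lra).
  apply Rmult_le_reg_r with (s ^ n); [easy|].
  simpl csum in H1, H2.
  rewrite (csum_ext (fun k => b k * RtoC s ^ k)%C (fun k => a k * RtoC s ^ k)%C) in H2
    by (intros j Hj; now rewrite IH').
  set (X := psum a (RtoC s) n) in *.
  pose proof (Cmod_triangle (f s - (X + b n * RtoC s ^ n)) (- (f s - (X + a n * RtoC s ^ n)))) as Ht.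
  rewrite Cmod_opp in Ht.
  replace (_ + - _)%C with ((a n - b n) * RtoC s ^ n)%C in Ht by ring.
  rewrite Cmod_mult, Cmod_pow, Hms in Ht; simpl in H1, H2; nra. }
apply Cmod_eq_0 in E; replace (a n) with (a n - b n + b n)%C by ring; rewrite E; ring.
Qed.

Lemma jet_ext_loc (n : nat) (f g : C -> C) (a : nat -> C) (r : R) : 0 < r ->
  (forall t : C, Cmod t < r -> f t = g t) -> jet n f a -> jet n g a.
Proof.
intros Hr E [d [M [Hd H]]]; exists (Rmin r d), M; split; [now apply Rmin_glb_lt|]; intros t Ht.
rewrite <- E by (eapply Rlt_le_trans; [exact Ht|apply Rmin_l]).
apply H; eapply Rlt_le_trans; [exact Ht|apply Rmin_r].
Qed.

Lemma pser_unique (R1 R2 r : R) (a b : nat -> C) (f g : C -> C) : 0 < R1 -> 0 < R2 -> 0 < r ->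
  pser R1 a f -> pser R2 b g -> (forall t : C, Cmod t < r -> f t = g t) ->
  forall k : nat, a k = b k.
Proof.
intros H1 H2 Hr Ha Hb E k; apply (jet_unique (S k) g a b); [|now apply pser_jet with R2|lia].
apply jet_ext_loc with f r; [easy|easy|now apply pser_jet with R1].
Qed.

Lemma pser_at_0 (rad : R) (a : nat -> C) (f : C -> C) : 0 < rad -> pser rad a f -> f 0 = a O.
Proof.
intros HR H; apply clim_unique with (psum a (RtoC 0)); [apply H; rewrite Cmod_0; easy|].
intros eps He; exists 1%nat; intros n Hn; destruct n as [|n]; [lia|].
rewrite csum_shift, (csum_ext _ (fun k => 0 * 0)%C), csum_scal.
- simpl; replace (_ - _)%C with (RtoC 0) by ring; now rewrite Cmod_0.
- intros k _; rewrite Cpow_0_l by lia; ring.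
Qed.

(** * Circle means *)

Lemma continuous_of_eps (u : R -> R) (x : R) :
  (forall eps : R, 0 < eps -> exists d : R, 0 < d /\
    forall y : R, Rabs (y - x) < d -> Rabs (u y - u x) < eps) -> continuous u x.
Proof.
intros H P [eps HP]; destruct (H eps (cond_pos eps)) as [d [Hd H']].
exists (mkposreal d Hd); intros y Hy; apply HP, H', Hy.
Qed.

Lemma Cmod_RtoC_minus (x y : R) : Cmod (RtoC x - RtoC y) = Rabs (x - y).
Proof. now rewrite <- RtoC_minus, Cmod_R. Qed.

Lemma Re_minus_le (a b : C) : Rabs (Re a - Re b) <= Cmod (a - b).
Proof. replace (Re a - Re b) with (Re (a - b)) by (unfold Re; simpl; ring); apply re_le_Cmod. Qed.

Lemma Im_minus_le (a b : C) : Rabs (Im a - Im b) <= Cmod (a - b).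
Proof. replace (Im a - Im b) with (Im (a - b)) by (unfold Im; simpl; ring); apply im_le_Cmod. Qed.

Lemma Cmod_minus_le (a b : C) : Rabs (Cmod a - Cmod b) <= Cmod (a - b).
Proof.
pose proof (Cmod_rev_triangle a b); pose proof (Cmod_rev_triangle b a).
rewrite (Cmod_minus_sym b a) in *; apply Rabs_le; lra.
Qed.

Lemma continuous_part (p : C -> R) (H : C -> C) (t : R) :
  (forall a b : C, Rabs (p a - p b) <= Cmod (a - b)) -> ccont H (RtoC t) ->
  continuous (fun s : R => p (H (RtoC s))) t.
Proof.
intros Hp Hc; apply continuous_of_eps; intros eps He; destruct (Hc eps He) as [d [Hd H']].
exists d; split; [easy|]; intros y Hy; eapply Rle_lt_trans; [apply Hp|apply H'].
now rewrite Cmod_RtoC_minus.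
Qed.

Definition mean (u : R -> R) : R := RInt u 0 (2 * PI) / (2 * PI).

Definition Cmean (H : R -> C) : C := (mean (fun t => Re (H t)), mean (fun t => Im (H t))).

Definition cts (u : R -> R) : Prop := forall t : R, continuous u t.

Lemma cts_ex_RInt (u : R -> R) (a b : R) : cts u -> ex_RInt u a b.
Proof. intros H; apply (@ex_RInt_continuous R_CompleteNormedModule); intros; apply H. Qed.

Lemma two_PI_pos : 0 < 2 * PI.
Proof. pose proof PI_RGT_0; lra. Qed.

Lemma mean_ext (u v : R -> R) : (forall t : R, u t = v t) -> mean u = mean v.
Proof. intros H; unfold mean; f_equal; now apply RInt_ext. Qed.

Lemma mean_plus (u v : R -> R) : cts u -> cts v -> mean (fun t => u t + v t) = mean u + mean v.
Proof.
intros Hu Hv; unfold mean.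
pose proof (RInt_plus u v 0 (2 * PI) (cts_ex_RInt _ _ _ Hu) (cts_ex_RInt _ _ _ Hv)) as E.
unfold plus in E; simpl in E; rewrite E; unfold Rdiv; ring.
Qed.

Lemma mean_scal (c : R) (u : R -> R) : cts u -> mean (fun t => c * u t) = c * mean u.
Proof.
intros Hu; unfold mean.
pose proof (RInt_scal u 0 (2 * PI) c (cts_ex_RInt _ _ _ Hu)) as E.
unfold scal in E; simpl in E; unfold mult in E; simpl in E; rewrite E; unfold Rdiv; ring.
Qed.

Lemma mean_const (c : R) : mean (fun _ => c) = c.
Proof.
unfold mean; rewrite RInt_const; unfold scal; simpl; unfold mult; simpl.
pose proof two_PI_pos; field; lra.
Qed.

Lemma mean_le (u v : R -> R) : cts u -> cts v ->
  (forall t : R, 0 <= t <= 2 * PI -> u t <= v t) -> mean u <= mean v.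
Proof.
intros Hu Hv H; unfold mean; pose proof two_PI_pos.
apply Rmult_le_compat_r; [left; now apply Rinv_0_lt_compat|].
apply RInt_le; [lra|now apply cts_ex_RInt|now apply cts_ex_RInt|intros; apply H; lra].
Qed.

Lemma cts_plus (u v : R -> R) : cts u -> cts v -> cts (fun t => u t + v t).
Proof. intros Hu Hv t; apply (@continuous_plus R_UniformSpace R_AbsRing R_NormedModule); auto. Qed.

Lemma cts_scal (c : R) (u : R -> R) : cts u -> cts (fun t => c * u t).
Proof. intros Hu t; apply (@continuous_scal_r R_UniformSpace R_AbsRing R_NormedModule); auto. Qed.

Lemma cts_const (c : R) : cts (fun _ => c).
Proof. intros t; apply continuous_const. Qed.

Lemma mean_minus (u v : R -> R) : cts u -> cts v -> mean (fun t => u t - v t) = mean u - mean v.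
Proof.
intros Hu Hv; rewrite (mean_ext _ (fun t => u t + (-1) * v t)) by (intros; ring).
rewrite mean_plus, mean_scal; try easy; [ring|now apply cts_scal].
Qed.

(** Integrands over a real parameter are kept as functions of a complex one, so that the calculus of
    [ccont] and [cdiff] applies to them unchanged. *)
Definition ccts (H : C -> C) : Prop := forall t : R, ccont H (RtoC t).

Lemma ccts_Re (H : C -> C) : ccts H -> cts (fun t => Re (H (RtoC t))).
Proof. intros Hc t; apply continuous_part; [apply Re_minus_le|apply Hc]. Qed.

Lemma ccts_Im (H : C -> C) : ccts H -> cts (fun t => Im (H (RtoC t))).
Proof. intros Hc t; apply continuous_part; [apply Im_minus_le|apply Hc]. Qed.

Lemma ccts_Cmod (H : C -> C) : ccts H -> cts (fun t => Cmod (H (RtoC t))).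
Proof. intros Hc t; apply continuous_part; [apply Cmod_minus_le|apply Hc]. Qed.

Lemma Cmean_ext (H K : R -> C) : (forall t : R, H t = K t) -> Cmean H = Cmean K.
Proof. intros E; unfold Cmean; f_equal; apply mean_ext; intros; now rewrite E. Qed.

Lemma Cmean_plus (H K : C -> C) : ccts H -> ccts K ->
  Cmean (fun t => H t + K t)%C = (Cmean (fun t => H t) + Cmean (fun t => K t))%C.
Proof.
intros Hh Hk; unfold Cmean; apply injective_projections; simpl.
- apply mean_plus; now apply ccts_Re.
- apply mean_plus; now apply ccts_Im.
Qed.

Lemma Cmean_scal (c : C) (H : C -> C) : ccts H ->
  Cmean (fun t => c * H t)%C = (c * Cmean (fun t => H t))%C.
Proof.
intros Hh; pose proof (ccts_Re H Hh) as Hr; pose proof (ccts_Im H Hh) as Hi.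
destruct c as [x y]; unfold Cmean, Re, Im in *; apply injective_projections; simpl.
- rewrite mean_minus by (apply cts_scal; assumption); now rewrite !mean_scal by assumption.
- rewrite mean_plus by (apply cts_scal; assumption); now rewrite !mean_scal by assumption.
Qed.

(** The factor 2 comes from bounding real and imaginary parts separately, and is harmless in all
    uses. *)
Lemma Cmean_bound (H : C -> C) (M : R) : ccts H ->
  (forall t : R, 0 <= t <= 2 * PI -> Cmod (H t) <= M) -> Cmod (Cmean (fun t => H t)) <= 2 * M.
Proof.
intros Hc HM; eapply Rle_trans; [apply Cmod_le_sum|]; unfold Cmean, Re at 1, Im at 1; simpl.
assert (A : forall p : C -> R, (forall z, Rabs (p z) <= Cmod z) -> cts (fun t => p (H (RtoC t))) ->
  Rabs (mean (fun t => p (H (RtoC t)))) <= M).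
{ intros p Hp Hpc; apply Rabs_le; split.
  - rewrite <- (mean_const (- M)); apply mean_le; [apply cts_const|easy|intros t Ht].
    pose proof (Hp (H t)) as Hb; apply Rabs_le_between in Hb; specialize (HM t Ht); lra.
  - rewrite <- (mean_const M); apply mean_le; [easy|apply cts_const|intros t Ht].
    pose proof (Hp (H t)) as Hb; apply Rabs_le_between in Hb; specialize (HM t Ht); lra. }
pose proof (A Re re_le_Cmod (ccts_Re H Hc)); pose proof (A Im im_le_Cmod (ccts_Im H Hc)); lra.
Qed.

Lemma cdiff_is_derive_part (p : C -> R) (G : C -> C) (t : R) (l : C) :
  (forall a b : C, p (a - b)%C = p a - p b) -> (forall z : C, Rabs (p z) <= Cmod z) ->
  (forall (x : R) (a : C), p (a * RtoC x)%C = p a * x) ->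
  cdiff G (RtoC t) l -> is_derive (fun s : R => p (G (RtoC s))) t (p l).
Proof.
intros Hm Hb Hl HG; split; [apply is_linear_scal_l|].
intros x Hx; apply (@is_filter_lim_locally_unique R_AbsRing (AbsRing_NormedModule R_AbsRing)) in Hx; subst x.
intros eps; destruct (cdiff_lim_eps G _ l HG eps (cond_pos eps)) as [d [Hd H]].
exists (mkposreal d Hd); intros y Hy.
assert (Hy' : Rabs (y - t) < d) by exact Hy.
specialize (H (RtoC y)); rewrite Cmod_RtoC_minus in H; specialize (H Hy').
unfold norm, minus, plus, opp, scal; simpl; unfold mult, abs; simpl.
eapply Rle_trans; [|exact H].
replace (p (G (RtoC y)) + - p (G (RtoC t)) + - ((y + - t) * p l))
  with (p (G (RtoC y) - G (RtoC t) - l * (RtoC y - RtoC t))%C); [apply Hb|].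
rewrite <- RtoC_minus, !Hm, Hl; ring.
Qed.

Lemma cdiff_is_derive_Re (G : C -> C) (t : R) (l : C) :
  cdiff G (RtoC t) l -> is_derive (fun s : R => Re (G (RtoC s))) t (Re l).
Proof.
apply cdiff_is_derive_part; [intros; unfold Re; simpl; ring|apply re_le_Cmod|].
intros; unfold Re; simpl; ring.
Qed.

Lemma cdiff_is_derive_Im (G : C -> C) (t : R) (l : C) :
  cdiff G (RtoC t) l -> is_derive (fun s : R => Im (G (RtoC s))) t (Im l).
Proof.
apply cdiff_is_derive_part; [intros; unfold Im; simpl; ring|apply im_le_Cmod|].
intros; unfold Im; simpl; ring.
Qed.

Lemma Cmean_derive (G G' : C -> C) : (forall t : R, cdiff G (RtoC t) (G' (RtoC t))) -> ccts G' ->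
  G (RtoC (2 * PI)) = G 0 -> Cmean (fun t => G' t) = 0.
Proof.
intros HG HG' HE; unfold Cmean, mean.
assert (A : forall p : C -> R, (forall t : R, is_derive (fun s : R => p (G (RtoC s))) t (p (G' (RtoC t)))) ->
  cts (fun t => p (G' (RtoC t))) -> RInt (fun t => p (G' (RtoC t))) 0 (2 * PI) / (2 * PI) = 0).
{ intros p Hd Hc.
  rewrite (is_RInt_unique _ _ _ _ (is_RInt_derive (fun s => p (G (RtoC s))) _ 0 (2 * PI) (fun x _ => Hd x) (fun x _ => Hc x))).
  rewrite HE; unfold minus, plus, opp; simpl; unfold Rdiv; ring. }
apply injective_projections; simpl.
- apply A; [intros; now apply cdiff_is_derive_Re|now apply ccts_Re].
- apply A; [intros; now apply cdiff_is_derive_Im|now apply ccts_Im].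
Qed.

(** At real [w] this runs over the circle of radius [r]; complex [w] are allowed so that it can be
    differentiated with [cdiff]. *)
Definition circ (r : R) (w : C) : C := (RtoC r * Cexp (Ci * w))%C.

Lemma Cmod_circ (r t : R) : 0 <= r -> Cmod (circ r t) = r.
Proof.
intros Hr; unfold circ; rewrite Cmod_mult, Cmod_Cexp, Cmod_R, Rabs_pos_eq by easy.
unfold Re; simpl; replace (0 * t - 1 * 0) with 0 by ring; rewrite exp_0; ring.
Qed.

Lemma circ_polar (r t : R) : circ r t = (r * cos t, r * sin t).
Proof.
unfold circ, Cexp, Re, Im; simpl.
replace (0 * t - 1 * 0) with 0 by ring; replace (0 * 0 + 1 * t) with t by ring.
rewrite exp_0; apply injective_projections; simpl; ring.
Qed.

Lemma circ_surj (z : C) : z <> 0 -> exists t : R, 0 <= t <= 2 * PI /\ circ (Cmod z) t = z.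
Proof.
intros Hz; destruct (polar_form z Hz) as [t [Ht E]]; exists t; split; [easy|].
now rewrite circ_polar.
Qed.

Lemma circ_reduce (r t : R) : 0 < r -> exists s : R, 0 <= s <= 2 * PI /\ circ r s = circ r t.
Proof.
intros Hr; assert (Hm : Cmod (circ r t) = r) by (apply Cmod_circ; lra).
destruct (circ_surj (circ r t)) as [s [Hs E]]; [apply Cmod_gt_0; lra|].
rewrite Hm in E; now exists s.
Qed.

Lemma cdiff_circ (r : R) (w : C) : cdiff (circ r) w (Ci * circ r w).
Proof.
unfold circ; eapply cdiff_eq;
  [|apply cdiff_scal, (cdiff_comp Cexp (fun w => Ci * w)%C); [apply cdiff_scal, cdiff_id|apply cdiff_Cexp]].
cbv beta; ring.
Qed.

Lemma ccont_circ (r : R) (w : C) : ccont (circ r) w.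
Proof. eapply cdiff_cont, cdiff_circ. Qed.

Lemma Cexp_2PI (z : C) : Cexp (z + Ci * RtoC (2 * PI)) = Cexp z.
Proof.
rewrite Cexp_plus; unfold Cexp at 2, Re, Im; simpl.
replace (0 * (2 * PI) - 1 * 0) with 0 by ring; replace (0 * 0 + 1 * (2 * PI)) with (2 * PI) by ring.
rewrite exp_0, cos_2PI, sin_2PI; unfold Cmult; destruct (Cexp z); simpl.
apply injective_projections; simpl; ring.
Qed.

Lemma circ_period (r : R) : circ r (RtoC (2 * PI)) = circ r 0.
Proof.
unfold circ; f_equal; rewrite <- (Cexp_2PI (Ci * 0)); f_equal; ring.
Qed.

Lemma circ_neq_0 (r : R) (w : C) : 0 < r -> circ r w <> 0.
Proof.
intros Hr; unfold circ; apply Cmult_neq_0; [apply Cmod_gt_0; rewrite Cmod_R, Rabs_pos_eq; lra|apply Cexp_neq_0].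
Qed.

Lemma cdiff_pow (f : C -> C) (z l : C) (n : nat) : cdiff f z l ->
  cdiff (fun w => f w ^ n)%C z (RtoC (INR n) * f z ^ pred n * l).
Proof.
intros Hf; induction n as [|n IH].
- apply cdiff_ext_loc with (fun _ => RtoC 1) 1; [lra|easy|].
  eapply cdiff_eq; [|apply cdiff_const]; simpl; ring.
- apply cdiff_ext_loc with (fun w => f w * f w ^ n)%C 1; [lra|easy|].
  eapply cdiff_eq; [|apply cdiff_mult; [exact Hf|exact IH]].
  rewrite S_INR, RtoC_plus; destruct n as [|n]; simpl pred; [simpl; ring|rewrite Cpow_S; ring].
Qed.

Lemma ccont_pow (f : C -> C) (z : C) (n : nat) : ccont f z -> ccont (fun w => f w ^ n)%C z.
Proof.
intros Hf; induction n as [|n IH]; [apply (ccont_const 1)|].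
apply ccont_ext_loc with (fun w => f w * f w ^ n)%C 1; [lra|easy|now apply ccont_mult].
Qed.

Lemma Cmean_circ_pow (r : R) (n : nat) : (0 < n)%nat -> Cmean (fun t => circ r t ^ n)%C = 0.
Proof.
intros Hn; assert (Hc : (Ci * RtoC (INR n))%C <> 0).
{ apply Cmult_neq_0; [apply Cmod_gt_0; rewrite Cmod_Ci; lra|].
  apply Cmod_gt_0; rewrite Cmod_R, Rabs_pos_eq by apply pos_INR; now apply lt_0_INR. }
apply (Cmean_derive (fun w => / (Ci * RtoC (INR n)) * circ r w ^ n)%C (fun w => circ r w ^ n)%C).
- intros t; eapply cdiff_eq; [|apply cdiff_scal, cdiff_pow, cdiff_circ].
  destruct n as [|n]; [lia|]; simpl pred; rewrite Cpow_S; field.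
  split; intros E; apply Hc; rewrite E; ring.
- intros t; apply ccont_pow, ccont_circ.
- now rewrite circ_period.
Qed.

(** The inverse of [circ r w] is [circ (/ r) (- w)], so a negative power is a positive power on a
    circle run backwards, and has a periodic primitive again. *)
Lemma Cmean_circ_inv_pow (r : R) (n : nat) : 0 < r -> (0 < n)%nat ->
  Cmean (fun t => / circ r t ^ n)%C = 0.
Proof.
intros Hr Hn.
assert (HI : forall w : C, (/ circ r w = circ (/ r) (- w))%C).
{ intros w; unfold circ; replace (Ci * - w)%C with (- (Ci * w))%C by ring.
  rewrite Cexp_opp, RtoC_inv by lra; field; split; [apply Cexp_neq_0|].
  apply Cmod_gt_0; rewrite Cmod_R, Rabs_pos_eq; lra. }
assert (Hc : (Ci * RtoC (INR n))%C <> 0).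
{ apply Cmult_neq_0; [apply Cmod_gt_0; rewrite Cmod_Ci; lra|].
  apply Cmod_gt_0; rewrite Cmod_R, Rabs_pos_eq by apply pos_INR; now apply lt_0_INR. }
assert (E : forall w : C, (/ circ r w ^ n = circ (/ r) (- (1) * w) ^ n)%C).
{ intros w; rewrite <- Cpow_inv by now apply circ_neq_0.
  rewrite HI; replace (- (1) * w)%C with (- w)%C by ring; reflexivity. }
rewrite (Cmean_ext _ _ (fun t => E (RtoC t))).
apply (Cmean_derive (fun w => - / (Ci * RtoC (INR n)) * circ (/ r) (- (1) * w) ^ n)%C
  (fun w => circ (/ r) (- (1) * w) ^ n)%C).
- intros t; eapply cdiff_eq.
  2:{ apply cdiff_scal, cdiff_pow, (cdiff_comp (circ (/ r)) (fun w => - (1) * w)%C);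
      [apply cdiff_scal, cdiff_id|apply cdiff_circ]. }
  destruct n as [|n]; [lia|]; simpl pred; rewrite Cpow_S; field.
  split; intros E'; apply Hc; rewrite E'; ring.
- intros t; apply ccont_pow, (ccont_comp (circ (/ r)) (fun w => - (1) * w)%C); [|apply ccont_circ].
  apply ccont_mult; [apply ccont_const|apply ccont_id].
- cbv beta; rewrite <- !E; now rewrite circ_period.
Qed.

(** * Cauchy's formula *)

Lemma circ_minus_neq_0 (r : R) (z : C) (t : R) : Cmod z < r -> (circ r t - z)%C <> 0.
Proof.
intros Hz E; pose proof (Cmod_ge_0 z); assert (Hr : 0 <= r) by lra.
assert (E' : circ r t = z) by (replace (circ r t) with (circ r t - z + z)%C by ring; rewrite E; ring).
rewrite <- E', Cmod_circ in Hz; lra.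
Qed.

(** Cauchy's kernel [dzeta / (2 pi i (zeta - z))] in the angular parameter, since
    [dzeta = i zeta dt]. *)
Definition cauchy_kernel (r : R) (z w : C) : C := (circ r w / (circ r w - z))%C.

Lemma ccts_cauchy_kernel (r : R) (z : C) : Cmod z < r -> ccts (cauchy_kernel r z).
Proof.
intros Hz t; apply ccont_div; [apply ccont_circ| |now apply circ_minus_neq_0].
apply ccont_minus; [apply ccont_circ|apply ccont_const].
Qed.

Lemma cauchy_kernel_bound (r : R) (z : C) (t : R) : Cmod z < r ->
  Cmod (cauchy_kernel r z t) <= r / (r - Cmod z).
Proof.
intros Hz; pose proof (Cmod_ge_0 z); unfold cauchy_kernel.
rewrite Cmod_div by now apply circ_minus_neq_0.
rewrite Cmod_circ by lra; apply Rmult_le_compat_l; [lra|].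
apply Rinv_le_contravar; [lra|].
pose proof (Cmod_rev_triangle (circ r t) z) as Ht; rewrite Cmod_circ in Ht; lra.
Qed.

Lemma ccts_mult (H K : C -> C) : ccts H -> ccts K -> ccts (fun w => H w * K w)%C.
Proof. intros Hh Hk t; now apply ccont_mult. Qed.

Lemma ccts_circ_inv_pow (r : R) (n : nat) : 0 < r -> ccts (fun w => / circ r w ^ n)%C.
Proof.
intros Hr t; apply (ccont_comp Cinv (fun w => circ r w ^ n)%C).
- apply ccont_pow, ccont_circ.
- apply ccont_inv, Cpow_nz, circ_neq_0, Hr.
Qed.

Lemma cauchy_series (H : C -> C) (M r : R) (z : C) : ccts H ->
  (forall t : R, 0 <= t <= 2 * PI -> Cmod (H t) <= M) ->
  Cmod z < r ->
  clim (csum (fun k => Cmean (fun t => H t * / circ r t ^ k) * z ^ k)%C)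
    (Cmean (fun t => H t * cauchy_kernel r z t)%C).
Proof.
intros Hc HM Hz; pose proof (Cmod_ge_0 z) as Hz0; assert (Hr : 0 < r) by lra.
set (K := cauchy_kernel r z); assert (HK : ccts K) by now apply ccts_cauchy_kernel.
assert (HP : forall n : nat, ccts (fun w => H w * / circ r w ^ n)%C).
{ intros n; apply ccts_mult; [easy|now apply ccts_circ_inv_pow]. }
assert (HPK : forall n : nat, ccts (fun w => H w * / circ r w ^ n * K w)%C).
{ intros n; now apply ccts_mult. }
(* The kernel satisfies [K = 1 + (z / circ r t) K]; iterating [n] times is the geometric expansion
   with its exact remainder. *)
assert (Hstep : forall n : nat, Cmean (fun t => H t * K t)%C =
  (csum (fun k => Cmean (fun t => H t * / circ r t ^ k) * z ^ k) n +
    z ^ n * Cmean (fun t => H t * / circ r t ^ n * K t))%C).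
{ induction n as [|n IH].
  - simpl; rewrite Cplus_0_l, Cmult_1_l; apply Cmean_ext; intros t; field.
  - rewrite IH at 1; simpl csum.
    rewrite (Cmean_ext (fun t => H t * / circ r t ^ n * K t)%C
      (fun t => H t * / circ r t ^ n + z * (H t * / circ r t ^ S n * K t))%C).
    + rewrite (Cmean_plus (fun w => H w * / circ r w ^ n)%C (fun w => z * (H w * / circ r w ^ S n * K w))%C),
        (Cmean_scal z (fun w => H w * / circ r w ^ S n * K w)%C).
      * rewrite Cpow_S; ring.
      * apply HPK.
      * apply HP.
      * intros t; apply ccont_mult; [apply ccont_const|apply HPK].
    + intros t; unfold K, cauchy_kernel; rewrite Cpow_S; field.
      repeat split; first [now apply circ_minus_neq_0|apply Cpow_nz, circ_neq_0, Hr|apply circ_neq_0, Hr]. }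
assert (HM0 : 0 <= M) by (eapply Rle_trans; [apply Cmod_ge_0|apply (HM 0); pose proof two_PI_pos; lra]).
set (B := 2 * (M * (r / (r - Cmod z)))).
assert (HB : 0 <= B).
{ unfold B; apply Rmult_le_pos; [lra|apply Rmult_le_pos; [easy|left; apply Rdiv_lt_0_compat; lra]]. }
intros eps He; pose proof (ratio_bounds r z Hz) as Hq.
destruct (pow_lim_0 (Cmod z / r) (eps / (B + 1)) Hq) as [N HN]; [apply Rdiv_lt_0_compat; lra|].
exists N; intros n Hn; specialize (HN n Hn).
rewrite (Hstep n).
replace (_ - _)%C with (- (z ^ n * Cmean (fun t => H t * / circ r t ^ n * K t)))%C by ring.
rewrite Cmod_opp, Cmod_mult, Cmod_pow.
assert (Hrn : 0 < r ^ n) by now apply pow_lt.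
assert (Hb : Cmod (Cmean (fun t => H t * / circ r t ^ n * K t)%C) <= 2 * (M * / r ^ n * (r / (r - Cmod z)))).
{ apply (Cmean_bound (fun w => H w * / circ r w ^ n * K w)%C).
  - apply HPK.
  - intros t Ht; rewrite !Cmod_mult, Cmod_inv, Cmod_pow, Cmod_circ by (try lra; apply Cpow_nz, circ_neq_0, Hr).
    apply Rmult_le_compat; try apply Cmod_ge_0.
    + apply Rmult_le_pos; [apply Cmod_ge_0|left; now apply Rinv_0_lt_compat].
    + apply Rmult_le_compat_r; [left; now apply Rinv_0_lt_compat|now apply HM].
    + now apply cauchy_kernel_bound. }
apply Rle_lt_trans with ((Cmod z / r) ^ n * B).
- unfold Rdiv at 1; rewrite Rpow_mult_distr, pow_inv.
  replace (Cmod z ^ n * / r ^ n * B) with (Cmod z ^ n * (2 * (M * / r ^ n * (r / (r - Cmod z))))) by (unfold B; ring).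
  apply Rmult_le_compat_l; [now apply pow_le|easy].
- apply (Rmult_lt_compat_r (B + 1)) in HN; [|lra].
  replace (eps / (B + 1) * (B + 1)) with eps in HN by (field; lra).
  nra.
Qed.

Lemma Cmean_const (c : C) : Cmean (fun _ => c) = c.
Proof. unfold Cmean; rewrite !mean_const; now destruct c. Qed.

(** In the expansion of [cauchy_series] for the constant function 1, only the coefficient of index 0
    survives. *)
Lemma Cmean_cauchy_kernel (r : R) (z : C) : Cmod z < r -> Cmean (fun t => cauchy_kernel r z t) = 1.
Proof.
intros Hz; pose proof (Cmod_ge_0 z).
rewrite (Cmean_ext _ (fun t => 1 * cauchy_kernel r z t)%C) by (intros; ring).
apply clim_unique with (csum (fun k => Cmean (fun t => 1 * / circ r t ^ k) * z ^ k)%C).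
{ apply (cauchy_series (fun _ => RtoC 1) 1); [intros t; apply ccont_const| |easy].
  intros _ _; rewrite Cmod_1; lra. }
intros eps He; exists 1%nat; intros n Hn; destruct n as [|n]; [lia|].
rewrite csum_shift, (csum_ext _ (fun k => 0 * 0)%C), csum_scal.
- rewrite (Cmean_ext _ (fun _ => RtoC 1)), Cmean_const.
  + simpl; replace (1 * 1 + 0 * _ - 1)%C with (RtoC 0) by ring; now rewrite Cmod_0.
  + intros t; simpl; field.
- intros k _; rewrite (Cmean_ext _ (fun t => / circ r t ^ S k)%C) by (intros; ring).
  rewrite Cmean_circ_inv_pow by (lra || lia); ring.
Qed.

Lemma continuity_2d_Re (H : C -> C) (x y : R) : ccont H (x, y) ->
  continuity_2d_pt (fun u v => Re (H (u, v))) x y.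
Proof.
intros Hc eps; destruct (Hc eps (cond_pos eps)) as [d [Hd H']].
exists (mkposreal (d / 2) ltac:(lra)); simpl; intros u v Hu Hv.
eapply Rle_lt_trans; [apply Re_minus_le|apply H'].
eapply Rle_lt_trans; [apply Cmod_le_sum|]; unfold Re, Im; simpl.
unfold Rminus in *; lra.
Qed.

Lemma ccont_RtoC_part (p : C -> R) (z : C) :
  (forall a b : C, Rabs (p a - p b) <= Cmod (a - b)) -> ccont (fun w => RtoC (p w)) z.
Proof.
intros Hp eps He; exists eps; split; [easy|]; intros w Hw.
rewrite Cmod_RtoC_minus; eapply Rle_lt_trans; [apply Hp|easy].
Qed.

Definition segment_to_circ (r : R) (z s w : C) : C := (z + s * (circ r w - z))%C.

Lemma Cmod_segment_to_circ (r : R) (z : C) (s t : R) : Cmod z < r -> 0 <= s <= 1 ->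
  Cmod (segment_to_circ r z s t) <= r.
Proof.
intros Hz Hs; pose proof (Cmod_ge_0 z); unfold segment_to_circ.
replace (z + s * (circ r t - z))%C with (RtoC (1 - s) * z + RtoC s * circ r t)%C by (rewrite RtoC_minus; ring).
eapply Rle_trans; [apply Cmod_triangle|]; rewrite !Cmod_mult, !Cmod_R, Cmod_circ, !Rabs_pos_eq by lra; nra.
Qed.

(** The neighbourhood of [s] is uniform in [t], as differentiation under the integral requires, and
    may leave [[0, 1]], which gives two-sided derivatives at the end points. *)
Lemma Cmod_segment_to_circ_near (rad r : R) (z : C) (s : R) : Cmod z < r -> r < rad -> 0 <= s <= 1 ->
  exists d : posreal, forall u t : R, Rabs (u - s) < d -> Cmod (segment_to_circ r z u t) < rad.
Proof.
intros Hz HR Hs; pose proof (Cmod_ge_0 z).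
assert (Hd : 0 < (rad - r) / (2 * r)) by (apply Rdiv_lt_0_compat; lra).
exists (mkposreal _ Hd); simpl; intros u t Hu.
replace (segment_to_circ r z u t) with (segment_to_circ r z s t + RtoC (u - s) * (circ r t - z))%C
  by (unfold segment_to_circ; rewrite RtoC_minus; ring).
eapply Rle_lt_trans; [apply Cmod_triangle|]; rewrite Cmod_mult, Cmod_R.
pose proof (Cmod_segment_to_circ r z s t Hz Hs).
pose proof (Cmod_triangle (circ r t) (- z)) as Ht; rewrite Cmod_opp, Cmod_circ in Ht by lra.
fold (Cminus (circ r t) z) in Ht.
assert (Rabs (u - s) * Cmod (circ r t - z) < rad - r); [|lra].
apply Rle_lt_trans with (Rabs (u - s) * (2 * r)).
- apply Rmult_le_compat_l; [apply Rabs_pos|lra].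
- apply (Rmult_lt_compat_r (2 * r)) in Hu; [|lra].
  replace ((rad - r) / (2 * r) * (2 * r)) with (rad - r) in Hu by (field; lra); easy.
Qed.

Lemma cdiff_segment_s (f : C -> C) (l : C) (r : R) (z s w : C) :
  cdiff f (segment_to_circ r z s w) l ->
  cdiff (fun s => f (segment_to_circ r z s w)) s (l * (circ r w - z)).
Proof.
intros Hf; apply (cdiff_comp f (fun s => segment_to_circ r z s w)); [|easy].
unfold segment_to_circ; eapply cdiff_eq;
  [|apply cdiff_plus; [apply cdiff_const|apply cdiff_mult; [apply cdiff_id|apply cdiff_const]]].
cbv beta; ring.
Qed.

Lemma cdiff_segment_w (f : C -> C) (l : C) (r : R) (z s w : C) :
  cdiff f (segment_to_circ r z s w) l ->
  cdiff (fun w => f (segment_to_circ r z s w)) w (l * (s * (Ci * circ r w))).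
Proof.
intros Hf; apply (cdiff_comp f (fun w => segment_to_circ r z s w)); [|easy].
unfold segment_to_circ; eapply cdiff_eq;
  [|apply cdiff_plus; [apply cdiff_const|apply cdiff_scal, cdiff_minus; [apply cdiff_circ|apply cdiff_const]]].
cbv beta; ring.
Qed.

Lemma ccont_segment_w (r : R) (z s w : C) : ccont (fun w => segment_to_circ r z s w) w.
Proof.
unfold segment_to_circ; apply ccont_plus; [apply ccont_const|apply ccont_mult; [apply ccont_const|]].
apply ccont_minus; [apply ccont_circ|apply ccont_const].
Qed.

Lemma hol_cdiff (rad : R) (f f' : C -> C) (z : C) : hol rad f f' -> Cmod z < rad -> cdiff f z (f' z).
Proof. intros H Hz; now apply H. Qed.

Lemma hol_ccont (rad : R) (f f' : C -> C) (z : C) : hol rad f f' -> Cmod z < rad -> ccont f z.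
Proof. intros H Hz; apply cdiff_cont with (f' z); now apply H. Qed.

(* The circle means of [f] over the curves [z + s (circ r - z)] against the Cauchy
   kernel do not depend on [s], because the [s]-derivative of the integrand is an
   exact derivative along the circle. *)
Lemma cauchy_homotopy (rad r : R) (f f' : C -> C) (c z : C) : hol rad f f' -> Cmod z < r -> r < rad ->
  mean (fun t => Re (c * (f (circ r t) * cauchy_kernel r z t)))
    = mean (fun t => Re (c * (f z * cauchy_kernel r z t))).
Proof.
intros Hf Hz HR.
set (K := cauchy_kernel r z); assert (HK : ccts K) by now apply ccts_cauchy_kernel.
set (u := fun s t : R => Re (c * (f (segment_to_circ r z s t) * K t))).
set (u' := fun s t : R => Re (c * (f' (segment_to_circ r z s t) * circ r t))).
set (Phi := fun s => RInt (fun t => u s t) 0 (2 * PI)).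
assert (Hder : forall s t : R, Cmod (segment_to_circ r z s t) < rad ->
  is_derive (fun s => u s t) s (u' s t)).
{ intros s t Hs; unfold u, u'.
  apply (cdiff_is_derive_Re (fun s => c * (f (segment_to_circ r z s t) * K t))%C s).
  eapply cdiff_eq; [|apply cdiff_scal, cdiff_mult; [apply cdiff_segment_s, (hol_cdiff rad f f'); easy|apply cdiff_const]].
  unfold K, cauchy_kernel; field; now apply circ_minus_neq_0. }
assert (Hcts : forall s : R, (forall t : R, Cmod (segment_to_circ r z s t) < rad) -> cts (fun t => u s t)).
{ intros s Hs; apply (ccts_Re (fun w => c * (f (segment_to_circ r z s w) * K w))%C); intros t.
  apply ccont_mult; [apply ccont_const|apply ccont_mult; [|apply HK]].
  apply (ccont_comp f (fun w => segment_to_circ r z s w)); [apply ccont_segment_w|now apply hol_ccont with rad f']. }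
assert (HPhi : forall s : R, 0 <= s <= 1 -> is_derive Phi s (RInt (fun t => u' s t) 0 (2 * PI))).
{ intros s Hs; destruct (Cmod_segment_to_circ_near rad r z s Hz HR Hs) as [d Hd].
  assert (Hs0 : Rabs (s - s) < d) by (rewrite Rminus_diag, Rabs_R0; apply cond_pos).
  rewrite (RInt_ext (fun t => u' s t) (fun t => Derive (fun s => u s t) s)).
  2:{ intros t _; symmetry; apply is_derive_unique, Hder; now apply Hd. }
  apply is_derive_RInt_param.
  - exists d; intros y Hy t _; exists (u' y t); apply Hder, Hd, Hy.
  - intros t _; apply continuity_2d_pt_ext_loc with u'.
    + exists d; intros y v Hy _; symmetry; apply is_derive_unique, Hder; now apply Hd.
    + apply (continuity_2d_Re
        (fun w => c * (f' (segment_to_circ r z (RtoC (Re w)) (RtoC (Im w))) * circ r (RtoC (Im w))))%C s t).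
      pose proof (ccont_RtoC_part Re (s, t) Re_minus_le) as HcRe.
      pose proof (ccont_RtoC_part Im (s, t) Im_minus_le) as HcIm.
      pose proof (ccont_comp (circ r) _ (s, t) HcIm (ccont_circ r _)) as HcC.
      apply ccont_mult; [apply ccont_const|apply ccont_mult; [|easy]].
      apply (ccont_comp f' (fun w => segment_to_circ r z (RtoC (Re w)) (RtoC (Im w)))).
      * unfold segment_to_circ; apply ccont_plus; [apply ccont_const|apply ccont_mult; [easy|]].
        apply ccont_minus; [easy|apply ccont_const].
      * apply Hf; apply (Hd s t Hs0).
  - exists d; intros y Hy; apply cts_ex_RInt, Hcts; intros t; now apply Hd. }
(* The primitive along the circle is divided by [s], which excludes [s = 0]; the mean value theorem
   below asks for the open interval only. *)
assert (Hzero : forall s : R, 0 < s < 1 -> RInt (fun t => u' s t) 0 (2 * PI) = 0).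
{ intros s Hs; assert (HsC : RtoC s <> 0) by (apply Cmod_gt_0; rewrite Cmod_R, Rabs_pos_eq; lra).
  assert (Hlt : forall t : R, Cmod (segment_to_circ r z s t) < rad).
  { intros t; eapply Rle_lt_trans; [apply Cmod_segment_to_circ; lra|easy]. }
  assert (HCi : Ci <> 0) by (apply Cmod_gt_0; rewrite Cmod_Ci; lra).
  pose proof (Cmean_derive (fun w => c * / (RtoC s * Ci) * f (segment_to_circ r z s w))%C
    (fun w => c * (f' (segment_to_circ r z s w) * circ r w))%C) as H.
  assert (E : Cmean (fun t => c * (f' (segment_to_circ r z s t) * circ r t))%C = 0).
  { apply H; clear H.
    - intros t; eapply cdiff_eq; [|apply cdiff_scal, cdiff_segment_w, (hol_cdiff rad f f'); easy].
      field; split; easy.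
    - intros t; apply ccont_mult; [apply ccont_const|apply ccont_mult; [|apply ccont_circ]].
      apply (ccont_comp f' (fun w => segment_to_circ r z s w)); [apply ccont_segment_w|now apply Hf].
    - unfold segment_to_circ; now rewrite circ_period. }
  apply (f_equal fst) in E; change (mean (fun t => u' s t) = 0) in E; unfold mean in E.
  pose proof two_PI_pos; apply (Rmult_eq_compat_r (2 * PI)) in E.
  unfold Rdiv in E; rewrite Rmult_assoc, Rinv_l, Rmult_0_l, Rmult_1_r in E by lra; exact E. }
assert (HE : Phi 1 = Phi 0).
{ destruct (MVT_gen Phi 0 1 (fun _ => 0)) as [x [_ Hx]].
  - rewrite Rmin_left, Rmax_right by lra; intros x Hx; rewrite <- (Hzero x Hx); apply HPhi; lra.
  - rewrite Rmin_left, Rmax_right by lra; intros x Hx.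
    apply continuity_pt_filterlim, (@ex_derive_continuous R_AbsRing R_NormedModule).
    eexists; apply HPhi; lra.
  - lra. }
unfold Phi, u, segment_to_circ in HE; unfold mean; f_equal.
etransitivity; [|etransitivity; [exact HE|]].
- apply RInt_ext; intros t _; do 3 f_equal; f_equal; ring.
- apply RInt_ext; intros t _; do 3 f_equal; f_equal; ring.
Qed.

Lemma cauchy_formula (rad r : R) (f f' : C -> C) (z : C) : hol rad f f' -> Cmod z < r -> r < rad ->
  Cmean (fun t => f (circ r t) * cauchy_kernel r z t)%C = f z.
Proof.
intros Hf Hz HR.
transitivity (Cmean (fun t => f z * cauchy_kernel r z t)%C).
- unfold Cmean; f_equal.
  + pose proof (cauchy_homotopy rad r f f' 1 z Hf Hz HR) as E.
    rewrite (mean_ext _ (fun t => Re (1 * (f (circ r t) * cauchy_kernel r z t)))) by (intros; f_equal; ring).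
    rewrite E; apply mean_ext; intros; f_equal; ring.
  (* Multiplication by [- Ci] turns imaginary parts into real parts, so the statement about real
     parts covers both components. *)
  + pose proof (cauchy_homotopy rad r f f' (- Ci) z Hf Hz HR) as E.
    assert (EI : forall w : C, Im w = Re (- Ci * w)) by (intros; unfold Re, Im; simpl; ring).
    rewrite (mean_ext _ _ (fun t => EI (f (circ r t) * cauchy_kernel r z t)%C)), E.
    apply mean_ext; intros; now rewrite EI.
- rewrite (Cmean_scal (f z) (cauchy_kernel r z)) by now apply ccts_cauchy_kernel.
  rewrite Cmean_cauchy_kernel by easy; ring.
Qed.

Lemma hol_mean_value (rad r : R) (f f' : C -> C) : hol rad f f' -> 0 < r -> r < rad ->
  Cmean (fun t => f (circ r t)) = f 0.
Proof.
intros Hf Hr HR; rewrite <- (cauchy_formula rad r f f' 0 Hf) by (rewrite ?Cmod_0; lra).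
apply Cmean_ext; intros t; unfold cauchy_kernel; field; now apply circ_neq_0.
Qed.

(** * Holomorphic functions on a disk *)

Lemma cts_bounded_above (u : R -> R) : cts u ->
  exists M : R, forall t : R, 0 <= t <= 2 * PI -> u t <= M.
Proof.
intros H; pose proof two_PI_pos.
destruct (continuity_ab_maj u 0 (2 * PI)) as [x [Hx _]]; [lra| |now exists (u x)].
intros c _; apply continuity_pt_filterlim, H.
Qed.

Lemma pser_ext (rad : R) (a : nat -> C) (f g : C -> C) :
  (forall z : C, Cmod z < rad -> f z = g z) -> pser rad a f -> pser rad a g.
Proof. intros E H z Hz; rewrite <- E; auto. Qed.

Lemma pser_ext_coef (rad : R) (a b : nat -> C) (f : C -> C) :
  (forall k : nat, a k = b k) -> pser rad a f -> pser rad b f.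
Proof.
intros E H z Hz; apply clim_ext with (psum a z); [|now apply H].
intros n; apply csum_ext; intros k _; now rewrite E.
Qed.

Lemma hol_pser (rad : R) (f f' : C -> C) : 0 < rad -> hol rad f f' -> exists a : nat -> C, pser rad a f.
Proof.
intros Hrad Hf.
set (A := fun r k => Cmean (fun t => f (circ r t) * / circ r t ^ k)%C).
assert (HA : forall r : R, 0 < r < rad -> pser r (A r) f).
{ intros r Hr z Hz.
  assert (Hc : ccts (fun w => f (circ r w))).
  { intros t; apply (ccont_comp f (circ r)); [apply ccont_circ|].
    apply hol_ccont with rad f'; [easy|]; rewrite Cmod_circ; lra. }
  destruct (cts_bounded_above _ (ccts_Cmod _ Hc)) as [M HM].
  rewrite <- (cauchy_formula rad r f f' z Hf) by lra.
  now apply (cauchy_series (fun w => f (circ r w)) M). }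
(* Coefficients are read on one fixed circle. A point close to the boundary requires a larger
   circle, whose coefficients are the same by uniqueness. *)
exists (A (rad / 2)); intros z Hz; pose proof (Cmod_ge_0 z).
assert (Hr : 0 < (Cmod z + rad) / 2 < rad) by lra; assert (Hr2 : 0 < rad / 2 < rad) by lra.
apply (pser_ext_coef ((Cmod z + rad) / 2) (A ((Cmod z + rad) / 2))); [|now apply HA|lra].
intros k; apply (pser_unique ((Cmod z + rad) / 2) (rad / 2) rad _ _ f f); try lra; [now apply HA|now apply HA|easy].
Qed.

Definition holo (rad : R) (f : C -> C) : Prop := exists f' : C -> C, hol rad f f'.

Lemma holo_pser (rad : R) (f : C -> C) : 0 < rad -> holo rad f -> exists a : nat -> C, pser rad a f.
Proof. intros Hrad [f' H]; now apply hol_pser with f'. Qed.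

Lemma pser_holo (rad : R) (a : nat -> C) (f : C -> C) : pser rad a f -> holo rad f.
Proof. intros H; destruct (pser_dcoef rad a f H) as [f' H']; exists f'; now apply pser_hol with a. Qed.

Lemma hol_derive_pser (rad : R) (a : nat -> C) (f f' : C -> C) :
  pser rad a f -> hol rad f f' -> pser rad (dcoef a) f'.
Proof.
intros Ha Hf; destruct (pser_dcoef rad a f Ha) as [g Hg].
apply pser_ext with g; [|easy]; intros z Hz.
apply cdiff_unique with f z; [now apply pser_cdiff with rad a|now apply Hf].
Qed.

Lemma hol_derive_holo (rad : R) (f f' : C -> C) : 0 < rad -> hol rad f f' -> holo rad f'.
Proof.
intros Hrad Hf; destruct (hol_pser rad f f' Hrad Hf) as [a Ha].
apply pser_holo with (dcoef a); now apply hol_derive_pser with f.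
Qed.

(** The local derivatives are glued by choosing the derivative at each point; uniqueness of
    derivatives identifies the choice with [g'] nearby, which yields continuity. *)
Lemma holo_local (rad : R) (f : C -> C) :
  (forall z : C, Cmod z < rad -> exists (d : R) (g g' : C -> C), 0 < d /\
    forall w : C, Cmod (w - z) < d -> f w = g w /\ cdiff g w (g' w) /\ ccont g' w) ->
  holo rad f.
Proof.
intros H; exists (fun z => epsilon (inhabits (RtoC 0)) (cdiff f z)); intros z Hz.
destruct (H z Hz) as [d [g [g' [Hd Hg]]]].
assert (HD : forall w : C, Cmod (w - z) < d -> cdiff f w (g' w)).
{ intros w Hw; apply cdiff_ext_loc with g (d - Cmod (w - z)); [lra| |now apply Hg].
  intros v Hv; symmetry; apply Hg.
  pose proof (Cmod_triangle (v - w) (w - z)) as Ht; replace (v - w + (w - z))%C with (v - z)%C in Ht by ring; lra. }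
assert (H0 : Cmod (z - z) < d) by now rewrite Cmod_0_minus.
split.
- apply epsilon_spec; exists (g' z); now apply HD.
- apply ccont_ext_loc with g' d; [easy| |now apply Hg].
  intros w Hw; apply cdiff_unique with f w; [now apply HD|].
  apply epsilon_spec; exists (g' w); now apply HD.
Qed.

Lemma holo_ext (rad : R) (f g : C -> C) : (forall z : C, Cmod z < rad -> f z = g z) -> holo rad f -> holo rad g.
Proof.
intros E [f' Hf]; exists f'; intros z Hz; split; [|now apply Hf].
apply cdiff_ext_loc with f (rad - Cmod z); [lra| |now apply Hf].
intros w Hw; apply E; pose proof (Cmod_le_shift w z); lra.
Qed.

Lemma holo_ccont (rad : R) (f : C -> C) (z : C) : holo rad f -> Cmod z < rad -> ccont f z.
Proof. intros [f' H] Hz; now apply hol_ccont with rad f'. Qed.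

Lemma holo_sub (r1 r2 : R) (f : C -> C) : r1 <= r2 -> holo r2 f -> holo r1 f.
Proof. intros Hr [f' H]; exists f'; intros z Hz; apply H; lra. Qed.

Lemma holo_const (rad : R) (c : C) : holo rad (fun _ => c).
Proof. exists (fun _ => RtoC 0); intros z _; split; [apply cdiff_const|apply ccont_const]. Qed.

Lemma holo_id (rad : R) : holo rad (fun z => z).
Proof. exists (fun _ => RtoC 1); intros z _; split; [apply cdiff_id|apply ccont_const]. Qed.

Lemma holo_plus (rad : R) (f g : C -> C) : holo rad f -> holo rad g -> holo rad (fun z => f z + g z)%C.
Proof.
intros [f' Hf] [g' Hg]; exists (fun z => f' z + g' z)%C; intros z Hz.
destruct (Hf z Hz), (Hg z Hz); split; [now apply cdiff_plus|now apply ccont_plus].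
Qed.

Lemma holo_mult (rad : R) (f g : C -> C) : holo rad f -> holo rad g -> holo rad (fun z => f z * g z)%C.
Proof.
intros Hf0 Hg0; assert (Hfc := fun z => holo_ccont rad f z Hf0); assert (Hgc := fun z => holo_ccont rad g z Hg0).
destruct Hf0 as [f' Hf], Hg0 as [g' Hg]; exists (fun z => f' z * g z + f z * g' z)%C; intros z Hz.
destruct (Hf z Hz), (Hg z Hz); split; [now apply cdiff_mult|].
apply ccont_plus; apply ccont_mult; auto.
Qed.

Lemma holo_minus (rad : R) (f g : C -> C) : holo rad f -> holo rad g -> holo rad (fun z => f z - g z)%C.
Proof.
intros Hf Hg; apply holo_ext with (fun z => f z + - (1) * g z)%C; [intros; ring|].
apply holo_plus; [easy|apply holo_mult; [apply holo_const|easy]].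
Qed.

Lemma holo_comp (r1 r2 : R) (f g : C -> C) : holo r2 f -> holo r1 g ->
  (forall z : C, Cmod z < r1 -> Cmod (g z) < r2) -> holo r1 (fun z => f (g z)).
Proof.
intros [f' Hf] Hg0 Hm; assert (Hgc := fun z => holo_ccont r1 g z Hg0).
destruct Hg0 as [g' Hg]; exists (fun z => f' (g z) * g' z)%C; intros z Hz.
destruct (Hg z Hz); destruct (Hf (g z) (Hm z Hz)); split; [now apply cdiff_comp|].
apply ccont_mult; [apply ccont_comp; auto|easy].
Qed.

Lemma holo_inv (rad : R) (f : C -> C) : holo rad f -> (forall z : C, Cmod z < rad -> f z <> 0) ->
  holo rad (fun z => / f z)%C.
Proof.
intros Hf0 Hn; assert (Hfc := fun z => holo_ccont rad f z Hf0); destruct Hf0 as [f' Hf].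
exists (fun z => - (1) * (/ f z * / f z) * f' z)%C; intros z Hz; specialize (Hn z Hz).
destruct (Hf z Hz) as [H1 H2]; split.
- eapply cdiff_eq; [|apply (cdiff_comp Cinv f); [exact H1|now apply cdiff_inv]]; ring.
- assert (Hi : ccont (fun z => / f z)%C z) by (apply (ccont_comp Cinv f); [auto|now apply ccont_inv]).
  apply ccont_mult; [apply ccont_mult; [apply ccont_const|now apply ccont_mult]|easy].
Qed.

Lemma holo_div (rad : R) (f g : C -> C) : holo rad f -> holo rad g ->
  (forall z : C, Cmod z < rad -> g z <> 0) -> holo rad (fun z => f z / g z)%C.
Proof. intros Hf Hg Hn; apply holo_mult; [easy|now apply holo_inv]. Qed.

Lemma holo_Cexp (rad : R) (f : C -> C) : holo rad f -> holo rad (fun z => Cexp (f z)).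
Proof.
intros Hf0; assert (Hfc := fun z => holo_ccont rad f z Hf0); destruct Hf0 as [f' Hf].
exists (fun z => Cexp (f z) * f' z)%C; intros z Hz; destruct (Hf z Hz) as [H1 H2]; split.
- apply (cdiff_comp Cexp f); [easy|apply cdiff_Cexp].
- apply ccont_mult; [apply (ccont_comp Cexp f); [auto|apply ccont_Cexp]|easy].
Qed.

Lemma pser_zero (rad : R) : pser rad (fun _ => RtoC 0) (fun _ => RtoC 0).
Proof.
intros z _ eps He; exists O; intros n _; rewrite csum_scal.
replace (0 * _ - 0)%C with (RtoC 0) by ring; now rewrite Cmod_0.
Qed.

Lemma hol_zero_const (rad : R) (f f' : C -> C) : 0 < rad -> hol rad f f' ->
  (forall z : C, Cmod z < rad -> f' z = 0) -> forall z : C, Cmod z < rad -> f z = f 0.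
Proof.
intros Hrad Hf H0 z Hz; destruct (hol_pser rad f f' Hrad Hf) as [a Ha].
assert (Hd : forall k : nat, dcoef a k = 0).
{ apply (pser_unique rad rad rad _ (fun _ => RtoC 0) f' (fun _ => RtoC 0)); try easy.
  - now apply hol_derive_pser with f.
  - apply pser_zero. }
rewrite (pser_at_0 rad a f Hrad Ha).
apply clim_unique with (psum a z); [now apply Ha|].
intros eps He; exists 1%nat; intros n Hn; destruct n as [|n]; [lia|].
rewrite csum_shift, (csum_ext _ (fun k => 0 * 0)%C), csum_scal.
- replace (_ - _)%C with (RtoC 0) by (simpl; ring); now rewrite Cmod_0.
- intros k _; destruct (Ceq_dec (a (S k)) 0) as [E|E]; [rewrite E; ring|exfalso].
  apply (Cmult_neq_0 (RtoC (INR (S k))) (a (S k))); [|easy|exact (Hd k)].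
  intros E'; apply RtoC_inj in E'; pose proof (lt_0_INR (S k) ltac:(lia)); lra.
Qed.

Lemma pser_primitive (rad : R) (b : nat -> C) (p : C -> C) (c : C) : 0 < rad -> pser rad b p ->
  exists l : C -> C, hol rad l p /\ l 0 = c.
Proof.
intros Hrad Hp.
set (B := fun k => match k with O => c | S k => (b k / RtoC (INR (S k)))%C end).
assert (HS : forall k : nat, 1 <= INR (S k)) by (intros k; rewrite S_INR; pose proof (pos_INR k); lra).
assert (HSC : forall k : nat, RtoC (INR (S k)) <> 0).
{ intros k E; apply RtoC_inj in E; specialize (HS k); lra. }
destruct (pser_exists rad B) as [l Hl].
{ intros rho Hr; destruct (pser_coef_bound rad rho b p Hp ltac:(lra)) as [M [HM HB]].
  exists (Rmax (Cmod c) (rho * M)); intros [|k].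
  - simpl; rewrite Rmult_1_r; apply Rmax_l.
  - eapply Rle_trans; [|apply Rmax_r].
    unfold B; rewrite Cmod_div, Cmod_R, Rabs_pos_eq by (try apply HSC; apply pos_INR).
    replace (Cmod (b k) / INR (S k) * rho ^ S k) with (rho * (Cmod (b k) * rho ^ k * / INR (S k)))
      by (simpl; field; specialize (HS k); simpl in HS; lra).
    apply Rmult_le_compat_l; [lra|]; specialize (HB k); specialize (HS k).
    assert (0 <= Cmod (b k) * rho ^ k) by (apply Rmult_le_pos; [apply Cmod_ge_0|apply pow_le; lra]).
    apply Rle_trans with (Cmod (b k) * rho ^ k * 1); [|lra].
    apply Rmult_le_compat_l; [easy|]; rewrite <- Rinv_1; apply Rinv_le_contravar; lra. }
exists l; split; [|now apply (pser_at_0 rad B)].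
apply pser_hol with B; [easy|]; apply pser_ext_coef with b; [|easy].
intros k; unfold dcoef, B; field; apply HSC.
Qed.

(** Take for [l] the primitive of [h' / h] with value [c] at 0: the product of [h] and [Cexp (- l)]
    then has derivative 0, hence is constant. *)
Lemma holo_log (rad : R) (h : C -> C) (c : C) : 0 < rad -> holo rad h ->
  (forall z : C, Cmod z < rad -> h z <> 0) -> Cexp c = h 0 ->
  exists l : C -> C, holo rad l /\ l 0 = c /\ forall z : C, Cmod z < rad -> Cexp (l z) = h z.
Proof.
intros Hrad [h' Hh] Hn Hc.
destruct (holo_pser rad (fun z => h' z / h z)%C Hrad) as [b Hb].
{ apply holo_div; [now apply hol_derive_holo with h|now exists h'|easy]. }
destruct (pser_primitive rad b _ c Hrad Hb) as [l [Hl Hl0]].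
exists l; split; [eexists; exact Hl|split; [easy|]]; intros z Hz.
assert (HQ : (h z * Cexp (- (1) * l z) = h 0 * Cexp (- (1) * l 0))%C).
{ apply (hol_zero_const rad (fun z => h z * Cexp (- (1) * l z))%C (fun _ => RtoC 0)); try easy.
  intros w Hw; split; [|apply ccont_const].
  destruct (Hh w Hw) as [H1 _]; destruct (Hl w Hw) as [H2 _].
  eapply cdiff_eq; [|apply cdiff_mult; [exact H1|]].
  2:{ apply (cdiff_comp Cexp (fun w => - (1) * l w)%C); [apply cdiff_scal, H2|apply cdiff_Cexp]. }
  cbv beta; field; now apply Hn. }
rewrite Hl0, <- Hc in HQ.
assert (E : forall a : C, Cexp (- (1) * a) = (/ Cexp a)%C).
{ intros a; rewrite <- Cexp_opp; f_equal; ring. }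
rewrite !E in HQ; pose proof (Cexp_neq_0 (l z)); pose proof (Cexp_neq_0 c).
assert (HQ' : (h z / Cexp (l z))%C = 1) by (unfold Cdiv; rewrite HQ; field; easy).
replace (h z) with (h z / Cexp (l z) * Cexp (l z))%C by (field; easy); rewrite HQ'; ring.
Qed.

Lemma holo_translate (a : C) (f : C -> C) : holo 1 f -> holo (1 - Cmod a) (fun w => f (a + w)%C).
Proof.
intros Hf; apply (holo_comp (1 - Cmod a) 1 f (fun w => a + w)%C); [easy| |].
- apply holo_plus; [apply holo_const|apply holo_id].
- intros z Hz; eapply Rle_lt_trans; [apply Cmod_triangle|lra].
Qed.

Lemma pser_factor_0 (rad : R) (a : nat -> C) (f : C -> C) : 0 < rad -> pser rad a f ->
  exists q : C -> C, pser rad (fun k => a (S k)) q /\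
    forall w : C, Cmod w < rad -> (f w = a O + w * q w)%C.
Proof.
intros Hrad Ha; destruct (pser_exists rad (fun k => a (S k))) as [q Hq].
{ intros rho Hr; destruct (pser_coef_bound rad rho a f Ha ltac:(lra)) as [M [HM HB]].
  exists (M * / rho); intros k; specialize (HB (S k)); simpl in HB.
  apply Rmult_le_reg_r with rho; [lra|]; rewrite (Rmult_assoc M), Rinv_l by lra; nra. }
exists q; split; [easy|]; intros w Hw.
apply clim_unique with (fun n => psum a w (S n)).
- apply (clim_shift (psum a w)), Ha, Hw.
- apply clim_ext with (fun n => (a O + w * csum (fun k => a (S k) * w ^ k) n)%C).
  + intros n; rewrite csum_shift, <- csum_scal; f_equal; [simpl; ring|].
    apply csum_ext; intros k _; rewrite Cpow_S; ring.
  + apply clim_plus; [|apply clim_scal, Hq, Hw].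
    intros eps He; exists O; intros n _; now rewrite Cmod_0_minus.
Qed.

Lemma holo_factor_0 (rad : R) (f : C -> C) : 0 < rad -> holo rad f ->
  exists q : C -> C, holo rad q /\ forall w : C, Cmod w < rad -> (f w = f 0 + w * q w)%C.
Proof.
intros Hrad Hf; destruct (holo_pser rad f Hrad Hf) as [a Ha].
destruct (pser_factor_0 rad a f Hrad Ha) as [q [Hq E]].
exists q; split; [now apply pser_holo with (fun k => a (S k))|].
now rewrite (pser_at_0 rad a f Hrad Ha).
Qed.

(** Removable singularity of the difference quotient: near [a] it is given by the power series of
    the translate of [f], elsewhere by the quotient itself. *)
Lemma holo_factor (f : C -> C) (a : C) : holo 1 f -> Cmod a < 1 ->
  exists q : C -> C, holo 1 q /\ forall w : C, Cmod w < 1 -> (f w = f a + (w - a) * q w)%C.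
Proof.
intros Hf Ha.
destruct (holo_factor_0 (1 - Cmod a) (fun w => f (a + w)%C)) as [q0 [Hq0 Hq]];
  [lra|now apply holo_translate|].
set (q := fun w => if Ceq_dec w a then q0 (RtoC 0) else ((f w - f a) / (w - a))%C).
exists q; split.
- apply holo_local; intros z Hz; destruct (Ceq_dec z a) as [->|Hza].
  + destruct Hq0 as [q0' Hq0].
    exists (1 - Cmod a), (fun w => q0 (w - a)%C), (fun w => q0' (w - a)%C).
    split; [lra|]; intros w Hw; destruct (Hq0 _ Hw) as [H1 H2]; split; [|split].
    * unfold q; destruct (Ceq_dec w a) as [->|Hwa]; [f_equal; ring|].
      specialize (Hq _ Hw); cbv beta in Hq; replace (a + (w - a))%C with w in Hq by ring.
      rewrite Hq; replace (a + 0)%C with a by ring; field; now apply Cminus_neq_0.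
    * eapply cdiff_eq; [|apply (cdiff_comp q0 (fun w => w - a)%C); [|exact H1]].
      2:{ apply cdiff_minus; [apply cdiff_id|apply cdiff_const]. }
      ring.
    * apply (ccont_comp q0' (fun w => w - a)%C); [|easy].
      apply ccont_minus; [apply ccont_id|apply ccont_const].
  + destruct Hf as [f' Hf].
    assert (Hd : 0 < Cmod (z - a)) by now apply Cmod_gt_0, Cminus_neq_0.
    exists (Rmin (Cmod (z - a)) (1 - Cmod z)), (fun w => (f w - f a) / (w - a))%C,
      (fun w => ((f' w - 0) * (w - a) - (f w - f a) * (1 - 0)) / ((w - a) * (w - a)))%C.
    split; [apply Rmin_glb_lt; lra|]; intros w Hw.
    destruct (Rmin_Rgt_l _ _ _ Hw) as [Hw1 Hw2].
    assert (Hwa : w <> a) by (intros ->; rewrite Cmod_minus_sym in Hw1; lra).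
    assert (Hwa' := Cminus_neq_0 w a Hwa).
    assert (Hwd : Cmod w < 1).
    { pose proof (Cmod_le_shift w z); lra. }
    destruct (Hf w Hwd) as [H1 H2]; split; [|split].
    * unfold q; now destruct (Ceq_dec w a).
    * apply (cdiff_div (fun w => f w - f a)%C (fun w => w - a)%C w (f' w - 0)%C (1 - 0)%C); [|apply cdiff_minus; [apply cdiff_id|apply cdiff_const]|easy].
      apply cdiff_minus; [easy|apply cdiff_const].
    * assert (Hc1 : ccont (fun w => w - a)%C w) by (apply ccont_minus; [apply ccont_id|apply ccont_const]).
      assert (Hc2 : ccont (fun w => f w - f a)%C w).
      { apply ccont_minus; [apply cdiff_cont with (f' w); easy|apply ccont_const]. }
      apply (ccont_div (fun w => (f' w - 0) * (w - a) - (f w - f a) * (1 - 0))%C (fun w => (w - a) * (w - a))%C); [|now apply ccont_mult|now apply Cmult_neq_0].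
      apply ccont_minus; apply ccont_mult; try easy; [|apply ccont_const].
      apply ccont_minus; [easy|apply ccont_const].
- intros w Hw; unfold q; destruct (Ceq_dec w a) as [->|Hwa]; [ring|].
  field; now apply Cminus_neq_0.
Qed.

(** * Univalent functions and Jensen's inequality *)

(** Order of vanishing at 0. It is finite because otherwise all coefficients, and with them [g w0],
    would be 0. *)
Lemma holo_order (rad : R) (g : C -> C) (w0 : C) : holo rad g -> Cmod w0 < rad -> g w0 <> 0 ->
  exists (m : nat) (G : C -> C), holo rad G /\ G 0 <> 0 /\
    forall w : C, Cmod w < rad -> (g w = w ^ m * G w)%C.
Proof.
intros Hg Hw0 Hn; assert (Hrad : 0 < rad) by (pose proof (Cmod_ge_0 w0); lra).
destruct (holo_pser rad g Hrad Hg) as [a Ha].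
assert (Hm : forall m : nat, (forall k : nat, (k < m)%nat -> a k = 0) ->
  exists G : C -> C, pser rad (fun k => a (m + k)%nat) G /\ forall w : C, Cmod w < rad -> (g w = w ^ m * G w)%C).
{ induction m as [|m IH]; intros H0.
  - exists g; split; [easy|]; intros w Hw; simpl; ring.
  - destruct IH as [G [HG E]]; [intros; apply H0; lia|].
    destruct (pser_factor_0 rad _ G Hrad HG) as [q [Hq E']].
    exists q; split.
    + apply pser_ext_coef with (fun k => a (m + S k)%nat); [intros k; f_equal; lia|easy].
    + intros w Hw; rewrite (E w Hw), (E' w Hw), Nat.add_0_r, H0, Cpow_S by lia; ring. }
assert (Hex : exists m : nat, (forall k : nat, (k < m)%nat -> a k = 0) /\ a m <> 0).
{ destruct (classic (exists m : nat, (forall k : nat, (k < m)%nat -> a k = 0) /\ a m <> 0)) as [|Hno]; [easy|exfalso].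
  assert (H0 : forall m k : nat, (k < m)%nat -> a k = 0).
  { induction m as [|m IH]; [lia|]; intros k Hk.
    destruct (Nat.eq_dec k m) as [->|]; [|apply IH; lia].
    destruct (Ceq_dec (a m) 0) as [|Hne]; [easy|exfalso; apply Hno; now exists m]. }
  apply Hn, (clim_unique (psum a w0)); [now apply Ha|].
  apply clim_ext with (csum (fun k => RtoC 0 * w0 ^ k)%C).
  - intros n; apply csum_ext; intros k Hk; now rewrite (H0 n k Hk).
  - now apply (pser_zero rad). }
destruct Hex as [m [H0 Hne]]; destruct (Hm m H0) as [G [HG E]].
exists m, G; split; [now apply pser_holo with (fun k => a (m + k)%nat)|split; [|easy]].
rewrite (pser_at_0 rad _ G Hrad HG), Nat.add_0_r; easy.
Qed.

Lemma Cexp_pow (z : C) (n : nat) : (Cexp z ^ n)%C = Cexp (RtoC (INR n) * z).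
Proof.
induction n as [|n IH]; [simpl; rewrite <- Cexp_0; f_equal; ring|].
rewrite Cpow_S, IH, <- Cexp_plus, S_INR, RtoC_plus; f_equal; ring.
Qed.

(* If [k] omitted [c], the mean value property of [1 / (k - c)] would bound [1 / |c|]. *)
Lemma holo_covers (rad : R) (E : C -> C) (e0 : R) (c : C) : 0 < rad -> 0 < e0 -> holo rad E ->
  (forall w : C, Cmod w < rad -> e0 <= Cmod (E w)) -> 0 < Cmod c < rad / 2 * e0 / 3 ->
  exists w : C, Cmod w < rad /\ (w * E w)%C = c.
Proof.
intros Hrad He0 HE Hb Hc.
destruct (classic (exists w : C, Cmod w < rad /\ (w * E w)%C = c)) as [|Hno]; [easy|exfalso].
assert (Hne : forall w : C, Cmod w < rad -> (w * E w - c)%C <> 0).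
{ intros w Hw H0; apply Hno; exists w; split; [easy|].
  replace (w * E w)%C with (w * E w - c + c)%C by ring; rewrite H0; ring. }
assert (Hh : holo rad (fun w => / (w * E w - c))%C).
{ apply holo_inv; [|easy]; apply holo_minus; [apply holo_mult; [apply holo_id|easy]|apply holo_const]. }
pose proof Hh as [h' Hh'].
pose proof (hol_mean_value rad (rad / 2) _ h' Hh' ltac:(lra) ltac:(lra)) as Hmv; cbv beta in Hmv.
assert (Hcirc : forall t : R, Cmod (circ (rad / 2) t) = rad / 2) by (intros; apply Cmod_circ; lra).
(* The factor 2 is the one of [Cmean_bound]; the inequality becomes [rad / 2 * e0 <= 3 * Cmod c],
   which explains the 3 in the hypothesis on [c]. *)
assert (HB : Cmod (/ (0 * E 0 - c)) <= 2 * / (rad / 2 * e0 - Cmod c)).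
{ rewrite <- Hmv; apply (Cmean_bound (fun w => / (circ (rad / 2) w * E (circ (rad / 2) w) - c))%C).
  - intros t; apply (ccont_comp (fun w => / (w * E w - c))%C (circ (rad / 2))); [apply ccont_circ|].
    apply holo_ccont with rad; [easy|]; rewrite Hcirc; lra.
  - intros t _; rewrite Cmod_inv by (apply Hne; rewrite Hcirc; lra).
    apply Rinv_le_contravar; [nra|].
    eapply Rle_trans; [|apply Cmod_rev_triangle]; rewrite Cmod_mult, Hcirc.
    specialize (Hb (circ (rad / 2) t)); rewrite Hcirc in Hb; nra. }
replace (0 * E 0 - c)%C with (- c)%C in HB by ring.
assert (Hc0 : (- c)%C <> 0) by (apply Cmod_gt_0; rewrite Cmod_opp; lra).
rewrite Cmod_inv, Cmod_opp in HB by easy.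
apply (Rmult_le_compat_r (Cmod c * (rad / 2 * e0 - Cmod c))) in HB; [|nra].
rewrite <- Rmult_assoc, Rinv_l, Rmult_1_l in HB by lra.
replace (2 * / (rad / 2 * e0 - Cmod c) * (Cmod c * (rad / 2 * e0 - Cmod c))) with (2 * Cmod c) in HB by (field; lra).
lra.
Qed.

Lemma Im_Ci_mult (x : R) : Im (Ci * RtoC x) = x.
Proof. unfold Im; simpl; ring. Qed.

Lemma Re_Ci_mult (x : R) : Re (Ci * RtoC x) = 0.
Proof. unfold Re; simpl; ring. Qed.

Definition inj_disk (f : C -> C) : Prop :=
  forall z w : C, Cmod z < 1 -> Cmod w < 1 -> f z = f w -> z = w.

(* A zero of [q] at [a] would make [f - f a] the [m]-th power, [m >= 2], of a function that
   covers a neighbourhood of 0, and hence not injective. *)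
Lemma inj_factor_neq_0 (f q : C -> C) (a : C) : inj_disk f -> holo 1 q -> Cmod a < 1 ->
  (forall w : C, Cmod w < 1 -> (f w = f a + (w - a) * q w)%C) -> q a <> 0.
Proof.
intros Hinj Hq Ha E Hqa.
assert (Hin : forall h : C, Cmod h < 1 - Cmod a -> Cmod (a + h) < 1).
{ intros h Hh; eapply Rle_lt_trans; [apply Cmod_triangle|lra]. }
set (h0 := RtoC ((1 - Cmod a) / 2)).
assert (Hh0 : Cmod h0 = (1 - Cmod a) / 2) by (unfold h0; rewrite Cmod_R, Rabs_pos_eq; lra).
destruct (holo_order (1 - Cmod a) (fun h => q (a + h)%C) h0) as [p [G [HG [HG0 EG]]]].
- now apply holo_translate.
- lra.
- intros H0; assert (Hz : f (a + h0)%C = f a) by (rewrite E, H0 by (apply Hin; lra); ring).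
  apply Hinj in Hz; [|apply Hin; lra|easy].
  assert (Hh : h0 = 0) by (replace h0 with (a + h0 - a)%C by ring; rewrite Hz; ring).
  rewrite Hh, Cmod_0 in Hh0; lra.
- assert (Hp : (1 <= p)%nat).
  { destruct p as [|p]; [exfalso|lia]; apply HG0.
    specialize (EG 0); rewrite Cmod_0 in EG; specialize (EG ltac:(lra)).
    replace (a + 0)%C with a in EG by ring; rewrite Hqa in EG; simpl in EG; rewrite Cmult_1_l in EG; now symmetry. }
  assert (HGd : exists d : R, 0 < d /\ forall w : C, Cmod w < d -> Cmod (G 0) / 2 <= Cmod (G w)).
  { destruct (ccont_neq_0 G 0) as [d [Hd H]]; [apply holo_ccont with (1 - Cmod a); [easy|rewrite Cmod_0; lra]|easy|].
    exists d; split; [easy|]; intros w Hw; apply H; now replace (w - 0)%C with w by ring. }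
  destruct HGd as [d1 [Hd1 HGd]].
  set (d := Rmin d1 (1 - Cmod a)).
  assert (Hd : 0 < d) by (apply Rmin_glb_lt; lra).
  assert (Hdl : d <= d1) by apply Rmin_l; assert (Hdr : d <= 1 - Cmod a) by apply Rmin_r.
  destruct (Cexp_surj (G 0) HG0) as [b0 Hb0].
  destruct (holo_log d G b0) as [l [Hl [_ El]]]; [easy|now apply holo_sub with (1 - Cmod a)| |easy|].
  { intros w Hw; apply Cmod_gt_0; specialize (HGd w ltac:(lra)); apply Cmod_gt_0 in HG0; lra. }
  (* The order [p] of [q] at [a] plus the factor [w - a]; below, [E1] is an [m]-th root of [G] near
     0, so that [f - f a] is the [m]-th power of [w * E1 w]. *)
  set (m := S p); assert (Hm : 2 <= INR m) by (replace 2 with (INR 2) by (simpl; ring); apply le_INR; unfold m; lia).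
  assert (HmC : RtoC (INR m) <> 0) by (intros H; apply RtoC_inj in H; lra).
  set (E1 := fun w => Cexp (/ RtoC (INR m) * l w)).
  assert (HE1 : holo d E1) by (apply holo_Cexp, holo_mult; [apply holo_const|easy]).
  assert (Hpow : forall w : C, Cmod w < d -> f (a + w)%C = (f a + (w * E1 w) ^ m)%C).
  { intros w Hw; rewrite E by (apply Hin; lra); rewrite (EG w) by lra; unfold E1.
    rewrite Cpow_mult_l, Cexp_pow.
    replace (RtoC (INR m) * (/ RtoC (INR m) * l w))%C with (l w) by (field; easy).
    rewrite El by easy; unfold m; rewrite Cpow_S; ring. }
  destruct (ccont_neq_0 E1 0) as [d2 [Hd2 HEd]]; [apply holo_ccont with d; [easy|rewrite Cmod_0; lra]|apply Cexp_neq_0|].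
  set (e0 := Cmod (E1 0) / 2) in *.
  assert (He0 : 0 < e0) by (unfold e0; assert (0 < Cmod (E1 0)) by (apply Cmod_gt_0, Cexp_neq_0); lra).
  set (d3 := Rmin d d2); assert (Hd3 : 0 < d3) by (now apply Rmin_glb_lt).
  assert (Hd3l : d3 <= d) by apply Rmin_l; assert (Hd3r : d3 <= d2) by apply Rmin_r.
  assert (HE3 : holo d3 E1) by (now apply holo_sub with d).
  assert (Hb3 : forall w : C, Cmod w < d3 -> e0 <= Cmod (E1 w)).
  { intros w Hw; apply HEd; replace (w - 0)%C with w by ring; lra. }
  (* A root of unity other than 1, as [m >= 2]. Both [c] and [om * c] are values of [w * E1 w] and
     have the same [m]-th power, so injectivity would force [om = 1]. The size of [c] is half of
     what [holo_covers] allows. *)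
  set (om := Cexp (Ci * RtoC (2 * PI / INR m))).
  assert (Homm : (om ^ m)%C = 1).
  { unfold om; rewrite Cexp_pow, <- Cexp_0, <- (Cexp_2PI 0); f_equal.
    unfold Rdiv; rewrite RtoC_mult, RtoC_inv by lra; field; easy. }
  assert (Hom1 : Cmod om = 1).
  { unfold om; rewrite Cmod_Cexp, Re_Ci_mult; apply exp_0. }
  set (c := RtoC (d3 / 2 * e0 / 6)).
  assert (Hcp : 0 < d3 / 2 * e0 / 6) by (assert (0 < d3 / 2 * e0) by (apply Rmult_lt_0_compat; lra); lra).
  assert (Hc : Cmod c = d3 / 2 * e0 / 6) by (unfold c; rewrite Cmod_R, Rabs_pos_eq; lra).
  destruct (holo_covers d3 E1 e0 c) as [w1 [Hw1 Ew1]]; try easy; [rewrite Hc; lra|].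
  destruct (holo_covers d3 E1 e0 (om * c)%C) as [w2 [Hw2 Ew2]]; try easy; [rewrite Cmod_mult, Hom1, Hc; lra|].
  assert (Hw : w1 = w2).
  { assert (H : (a + w1)%C = (a + w2)%C).
    { apply Hinj; [apply Hin; lra|apply Hin; lra|].
      rewrite !Hpow by lra; rewrite Ew1, Ew2, Cpow_mult_l, Homm; ring. }
    replace w1 with (a + w1 - a)%C by ring; rewrite H; ring. }
  rewrite <- Hw, Ew1 in Ew2.
  assert (Hc0 : c <> 0) by (apply Cmod_gt_0; lra).
  assert (Hom : om = 1).
  { replace om with (om * c / c)%C by (field; easy); rewrite <- Ew2; field; easy. }
  apply Cexp_eq_1 in Hom.
  + apply (f_equal Im) in Hom; rewrite Im_Ci_mult in Hom; change (Im 0) with 0 in Hom.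
    pose proof PI_RGT_0; assert (0 < 2 * PI / INR m) by (apply Rdiv_lt_0_compat; lra); lra.
  + rewrite Im_Ci_mult.
    pose proof PI_RGT_0; rewrite Rabs_pos_eq by (left; apply Rdiv_lt_0_compat; lra).
    apply Rmult_lt_reg_r with (INR m); [lra|]; unfold Rdiv; rewrite Rmult_assoc, Rinv_l by lra; nra.
Qed.

(** At [a] this is [inj_factor_neq_0]; a zero of [q] elsewhere would make [f] take the value [f a]
    twice. *)
Lemma inj_factor (f : C -> C) (a : C) : holo 1 f -> inj_disk f -> Cmod a < 1 ->
  exists q : C -> C, holo 1 q /\ (forall w : C, Cmod w < 1 -> q w <> 0) /\
    forall w : C, Cmod w < 1 -> (f w = f a + (w - a) * q w)%C.
Proof.
intros Hf Hinj Ha; destruct (holo_factor f a Hf Ha) as [q [Hq E]].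
exists q; split; [easy|split; [|easy]]; intros w Hw; destruct (Ceq_dec w a) as [->|Hwa].
- now apply (inj_factor_neq_0 f q a).
- intros H0; apply Hwa, Hinj; try easy; rewrite E, H0 by easy; ring.
Qed.

Lemma cts_comp (g u : R -> R) : (forall t : R, continuous g (u t)) -> cts u -> cts (fun t => g (u t)).
Proof. intros Hg Hu t; apply (continuous_comp u g); [apply Hu|apply Hg]. Qed.

Lemma continuous_of_derivable (g : R -> R) (x l : R) : is_derive g x l -> continuous g x.
Proof. intros H; apply (@ex_derive_continuous R_AbsRing R_NormedModule); now exists l. Qed.

Lemma cts_ln (u : R -> R) : (forall t : R, 0 < u t) -> cts u -> cts (fun t => ln (u t)).
Proof.
intros Hp; apply cts_comp; intros t.
now apply (continuous_of_derivable ln _ (/ u t)), is_derive_ln.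
Qed.

Lemma holo_ccts_circ (rad r : R) (h : C -> C) : holo rad h -> 0 <= r < rad -> ccts (fun w => h (circ r w)).
Proof.
intros Hh Hr t; apply (ccont_comp h (circ r)); [apply ccont_circ|].
apply holo_ccont with rad; [easy|]; rewrite Cmod_circ; lra.
Qed.

Lemma holo_cts_ln (rad r : R) (h : C -> C) : holo rad h -> 0 <= r < rad ->
  (forall t : R, h (circ r t) <> 0) -> cts (fun t => ln (Cmod (h (circ r t)))).
Proof.
intros Hh Hr Hn; apply cts_ln; [intros t; apply Cmod_gt_0, Hn|].
apply (ccts_Cmod (fun w => h (circ r w))); now apply holo_ccts_circ with rad.
Qed.

(** [ln |h|] is the real part of a holomorphic logarithm, to which the mean value property
    applies. *)
Lemma mean_ln_nonvanishing (rad r : R) (h : C -> C) : holo rad h -> 0 < r < rad ->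
  (forall z : C, Cmod z < rad -> h z <> 0) ->
  mean (fun t => ln (Cmod (h (circ r t)))) = ln (Cmod (h 0)).
Proof.
intros Hh Hr Hn; destruct (Cexp_surj (h 0)) as [c Hc]; [apply Hn; rewrite Cmod_0; lra|].
destruct (holo_log rad h c ltac:(lra) Hh Hn Hc) as [l [[l' Hl] [Hl0 El]]].
rewrite (mean_ext _ (fun t => Re (l (circ r t)))).
- change (mean (fun t => Re (l (circ r t)))) with (Re (Cmean (fun t => l (circ r t)))).
  rewrite (hol_mean_value rad r l l' Hl) by lra.
  rewrite <- (El 0), Cmod_Cexp, ln_exp by (rewrite Cmod_0; lra); easy.
- intros t; rewrite <- El, Cmod_Cexp, ln_exp by (rewrite Cmod_circ; lra); easy.
Qed.

Lemma mean_ln_linear (r : R) (a : C) : 0 < r -> Cmod a <> r ->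
  mean (fun t => ln (Cmod (circ r t - a))) = ln (Rmax r (Cmod a)).
Proof.
intros Hr Ha; pose proof (Cmod_ge_0 a); destruct (Rlt_dec r (Cmod a)) as [Hlt|Hge].
- rewrite Rmax_right by lra.
  rewrite (mean_ln_nonvanishing (Cmod a) r (fun z => z - a)%C).
  + f_equal; replace (0 - a)%C with (- a)%C by ring; apply Cmod_opp.
  + apply holo_minus; [apply holo_id|apply holo_const].
  + lra.
  + intros z Hz; apply Cminus_neq_0; intros ->; lra.
- rewrite Rmax_left by lra.
  (* [|r e^(it) - a| = |r - conj a e^(it)|] *)
  set (h := fun z => (RtoC r - Cconj a * z)%C).
  rewrite (mean_ext _ (fun t => ln (Cmod (h (circ 1 t))))).
  (* This radius lies above 1 and keeps [|a| |z|] below [r], so [h] has no zero in the disk. *)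
  + rewrite (mean_ln_nonvanishing (2 * r / (Cmod a + r)) 1 h).
    * unfold h; replace (RtoC r - Cconj a * 0)%C with (RtoC r) by ring.
      rewrite Cmod_R, Rabs_pos_eq; lra.
    * unfold h; apply holo_minus; [apply holo_const|apply holo_mult; [apply holo_const|apply holo_id]].
    * split; [lra|]; apply Rmult_lt_reg_r with (Cmod a + r); [lra|].
      unfold Rdiv; rewrite Rmult_assoc, Rinv_l; lra.
    * intros z Hz; unfold h; apply Cminus_neq_0; intros E.
      apply (f_equal Cmod) in E; rewrite Cmod_mult, Cmod_conj, Cmod_R, Rabs_pos_eq in E by lra.
      apply (Rmult_lt_compat_r (Cmod a + r)) in Hz; [|lra].
      unfold Rdiv in Hz; rewrite Rmult_assoc, Rinv_l in Hz by lra.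
      nra.
  + intros t; f_equal; unfold h.
    assert (E : (Cconj (circ r t) * circ 1 t)%C = RtoC r).
    { unfold circ; rewrite Cmult_conj.
      replace (Cconj (RtoC r) * Cconj (Cexp (Ci * t)) * (RtoC 1 * Cexp (Ci * t)))%C
        with (Cconj (RtoC r) * (Cexp (Ci * t) * Cconj (Cexp (Ci * t))))%C by ring.
      rewrite <- Cmod2_conj, Cmod_Cexp, Re_Ci_mult, exp_0.
      apply injective_projections; simpl; ring. }
    assert (HE : (RtoC r - Cconj a * circ 1 t = Cconj (circ r t - a) * circ 1 t)%C).
    { rewrite Cminus_conj, <- E; ring. }
    rewrite HE, Cmod_mult, Cmod_conj, Cmod_circ by lra; ring.
Qed.

Lemma Rmax_ln_lipschitz (r1 r2 x : R) : 0 < r1 < r2 -> ln (Rmax r2 x) - ln (Rmax r1 x) <= ln r2 - ln r1.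
Proof.
intros Hr; assert (Hm1 : ln r1 < ln r2) by (apply ln_increasing; lra).
destruct (Rle_dec x r1); [rewrite !Rmax_left; lra|].
destruct (Rle_dec x r2).
- rewrite Rmax_left, Rmax_right by lra; assert (ln r1 < ln x) by (apply ln_increasing; lra); lra.
- rewrite !Rmax_right by lra; lra.
Qed.

Lemma ln_mult_Cmod (a b : C) : a <> 0 -> b <> 0 -> ln (Cmod (a * b)) = ln (Cmod a) + ln (Cmod b).
Proof. intros Ha Hb; rewrite Cmod_mult; apply ln_mult; now apply Cmod_gt_0. Qed.

(** Univalence allows at most one zero [a] of [f - w]. With one zero, [f - w = (z - a) q] with [q]
    zero-free and the mean is [ln (max r |a|)] plus a constant; with none it is constant. *)
Lemma inj_jensen (f : C -> C) (r1 r2 : R) (w : C) : holo 1 f -> inj_disk f -> 0 < r1 < r2 -> r2 < 1 ->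
  (forall t : R, f (circ r1 t) <> w) -> (forall t : R, f (circ r2 t) <> w) ->
  mean (fun t => ln (Cmod (f (circ r2 t) - w))) - mean (fun t => ln (Cmod (f (circ r1 t) - w))) <= ln r2 - ln r1.
Proof.
intros Hf Hinj Hr Hr2 H1 H2.
assert (Hl : ln r1 < ln r2) by (apply ln_increasing; lra).
destruct (classic (exists a : C, Cmod a < 1 /\ f a = w)) as [[a [Ha Hfa]]|Hno].
- destruct (inj_factor f a Hf Hinj Ha) as [q [Hq [Hqn E]]].
  assert (A : forall r : R, 0 < r < 1 -> (forall t : R, f (circ r t) <> w) ->
    mean (fun t => ln (Cmod (f (circ r t) - w))) = ln (Rmax r (Cmod a)) + ln (Cmod (q 0))).
  { intros r Hr' Hnr; assert (Hcirc : forall t : R, Cmod (circ r t) = r) by (intros; apply Cmod_circ; lra).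
    assert (Hca : forall t : R, circ r t <> a) by (intros t E0; apply (Hnr t); now rewrite E0).
    assert (Har : Cmod a <> r).
    { intros Har; assert (Ha0 : a <> 0) by (apply Cmod_gt_0; lra).
      destruct (circ_surj a Ha0) as [t [_ Et]]; rewrite Har in Et; exact (Hca t Et). }
    rewrite <- (mean_ln_linear r a), <- (mean_ln_nonvanishing 1 r q Hq) by (try easy; lra).
    rewrite <- mean_plus.
    - apply mean_ext; intros t; rewrite E, Hfa by (rewrite Hcirc; lra).
      rewrite <- ln_mult_Cmod by (first [apply Hqn; rewrite Hcirc; lra|apply Cminus_neq_0, Hca]).
      do 2 f_equal; ring.
    - apply (holo_cts_ln 1 r (fun z => z - a)%C); [|lra|intros; apply Cminus_neq_0, Hca].
      apply holo_minus; [apply holo_id|apply holo_const].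
    - apply (holo_cts_ln 1); [easy|lra|]; intros; apply Hqn; rewrite Hcirc; lra. }
  rewrite !A by (try easy; lra); pose proof (Rmax_ln_lipschitz r1 r2 (Cmod a) Hr); lra.
- assert (A : forall r : R, 0 < r < 1 -> mean (fun t => ln (Cmod (f (circ r t) - w))) = ln (Cmod (f 0 - w))).
  { intros r Hr'; apply (mean_ln_nonvanishing 1 r (fun z => f z - w)%C); [|lra|].
    - apply holo_minus; [easy|apply holo_const].
    - intros z Hz; apply Cminus_neq_0; intros E; apply Hno; now exists z. }
  rewrite !A by lra; lra.
Qed.

(** * Powers avoiding a point *)

Definition lprod (v : C) (l : list C) : C := fold_right (fun w acc => (v - w) * acc)%C (RtoC 1) l.

Lemma lprod_app (v : C) (l1 l2 : list C) : lprod v (l1 ++ l2) = (lprod v l1 * lprod v l2)%C.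
Proof. induction l1 as [|w l IH]; simpl; [ring|rewrite IH; ring]. Qed.

Lemma lprod_neq_0 (v : C) (l : list C) : (forall w : C, In w l -> v <> w) <-> lprod v l <> 0.
Proof.
induction l as [|w l IH]; simpl; split; intros H.
- apply Cmod_gt_0; rewrite Cmod_1; lra.
- easy.
- apply Cmult_neq_0; [apply Cminus_neq_0; auto|apply IH; auto].
- intros u [<-|Hu] E; apply H.
  + rewrite E; ring.
  + subst u; destruct (Ceq_dec (lprod v l) 0) as [->|Hn]; [ring|].
    exfalso; now apply (proj2 IH Hn v Hu).
Qed.

Lemma Csqrt_exists (c : C) : exists s : C, (s * s)%C = c.
Proof.
destruct (Ceq_dec c 0) as [->|Hc]; [exists 0; ring|].
destruct (Cexp_surj c Hc) as [b Hb]; exists (Cexp (/ 2 * b)).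
rewrite <- Cexp_plus, <- Hb; f_equal; field.
Qed.

(** For [W = s^2] the difference of squares splits into the factorizations for [s] and [- s], so
    only square roots have to exist. The exponent is a power of two for this reason. *)
Lemma pow2_factorization (k : nat) (W : C) :
  exists l : list C, length l = (2 ^ k)%nat /\ forall v : C, (v ^ (2 ^ k) - W)%C = lprod v l.
Proof.
revert W; induction k as [|k IH]; intros W.
- exists (W :: nil); split; [easy|]; intros v; simpl; ring.
- destruct (Csqrt_exists W) as [s Hs].
  destruct (IH s) as [l1 [H1 E1]]; destruct (IH (- s)%C) as [l2 [H2 E2]].
  exists (l1 ++ l2); split; [rewrite length_app; simpl; lia|]; intros v.
  rewrite lprod_app, <- E1, <- E2, <- Hs; simpl Nat.pow.
  rewrite Nat.add_0_r, Cpow_add_r; ring.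
Qed.

Lemma inj_jensen_lprod (f : C -> C) (r1 r2 : R) (l : list C) : holo 1 f -> inj_disk f ->
  0 < r1 < r2 -> r2 < 1 ->
  (forall t : R, lprod (f (circ r1 t)) l <> 0) -> (forall t : R, lprod (f (circ r2 t)) l <> 0) ->
  mean (fun t => ln (Cmod (lprod (f (circ r2 t)) l))) - mean (fun t => ln (Cmod (lprod (f (circ r1 t)) l)))
    <= INR (length l) * (ln r2 - ln r1).
Proof.
intros Hf Hinj Hr Hr2; induction l as [|w l IH]; intros H1 H2.
- simpl; lra.
- assert (Hw : forall r t : R, lprod (f (circ r t)) (w :: l) <> 0 ->
    f (circ r t) <> w /\ lprod (f (circ r t)) l <> 0).
  { intros r t H; split; [|apply lprod_neq_0]; pose proof (proj2 (lprod_neq_0 _ _) H) as H'; simpl in H'; auto. }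
  assert (A : forall r : R, 0 < r < 1 -> (forall t : R, lprod (f (circ r t)) (w :: l) <> 0) ->
    mean (fun t => ln (Cmod (lprod (f (circ r t)) (w :: l)))) =
    mean (fun t => ln (Cmod (f (circ r t) - w))) + mean (fun t => ln (Cmod (lprod (f (circ r t)) l)))).
  { intros r Hr' H; rewrite <- mean_plus.
    - apply mean_ext; intros t; destruct (Hw r t (H t)); simpl.
      apply ln_mult_Cmod; [now apply Cminus_neq_0|easy].
    - apply (holo_cts_ln 1 r (fun z => f z - w)%C); [apply holo_minus; [easy|apply holo_const]|lra|].
      intros t; apply Cminus_neq_0; now apply Hw.
    - apply (holo_cts_ln 1 r (fun z => lprod (f z) l)); [|lra|intros t; now apply Hw].
      clear -Hf; induction l as [|v l IH]; [apply (holo_const 1 1)|].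
      simpl; apply (holo_mult 1 (fun z => f z - v)%C (fun z => lprod (f z) l)); [|easy].
      apply holo_minus; [easy|apply holo_const]. }
  rewrite !A by (try easy; lra); change (length (w :: l)) with (S (length l)); rewrite S_INR.
  assert (I1 := IH (fun t => proj2 (Hw r1 t (H1 t))) (fun t => proj2 (Hw r2 t (H2 t)))).
  pose proof (inj_jensen f r1 r2 w Hf Hinj Hr Hr2 (fun t => proj1 (Hw r1 t (H1 t))) (fun t => proj1 (Hw r2 t (H2 t)))).
  lra.
Qed.

(** Pigeonhole: by the separation, a point of [l] is closer than [delta] to at most one of the
    [c i], so each point eliminates at most one candidate. *)
Lemma separated_point (c : nat -> C) (delta : R) (l : list C) (idx : list nat) : NoDup idx ->
  (forall i j : nat, In i idx -> In j idx -> i <> j -> 2 * delta <= Cmod (c i - c j)) ->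
  (length l < length idx)%nat ->
  exists i : nat, In i idx /\ forall p : C, In p l -> delta <= Cmod (p - c i).
Proof.
revert idx; induction l as [|p l IH]; intros idx Hnd Hsep Hlen.
- destruct idx as [|i idx]; [simpl in Hlen; lia|]; exists i; split; [now left|easy].
- destruct (classic (exists i : nat, In i idx /\ Cmod (p - c i) < delta)) as [[i [Hi Hpi]]|Hno].
  + destruct (in_split i idx Hi) as [l1 [l2 ->]].
    destruct (IH (l1 ++ l2)) as [j [Hj HJ]].
    * now apply NoDup_remove_1 with i.
    * intros a b Ha Hb; apply Hsep; apply in_app_iff; simpl; apply in_app_iff in Ha, Hb; tauto.
    * rewrite length_app in *; simpl in Hlen; lia.
    * exists j; split; [apply in_app_iff; simpl; apply in_app_iff in Hj; tauto|].
      intros q [<-|Hq]; [|now apply HJ].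
      assert (Hij : i <> j) by (intros ->; now apply (NoDup_remove_2 l1 l2 j)).
      assert (Hs : 2 * delta <= Cmod (c i - c j)).
      { apply Hsep; [easy| |easy]; apply in_app_iff; simpl; apply in_app_iff in Hj; tauto. }
      pose proof (Cmod_triangle (c i - p) (p - c j)) as Ht.
      replace (c i - p + (p - c j))%C with (c i - c j)%C in Ht by ring.
      rewrite (Cmod_minus_sym (c i) p) in Ht; lra.
  + destruct (IH idx Hnd Hsep) as [j [Hj HJ]]; [simpl in Hlen; lia|].
    exists j; split; [easy|]; intros q [<-|Hq]; [|now apply HJ].
    apply Rnot_lt_le; intros Hlt; apply Hno; now exists j.
Qed.

Lemma grid_point (n : nat) (l : list C) : (0 < n)%nat -> (length l < n * n)%nat ->
  exists W : C, 1 <= Cmod W <= 2 /\ forall p : C, In p l -> / (4 * INR n) <= Cmod (p - W).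
Proof.
intros Hn Hlen; assert (HnR : 0 < INR n) by now apply lt_0_INR.
(* An [n] by [n] grid of spacing [1 / (2 n)] in the square [[1, 3/2] x [0, 1/2]], all of whose
   points have modulus between 1 and 2. *)
set (c := fun i : nat => (1 + INR (i / n) / (2 * INR n), INR (i mod n) / (2 * INR n)) : C).
assert (Hx : forall a : nat, (a < n)%nat -> 0 <= INR a / (2 * INR n) <= 1 / 2).
{ intros a Ha; apply lt_INR in Ha; pose proof (pos_INR a); split.
  - apply Rmult_le_pos; [easy|left; apply Rinv_0_lt_compat; lra].
  - apply Rmult_le_reg_r with (2 * INR n); [lra|]; unfold Rdiv at 1; rewrite Rmult_assoc, Rinv_l; lra. }
assert (Hdist : forall a b : nat, a <> b -> 2 * / (4 * INR n) <= Rabs (INR a / (2 * INR n) - INR b / (2 * INR n))).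
{ intros a b Hab.
  replace (INR a / (2 * INR n) - INR b / (2 * INR n)) with ((INR a - INR b) * / (2 * INR n)) by (field; lra).
  rewrite Rabs_mult, (Rabs_pos_eq (/ _)) by (left; apply Rinv_0_lt_compat; lra).
  replace (2 * / (4 * INR n)) with (1 * / (2 * INR n)) by (field; lra).
  apply Rmult_le_compat_r; [left; apply Rinv_0_lt_compat; lra|].
  destruct (Nat.lt_gt_cases a b) as [H _]; destruct (H Hab) as [Hl|Hl]; apply (le_INR (S _)) in Hl; rewrite S_INR in Hl.
  - rewrite Rabs_left1; lra.
  - rewrite Rabs_pos_eq; lra. }
destruct (separated_point c (/ (4 * INR n)) l (seq 0 (n * n))) as [i [Hi HI]].
- apply seq_NoDup.
- intros i j Hi Hj Hij.
  destruct (Nat.eq_dec (i / n) (j / n)) as [E1|E1]; [destruct (Nat.eq_dec (i mod n) (j mod n)) as [E2|E2]|].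
  + exfalso; apply Hij; rewrite (Nat.div_mod_eq i n), (Nat.div_mod_eq j n); congruence.
  + eapply Rle_trans; [apply (Hdist _ _ E2)|].
    eapply Rle_trans; [|apply im_le_Cmod]; right; f_equal; unfold c, Im; simpl; ring.
  + eapply Rle_trans; [apply (Hdist _ _ E1)|].
    eapply Rle_trans; [|apply re_le_Cmod]; right; f_equal; unfold c, Re; simpl; ring.
- now rewrite length_seq.
- exists (c i); split; [|easy]; apply in_seq in Hi.
  assert (H1 : (i / n < n)%nat) by (apply Nat.Div0.div_lt_upper_bound; lia).
  assert (H2 : (i mod n < n)%nat) by (apply Nat.mod_upper_bound; lia).
  apply Hx in H1, H2; split.
  + eapply Rle_trans; [|apply re_le_Cmod]; unfold c, Re; simpl; rewrite Rabs_pos_eq; lra.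
  + eapply Rle_trans; [apply Cmod_le_sum|]; unfold c, Re, Im; simpl; rewrite !Rabs_pos_eq; lra.
Qed.

Lemma grid_near (m : nat) (h t : R) : 0 < h -> 0 <= t <= INR m * h ->
  exists j : nat, (j <= m)%nat /\ 0 <= INR j * h <= INR m * h /\ Rabs (t - INR j * h) <= h.
Proof.
intros Hh; induction m as [|m IH]; intros Ht.
- exists O; simpl in *; repeat split; try lia; try lra; rewrite Rabs_pos_eq; lra.
- rewrite S_INR in Ht; destruct (Rle_dec t (INR m * h)) as [Hle|Hgt].
  + destruct IH as [j [Hj [Hj' HJ]]]; [lra|]; exists j; rewrite S_INR; repeat split; [lia|lra|lra|easy].
  + exists m; rewrite S_INR; pose proof (pos_INR m); repeat split; [lia|nra|nra|].
    rewrite Rabs_pos_eq; lra.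
Qed.

Lemma Cpow_lipschitz (m : R) (u v : C) (p : nat) : Cmod u <= m -> Cmod v <= m -> 1 <= m ->
  Cmod (v ^ p - u ^ p) <= INR p * m ^ p * Cmod (v - u).
Proof.
intros Hu Hv Hm; induction p as [|p IH]; [simpl; rewrite Cmod_0_minus; lra|].
rewrite !Cpow_S, S_INR; replace (v * v ^ p - u * u ^ p)%C with (v * (v ^ p - u ^ p) + (v - u) * u ^ p)%C by ring.
eapply Rle_trans; [apply Cmod_triangle|]; rewrite !Cmod_mult, Cmod_pow; simpl.
pose proof (Cmod_ge_0 u); pose proof (Cmod_ge_0 v); pose proof (Cmod_ge_0 (v - u)).
pose proof (Cmod_ge_0 (v ^ p - u ^ p)).
assert (Hp : Cmod u ^ p <= m ^ p) by (apply pow_incr; lra).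
assert (Hp1 : 1 <= m ^ p) by (apply pow_R1_Rle; lra).
assert (B : Cmod (v - u) * Cmod u ^ p <= Cmod (v - u) * (m * m ^ p)) by (apply Rmult_le_compat_l; nra).
nra.
Qed.

Lemma pow_1_inv_le (p : nat) : (0 < p)%nat -> (1 + / INR p) ^ p <= 3.
Proof.
intros Hp; assert (HpR : 0 < INR p) by now apply lt_0_INR.
eapply Rle_trans; [|apply exp_le_3].
replace 1 with (INR p * / INR p) at 2 by (field; lra).
rewrite <- (ln_exp (/ INR p)) at 2.
change (exp (INR p * ln (exp (/ INR p)))) with (Rpower (exp (/ INR p)) (INR p)).
rewrite Rpower_pow by apply exp_pos.
apply pow_incr; split; [left; pose proof (Rinv_0_lt_compat _ HpR); lra|apply exp_ineq1_le].
Qed.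

(* Fewer than [n^2] sample values come within [1 / (8 n)] of every point of the two power
   curves, while the grid has [n^2] candidates for [W]. *)
Lemma avoid_power_curves (v1 v2 : R -> C) (K p : nat) : (0 < K)%nat -> (0 < p)%nat ->
  (forall i : bool, forall t s : R, 0 <= t <= 2 * PI -> 0 <= s <= 2 * PI ->
    Cmod ((if i then v1 else v2) t - (if i then v1 else v2) s) <= INR K * Rabs (t - s)) ->
  exists W : C, 1 <= Cmod W <= 2 /\ forall i : bool, forall t : R, 0 <= t <= 2 * PI ->
    Cmod ((if i then v1 else v2) t) ^ p <= 3 ->
    / (9232 * INR p * INR K) <= Cmod ((if i then v1 else v2) t ^ p - W).
Proof.
intros HK Hp HL.
(* The [2 (N + 1)] samples number fewer than [n^2] because 1154 exceeds twice 576. The mesh makes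
   consecutive samples of the curves differ by at most [1 / (72 p n)], as [pi <= 4] and
   [576 = 8 * 72]; with the Lipschitz factor [9 p] of the power, [72 = 8 * 9] leaves [1 / (8 n)].
   Finally [9232 = 8 * 1154]. *)
set (n := (1154 * (p * K))%nat); set (N := (576 * (p * K) * n)%nat).
assert (HpR : 1 <= INR p) by (apply (le_INR 1); lia); assert (HKR : 1 <= INR K) by (apply (le_INR 1); lia).
assert (Hn : INR n = 1154 * (INR p * INR K)) by (unfold n; rewrite !mult_INR, INR_IZR_INZ; simpl; ring).
assert (HN : INR N = 576 * (INR p * INR K) * INR n) by (unfold N; rewrite !mult_INR, INR_IZR_INZ; simpl; ring).
assert (HpK : 1 <= INR p * INR K) by nra.
assert (HNR : 0 < INR N) by (rewrite HN; nra).
pose proof PI_RGT_0 as Hpi; pose proof PI_4 as Hpi4.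
set (h := 2 * PI / INR N); assert (Hh : 0 < h) by (apply Rdiv_lt_0_compat; lra).
assert (HNh : INR N * h = 2 * PI) by (unfold h; field; lra).
set (samples := map (fun j => v1 (INR j * h)%R ^ p)%C (seq 0 (S N)) ++ map (fun j => v2 (INR j * h)%R ^ p)%C (seq 0 (S N))).
destruct (grid_point n samples) as [W [HW HWs]].
- unfold n; nia.
- unfold samples; rewrite length_app, !length_map, !length_seq; unfold N, n; nia.
- exists W; split; [easy|]; intros i t Ht Hv.
  set (v := if i then v1 else v2) in *.
  destruct (grid_near N h t Hh) as [j [Hj [Hj' HJ]]]; [lra|].
  set (s := INR j * h) in *.
  assert (Hs : / (4 * INR n) <= Cmod (v s ^ p - W)).
  { apply HWs; unfold samples; apply in_app_iff; unfold v, s; destruct i; [left|right].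
    - apply (in_map (fun j => v1 (INR j * h)%R ^ p)%C), in_seq; lia.
    - apply (in_map (fun j => v2 (INR j * h)%R ^ p)%C), in_seq; lia. }
  assert (Hd : Cmod (v t - v s) <= INR K * h).
  { eapply Rle_trans; [apply HL; [easy|lra]|]; apply Rmult_le_compat_l; lra. }
  assert (HKh : INR K * h <= / (72 * INR p * INR n)).
  { unfold h; rewrite HN; apply Rmult_le_reg_r with (72 * INR p * INR n); [nra|].
    rewrite Rinv_l by nra.
    replace (INR K * (2 * PI / (576 * (INR p * INR K) * INR n)) * (72 * INR p * INR n)) with (PI / 4) by (field; lra).
    lra. }
  assert (Hip : / (72 * INR p * INR n) <= / INR p).
  { apply Rinv_le_contravar; [lra|]; nra. }
  set (m := Rmax (Cmod (v t)) 1).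
  assert (Hm1 : 1 <= m) by apply Rmax_r; assert (Hmv : Cmod (v t) <= m) by apply Rmax_l.
  assert (Hmp : m ^ p <= 3).
  { unfold m, Rmax; destruct (Rle_dec (Cmod (v t)) 1); [rewrite pow1; lra|easy]. }
  assert (Hip0 : 0 < / INR p) by (apply Rinv_0_lt_compat; lra).
  (* The sample value next to [v t] may be larger than [m], by a factor at most [1 + 1 / p], which
     costs another factor 3 in the [p]-th power. *)
  assert (Hms : (m * (1 + / INR p)) ^ p <= 9).
  { rewrite Rpow_mult_distr; pose proof (pow_1_inv_le p Hp).
    assert (0 <= (1 + / INR p) ^ p) by (apply pow_le; lra); nra. }
  assert (Hvs : Cmod (v s) <= m * (1 + / INR p)).
  { pose proof (Cmod_rev_triangle (v s) (v t)) as Hr; rewrite Cmod_minus_sym in Hr; nra. }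
  assert (Hvt : Cmod (v t) <= m * (1 + / INR p)) by nra.
  pose proof (Cpow_lipschitz (m * (1 + / INR p)) (v s) (v t) p Hvs Hvt ltac:(nra)) as HLp.
  pose proof (Cmod_ge_0 (v t - v s)) as Hd0.
  assert (Hclose : Cmod (v t ^ p - v s ^ p) <= / (8 * INR n)).
  { eapply Rle_trans; [exact HLp|].
    apply Rle_trans with (INR p * 9 * / (72 * INR p * INR n)).
    - apply Rmult_le_compat; [|easy| |lra].
      + apply Rmult_le_pos; [lra|apply pow_le; nra].
      + apply Rmult_le_compat_l; lra.
    - right; field; lra. }
  pose proof (Cmod_triangle (v s ^ p - v t ^ p) (v t ^ p - W)) as Htr.
  replace (v s ^ p - v t ^ p + (v t ^ p - W))%C with (v s ^ p - W)%C in Htr by ring.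
  rewrite (Cmod_minus_sym (v s ^ p) (v t ^ p)) in Htr.
  replace (/ (9232 * INR p * INR K)) with (/ (8 * INR n)) by (rewrite Hn; f_equal; ring).
  assert (/ (4 * INR n) = 2 * / (8 * INR n)) by (field; lra).
  lra.
Qed.

(** * Means of the truncated logarithm *)

(** The constant is a positive natural number because it enters the grid sizes in
    [avoid_power_curves]. *)
Lemma circ_lipschitz (f : C -> C) (r : R) : holo 1 f -> 0 < r < 1 ->
  exists K : nat, (0 < K)%nat /\ forall t s : R, 0 <= t <= 2 * PI -> 0 <= s <= 2 * PI ->
    Cmod (f (circ r t) - f (circ r s)) <= INR K * Rabs (t - s).
Proof.
intros [f' Hf] Hr.
assert (Hcirc : forall t : R, Cmod (circ r t) < 1) by (intros; rewrite Cmod_circ; lra).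
set (G' := fun w => (f' (circ r w) * (Ci * circ r w))%C).
assert (HG : forall t : R, cdiff (fun w => f (circ r w)) t (G' t)).
{ intros t; apply (cdiff_comp f (circ r)); [apply cdiff_circ|apply Hf, Hcirc]. }
assert (HG' : ccts G').
{ intros t; apply ccont_mult; [apply (ccont_comp f' (circ r)); [apply ccont_circ|apply Hf, Hcirc]|].
  apply ccont_mult; [apply ccont_const|apply ccont_circ]. }
destruct (cts_bounded_above _ (ccts_Cmod _ HG')) as [M HM].
destruct (INR_unbounded (2 * M)) as [K0 HK0].
assert (A : forall p : C -> R, (forall z : C, Rabs (p z) <= Cmod z) ->
  (forall t : R, is_derive (fun s : R => p (f (circ r s))) t (p (G' t))) ->
  forall t s : R, 0 <= t <= 2 * PI -> 0 <= s <= 2 * PI ->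
  Rabs (p (f (circ r t)) - p (f (circ r s))) <= M * Rabs (t - s)).
{ intros p Hp Hd t s Ht Hs.
  destruct (MVT_gen (fun s : R => p (f (circ r s))) s t (fun t => p (G' (RtoC t)))) as [c [Hc E]].
  - intros x _; apply Hd.
  - intros x _; apply continuity_pt_filterlim; now apply continuous_of_derivable with (p (G' (RtoC x))).
  - rewrite E, Rabs_mult; apply Rmult_le_compat_r; [apply Rabs_pos|].
    eapply Rle_trans; [apply Hp|apply HM].
    pose proof (Rmin_glb _ _ _ (proj1 Hs) (proj1 Ht)); pose proof (Rmax_lub _ _ _ (proj2 Hs) (proj2 Ht)); lra. }
exists (S K0); split; [lia|]; intros t s Ht Hs.
eapply Rle_trans; [apply Cmod_le_sum|].
assert (HRe := A Re re_le_Cmod (fun t => cdiff_is_derive_Re _ t _ (HG t)) t s Ht Hs).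
assert (HIm := A Im im_le_Cmod (fun t => cdiff_is_derive_Im _ t _ (HG t)) t s Ht Hs).
replace (Re (f (circ r t) - f (circ r s))) with (Re (f (circ r t)) - Re (f (circ r s))) by (unfold Re; simpl; ring).
replace (Im (f (circ r t) - f (circ r s))) with (Im (f (circ r t)) - Im (f (circ r s))) by (unfold Im; simpl; ring).
rewrite S_INR; pose proof (Rabs_pos (t - s)); nra.
Qed.

(** If [|v|^p <= 3], the maximum has [p]-th power at most 3 and the assumed distance is enough. If
    [|v|^p > 3], then [|v^p - W| >= |v|^p - 2 >= |v|^p / 3]. *)
Lemma pow_minus_bounds (v W : C) (p : nat) (delta : R) : 0 < delta <= 1 -> 1 <= Cmod W <= 2 ->
  (Cmod v ^ p <= 3 -> delta <= Cmod (v ^ p - W)) ->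
  delta / 3 * Rmax (Cmod v) 1 ^ p <= Cmod (v ^ p - W) <= 3 * Rmax (Cmod v) 1 ^ p.
Proof.
intros Hd HW H; pose proof (Cmod_ge_0 v).
set (m := Rmax (Cmod v) 1).
assert (Hm1 : 1 <= m) by apply Rmax_r; assert (Hmv : Cmod v <= m) by apply Rmax_l.
assert (Hmp : 1 <= m ^ p) by (apply pow_R1_Rle; lra).
assert (Hvp : Cmod v ^ p <= m ^ p) by (apply pow_incr; lra).
split.
- destruct (Rle_dec (Cmod v ^ p) 3) as [Hle|Hgt].
  + assert (m ^ p <= 3) by (unfold m, Rmax; destruct (Rle_dec (Cmod v) 1); [rewrite pow1; lra|easy]).
    nra.
  + assert (Hm : m = Cmod v).
    { unfold m; apply Rmax_left; destruct (Rle_dec 1 (Cmod v)) as [|Hn]; [easy|exfalso; apply Hgt].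
      apply Rle_trans with (1 ^ p); [apply pow_incr; lra|rewrite pow1; lra]. }
    rewrite Hm; pose proof (Cmod_rev_triangle (v ^ p) W) as Ht; rewrite Cmod_pow in Ht.
    apply Rle_trans with (1 / 3 * Cmod v ^ p); [apply Rmult_le_compat_r; lra|lra].
- pose proof (Cmod_triangle (v ^ p) (- W)) as Ht; rewrite Cmod_opp, Cmod_pow in Ht.
  unfold Cminus; lra.
Qed.

Lemma ln_pow (x : R) (n : nat) : 0 < x -> ln (x ^ n) = INR n * ln x.
Proof.
intros Hx; induction n as [|n IH]; [simpl; rewrite ln_1; ring|].
rewrite S_INR; simpl; rewrite ln_mult, IH by (try apply pow_lt; easy); ring.
Qed.

Lemma cts_Rmax (u : R -> R) (c : R) : cts u -> cts (fun t => Rmax (u t) c).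
Proof.
apply (cts_comp (fun x => Rmax x c)); intros x0; apply continuous_of_eps; intros eps He.
exists eps; split; [easy|]; intros y Hy; eapply Rle_lt_trans; [|exact Hy].
unfold Rmax; destruct (Rle_dec y c), (Rle_dec (u x0) c); unfold Rabs; repeat destruct Rcase_abs; lra.
Qed.

Lemma cts_ln_Rmax (f : C -> C) (r : R) : holo 1 f -> 0 < r < 1 ->
  cts (fun t => ln (Rmax (Cmod (f (circ r t))) 1)).
Proof.
intros Hf Hr; apply cts_ln; [intros t; eapply Rlt_le_trans; [apply Rlt_0_1|apply Rmax_r]|].
apply cts_Rmax, (ccts_Cmod (fun w => f (circ r w))), holo_ccts_circ with 1; [easy|lra].
Qed.

Lemma mean_ln_Rmax_approx (f : C -> C) (r1 r2 : R) : holo 1 f -> inj_disk f ->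
  0 < r1 < r2 -> r2 < 1 -> exists A : R, 0 <= A /\ forall k : nat,
  INR (2 ^ k) * (mean (fun t => ln (Rmax (Cmod (f (circ r2 t))) 1)) - mean (fun t => ln (Rmax (Cmod (f (circ r1 t))) 1)))
    <= INR (2 ^ k) * (ln r2 - ln r1) + A + INR k.
Proof.
intros Hf Hinj Hr Hr2.
destruct (circ_lipschitz f r1 Hf) as [K1 [HK1 HL1]]; [lra|].
destruct (circ_lipschitz f r2 Hf) as [K2 [HK2 HL2]]; [lra|].
set (K := (K1 + K2)%nat).
assert (HKR : 1 <= INR K) by (apply (le_INR 1); lia).
(* The logarithms of the two factors in [pow_minus_bounds]. The remaining part [ln p] of
   [- ln (delta / 3)] is at most [k], since [p = 2 ^ k]. *)
exists (ln 3 + ln (3 * (9232 * INR K))).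
assert (Hl3 : 0 < ln 3) by (rewrite <- ln_1; apply ln_increasing; lra).
assert (HlK : 0 < ln (3 * (9232 * INR K))) by (rewrite <- ln_1; apply ln_increasing; lra).
split; [lra|]; intros k; set (p := (2 ^ k)%nat).
assert (Hp : (0 < p)%nat) by (unfold p; pose proof (Nat.pow_nonzero 2 k); lia).
assert (HpR : 1 <= INR p) by (apply (le_INR 1); lia).
destruct (avoid_power_curves (fun t => f (circ r1 t)) (fun t => f (circ r2 t)) K p) as [W [HW Havoid]].
- lia.
- easy.
- assert (INR K1 <= INR K) by (apply le_INR; lia); assert (INR K2 <= INR K) by (apply le_INR; lia).
  intros [|] t s Ht Hs; [eapply Rle_trans; [now apply HL1|]|eapply Rle_trans; [now apply HL2|]];
    apply Rmult_le_compat_r; try easy; apply Rabs_pos.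
- set (delta := / (9232 * INR p * INR K)) in *.
  assert (Hdelta : 0 < delta <= 1).
  { unfold delta; split; [apply Rinv_0_lt_compat; nra|rewrite <- Rinv_1; apply Rinv_le_contravar; nra]. }
  assert (HB : forall r : R, r = r1 \/ r = r2 -> forall t : R,
    delta / 3 * Rmax (Cmod (f (circ r t))) 1 ^ p <= Cmod (f (circ r t) ^ p - W) <= 3 * Rmax (Cmod (f (circ r t))) 1 ^ p).
  { intros r Hr' t; assert (Hrp : 0 < r) by (destruct Hr'; lra).
    destruct (circ_reduce r t Hrp) as [s [Hs <-]]; apply pow_minus_bounds; [easy|easy|].
    destruct Hr' as [-> | ->]; [exact (Havoid true s Hs)|exact (Havoid false s Hs)]. }
  destruct (pow2_factorization k W) as [l [Hlen El]]; fold p in El, Hlen.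
  assert (Hm0 : forall r t : R, 0 < Rmax (Cmod (f (circ r t))) 1 ^ p).
  { intros r t; apply pow_lt; eapply Rlt_le_trans; [apply Rlt_0_1|apply Rmax_r]. }
  assert (Hne : forall r : R, r = r1 \/ r = r2 -> forall t : R, lprod (f (circ r t)) l <> 0).
  { intros r Hr' t; rewrite <- El; apply Cmod_gt_0; specialize (HB r Hr' t); specialize (Hm0 r t).
    nra. }
  pose proof (inj_jensen_lprod f r1 r2 l Hf Hinj Hr Hr2 (Hne r1 (or_introl eq_refl)) (Hne r2 (or_intror eq_refl))) as HJ.
  rewrite Hlen in HJ.
  assert (HlB : forall r : R, r = r1 \/ r = r2 -> forall t : R,
    ln (delta / 3) + INR p * ln (Rmax (Cmod (f (circ r t))) 1) <= ln (Cmod (lprod (f (circ r t)) l))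
      <= ln 3 + INR p * ln (Rmax (Cmod (f (circ r t))) 1)).
  { intros r Hr' t; specialize (HB r Hr' t); specialize (Hne r Hr' t).
    rewrite <- ln_pow by (eapply Rlt_le_trans; [apply Rlt_0_1|apply Rmax_r]).
    rewrite <- !ln_mult by (try easy; lra).
    rewrite <- El in *; apply Cmod_gt_0 in Hne.
    split; apply ln_le; try easy; apply Rmult_lt_0_compat; lra. }
  assert (Hcts : forall r : R, r = r1 \/ r = r2 -> cts (fun t => ln (Cmod (lprod (f (circ r t)) l)))).
  { intros r Hr'; apply (holo_cts_ln 1 r (fun z => lprod (f z) l)); [|destruct Hr'; lra|now apply Hne].
    apply holo_ext with (fun z => f z ^ p - W)%C; [intros; apply El|].
    apply holo_minus; [|apply holo_const]; clear -Hf.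
    induction p as [|p IH]; [apply (holo_const 1 1)|now apply (holo_mult 1 f (fun z => f z ^ p)%C)]. }
  assert (Hmx : forall r : R, r = r1 \/ r = r2 -> cts (fun t => ln (Rmax (Cmod (f (circ r t))) 1))).
  { intros r Hr'; apply cts_ln_Rmax; [easy|destruct Hr'; lra]. }
  assert (Hlin : forall c r : R, r = r1 \/ r = r2 ->
    cts (fun t => c + INR p * ln (Rmax (Cmod (f (circ r t))) 1)) /\
    mean (fun t => c + INR p * ln (Rmax (Cmod (f (circ r t))) 1)) = c + INR p * mean (fun t => ln (Rmax (Cmod (f (circ r t))) 1))).
  { intros c r Hr'; split.
    - apply cts_plus; [apply cts_const|now apply cts_scal, Hmx].
    - rewrite mean_plus, mean_const, mean_scal; [easy|now apply Hmx|apply cts_const|now apply cts_scal, Hmx]. }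
  assert (L2 : ln (delta / 3) + INR p * mean (fun t => ln (Rmax (Cmod (f (circ r2 t))) 1)) <=
    mean (fun t => ln (Cmod (lprod (f (circ r2 t)) l)))).
  { destruct (Hlin (ln (delta / 3)) r2 (or_intror eq_refl)) as [Hc <-].
    apply mean_le; [easy|now apply Hcts; right|]; intros t _; now apply HlB; right. }
  assert (L1 : mean (fun t => ln (Cmod (lprod (f (circ r1 t)) l))) <=
    ln 3 + INR p * mean (fun t => ln (Rmax (Cmod (f (circ r1 t))) 1))).
  { destruct (Hlin (ln 3) r1 (or_introl eq_refl)) as [Hc <-].
    apply mean_le; [now apply Hcts; left|easy|]; intros t _; now apply HlB; left. }
  assert (Hld : - ln (delta / 3) = ln (3 * (9232 * INR K)) + ln (INR p)).
  { rewrite <- ln_mult, <- ln_Rinv by (try apply Rdiv_lt_0_compat; lra); f_equal.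
    unfold delta; field; lra. }
  assert (Hlp : ln (INR p) <= INR k).
  { unfold p; rewrite pow_INR, ln_pow by (simpl; lra).
    rewrite <- (Rmult_1_r (INR k)) at 2; apply Rmult_le_compat_l; [apply pos_INR|].
    left; simpl; replace (1 + 1) with 2 by ring; rewrite <- (ln_exp 1).
    apply ln_increasing; [lra|apply exp_ineq1; lra]. }
  lra.
Qed.

Lemma mean_ln_Rmax_le (f : C -> C) (r1 r2 : R) : holo 1 f -> inj_disk f -> 0 < r1 < r2 -> r2 < 1 ->
  mean (fun t => ln (Rmax (Cmod (f (circ r2 t))) 1)) - mean (fun t => ln (Rmax (Cmod (f (circ r1 t))) 1))
    <= ln r2 - ln r1.
Proof.
intros Hf Hinj Hr Hr2; destruct (mean_ln_Rmax_approx f r1 r2 Hf Hinj Hr Hr2) as [A [HA H]].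
set (D := mean _ - mean _) in *; set (L := ln r2 - ln r1) in *.
apply le_epsilon; intros eps He.
destruct (INR_unbounded ((A + 2) / eps)) as [k Hk].
assert (HkE : A + 2 < INR k * eps).
{ apply (Rmult_lt_compat_r eps) in Hk; [|easy]; unfold Rdiv in Hk; rewrite Rmult_assoc, Rinv_l in Hk; lra. }
(* With exponent [2 k] the factor in front of the means is at least [(1 + k)^2], which beats the
   error [A + 2 k] by the choice of [k]. *)
specialize (H (k + k)%nat); rewrite Nat.pow_add_r, mult_INR, plus_INR in H.
assert (H2 : 1 + INR k <= INR (2 ^ k)).
{ rewrite pow_INR.
  clear; induction k as [|k IH]; [simpl; lra|]; rewrite S_INR; simpl in *.
  pose proof (pos_INR k); lra. }
set (q := INR (2 ^ k)) in *; pose proof (pos_INR k).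
destruct (Rle_dec D (L + eps)) as [|Hn]; [easy|exfalso].
set (Q := q * q) in *; set (x := INR k) in *.
assert (HQ : (1 + x) * (1 + x) <= Q) by (apply Rmult_le_compat; lra).
assert (HQ0 : 0 < Q) by nra.
nra.
Qed.

(** * Means of negative powers *)

Lemma cts_Rmin (u : R -> R) (c : R) : cts u -> cts (fun t => Rmin (u t) c).
Proof.
apply (cts_comp (fun x => Rmin x c)); intros x0; apply continuous_of_eps; intros eps He.
exists eps; split; [easy|]; intros y Hy; eapply Rle_lt_trans; [|exact Hy].
unfold Rmin; destruct (Rle_dec y c), (Rle_dec (u x0) c); unfold Rabs; repeat destruct Rcase_abs; lra.
Qed.

Lemma cts_exp (u : R -> R) : cts u -> cts (fun t => exp (u t)).
Proof.
apply cts_comp; intros t; apply (continuous_of_derivable exp _ (exp (u t))), is_derive_exp.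
Qed.

(** Discrete form of [d exp (- s min (L, tau)) = - s exp (- s tau) d min (L, tau)]. The quadratic
    error is that of [exp (- u) - 1 + u <= u^2] for [u >= 0]. *)
Lemma exp_min_step (s h tau L : R) : 0 < s -> 0 < h ->
  0 <= exp (- s * Rmin L (tau + h)) - exp (- s * Rmin L tau)
    + s * exp (- s * tau) * (Rmin L (tau + h) - Rmin L tau) <= s ^ 2 * exp (- s * tau) * h ^ 2.
Proof.
intros Hs Hh; pose proof (exp_pos (- s * tau)) as He.
assert (Hr0 : 0 <= s ^ 2 * exp (- s * tau) * h ^ 2).
{ apply Rmult_le_pos; [apply Rmult_le_pos; [apply pow2_ge_0|lra]|apply pow2_ge_0]. }
destruct (Rle_dec L tau) as [HL|HL].
- rewrite !Rmin_left by lra; split; lra.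
- rewrite (Rmin_right L tau) by lra; set (y := Rmin L (tau + h)).
  assert (Hy : tau <= y <= tau + h) by (unfold y; split; [apply Rmin_glb; lra|apply Rmin_r]).
  set (u := s * (y - tau)); assert (Hu : 0 <= u) by (unfold u; nra).
  assert (Huh : u <= s * h) by (unfold u; nra).
  replace (exp (- s * y)) with (exp (- s * tau) * exp (- u)) by (rewrite <- exp_plus; f_equal; unfold u; ring).
  replace (exp (- s * tau) * exp (- u) - exp (- s * tau) + s * exp (- s * tau) * (y - tau))
    with (exp (- s * tau) * (exp (- u) - 1 + u)) by (unfold u; ring).
  pose proof (exp_ineq1_le (- u)); pose proof (exp_ineq1_le u).
  assert (E1 : exp u * exp (- u) = 1) by (rewrite <- exp_plus, Rplus_opp_r; apply exp_0).
  assert (Hub : exp (- u) - 1 + u <= u ^ 2).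
  { assert ((1 + u) * exp (- u) <= 1) by nra.
    assert (1 <= (1 + u) * (1 - u + u ^ 2)) by nra.
    nra. }
  split; [apply Rmult_le_pos; lra|].
  apply Rle_trans with (exp (- s * tau) * (s * h) ^ 2).
  + apply Rmult_le_compat_l; [lra|]; apply Rle_trans with (u ^ 2); [easy|apply pow_incr; lra].
  + right; ring.
Qed.

(** As [tau] rises from a lower to an upper bound of [L], this passes from an explicit constant to
    the mean of [exp (- s * L)]. Following it in small steps plays the role of an integral over the
    truncation levels. *)
Definition emin (s : R) (L : R -> R) (tau : R) : R := mean (fun t => exp (- s * Rmin (L t) tau)).

Definition mmin (L : R -> R) (tau : R) : R := mean (fun t => Rmin (L t) tau).

Lemma emin_step (s h tau : R) (L : R -> R) : 0 < s -> 0 < h -> cts L ->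
  0 <= emin s L (tau + h) - emin s L tau + s * exp (- s * tau) * (mmin L (tau + h) - mmin L tau)
    <= s ^ 2 * exp (- s * tau) * h ^ 2.
Proof.
intros Hs Hh HL; set (sg := s * exp (- s * tau)).
assert (Hm : forall x : R, cts (fun t => Rmin (L t) x)) by (intros; now apply cts_Rmin).
assert (He : forall x : R, cts (fun t => exp (- s * Rmin (L t) x))) by (intros; now apply cts_exp, cts_scal).
assert (Hc1 : cts (fun t => exp (- s * Rmin (L t) (tau + h)) + (-1) * exp (- s * Rmin (L t) tau))).
{ apply cts_plus; [apply He|now apply (cts_scal (-1))]. }
assert (Hc2 : cts (fun t => sg * (Rmin (L t) (tau + h) + (-1) * Rmin (L t) tau))).
{ apply cts_scal, cts_plus; [apply Hm|now apply (cts_scal (-1))]. }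
assert (E : emin s L (tau + h) - emin s L tau + sg * (mmin L (tau + h) - mmin L tau) =
  mean (fun t => exp (- s * Rmin (L t) (tau + h)) + (-1) * exp (- s * Rmin (L t) tau)
    + sg * (Rmin (L t) (tau + h) + (-1) * Rmin (L t) tau))).
{ rewrite (mean_plus _ _ Hc1 Hc2), mean_plus by (try apply He; now apply (cts_scal (-1))).
  rewrite (mean_scal sg) by (apply cts_plus; [apply Hm|now apply (cts_scal (-1))]).
  rewrite mean_plus by (try apply Hm; now apply (cts_scal (-1))).
  rewrite !mean_scal by easy; unfold emin, mmin; ring. }
rewrite E; clear E; split.
- rewrite <- (mean_const 0); apply mean_le; [apply cts_const|now apply cts_plus|]; intros t _.
  pose proof (exp_min_step s h tau (L t) Hs Hh) as H; fold sg in H; lra.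
- rewrite <- (mean_const (s ^ 2 * exp (- s * tau) * h ^ 2)).
  apply mean_le; [now apply cts_plus|apply cts_const|]; intros t _.
  pose proof (exp_min_step s h tau (L t) Hs Hh) as H; fold sg in H; lra.
Qed.

Lemma mean_ext_on (u v : R -> R) : cts u -> cts v ->
  (forall t : R, 0 <= t <= 2 * PI -> u t = v t) -> mean u = mean v.
Proof. intros Hu Hv H; apply Rle_antisym; apply mean_le; try easy; intros t Ht; rewrite H by easy; lra. Qed.

(** The function [exp (- s L)] is decreasing and convex in [L], hence a combination of the
    truncations [- min (L, tau)] with nonnegative weights, up to a constant; comparing all truncated
    means therefore compares its means. *)
Lemma mean_exp_le (s A B : R) (L1 L2 : R -> R) : 0 < s -> A < B -> cts L1 -> cts L2 ->
  (forall t : R, 0 <= t <= 2 * PI -> A <= L1 t <= B) -> (forall t : R, 0 <= t <= 2 * PI -> A <= L2 t <= B) ->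
  (forall tau : R, mmin L1 tau <= mmin L2 tau) ->
  mean (fun t => exp (- s * L2 t)) <= mean (fun t => exp (- s * L1 t)).
Proof.
intros Hs HAB Hc1 Hc2 HB1 HB2 HE.
set (C0 := s ^ 2 * exp (- s * A)).
assert (HC0 : 0 < C0) by (apply Rmult_lt_0_compat; [nra|apply exp_pos]).
(* The last summand is the boundary term of a summation by parts. With it, the increment of [K] is
   the decrease of [s exp (- s tau)] times a nonnegative difference of truncated means, up to a
   quadratic error; so [K] is almost nonincreasing. *)
set (K := fun tau => emin s L2 tau - emin s L1 tau + s * exp (- s * tau) * (mmin L2 tau - mmin L1 tau)).
assert (Hstep : forall tau h : R, A <= tau -> 0 < h -> K (tau + h) <= K tau + C0 * h ^ 2).
{ intros tau h Htau Hh; unfold K.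
  pose proof (emin_step s h tau L1 Hs Hh Hc1) as H1; pose proof (emin_step s h tau L2 Hs Hh Hc2) as H2.
  assert (Hx : exp (- s * tau) <= exp (- s * A)).
  { destruct (Req_dec tau A) as [->|]; [lra|left; apply exp_increasing; nra]. }
  assert (Hx' : exp (- s * (tau + h)) <= exp (- s * tau)) by (left; apply exp_increasing; nra).
  assert (H3 : s ^ 2 * exp (- s * tau) * h ^ 2 <= C0 * h ^ 2).
  { apply Rmult_le_compat_r; [apply pow2_ge_0|]; apply Rmult_le_compat_l; [apply pow2_ge_0|easy]. }
  specialize (HE (tau + h)).
  assert (H4 : s * exp (- s * (tau + h)) * (mmin L2 (tau + h) - mmin L1 (tau + h)) <=
    s * exp (- s * tau) * (mmin L2 (tau + h) - mmin L1 (tau + h))).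
  { apply Rmult_le_compat_r; [lra|]; apply Rmult_le_compat_l; lra. }
  lra. }
assert (HKA : K A = 0).
{ assert (E : forall L : R -> R, cts L -> (forall t : R, 0 <= t <= 2 * PI -> A <= L t <= B) ->
    emin s L A = exp (- s * A) /\ mmin L A = A).
  { intros L HL HLB; split.
    - unfold emin; rewrite <- (mean_const (exp (- s * A))); apply mean_ext_on.
      + now apply cts_exp, cts_scal, cts_Rmin.
      + apply cts_const.
      + intros t Ht; rewrite Rmin_right; [easy|now apply HLB].
    - unfold mmin; transitivity (mean (fun _ => A)); [apply mean_ext_on|apply mean_const].
      + now apply cts_Rmin.
      + apply cts_const.
      + intros t Ht; rewrite Rmin_right; [easy|now apply HLB]. }
  destruct (E L1 Hc1 HB1) as [E1 E2]; destruct (E L2 Hc2 HB2) as [E3 E4].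
  unfold K; rewrite E1, E2, E3, E4; ring. }
assert (HKB : mean (fun t => exp (- s * L2 t)) - mean (fun t => exp (- s * L1 t)) <= K B).
{ assert (E : forall L : R -> R, cts L -> (forall t : R, 0 <= t <= 2 * PI -> A <= L t <= B) ->
    emin s L B = mean (fun t => exp (- s * L t))).
  { intros L HL HLB; unfold emin; apply mean_ext_on.
    - now apply cts_exp, cts_scal, cts_Rmin.
    - now apply cts_exp, cts_scal.
    - intros t Ht; rewrite Rmin_left; [easy|now apply HLB]. }
  unfold K; rewrite (E L1 Hc1 HB1), (E L2 Hc2 HB2); specialize (HE B).
  pose proof (exp_pos (- s * B)).
  assert (0 <= s * exp (- s * B) * (mmin L2 B - mmin L1 B)) by (apply Rmult_le_pos; [nra|lra]); lra. }
assert (Hm : forall (h : R) (j : nat), 0 < h -> K (A + INR j * h) <= INR j * (C0 * h ^ 2)).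
{ intros h j Hh; induction j as [|j IH].
  - simpl; rewrite !Rmult_0_l, Rplus_0_r, HKA; lra.
  - rewrite S_INR; replace (A + (INR j + 1) * h) with (A + INR j * h + h) by ring.
    pose proof (pos_INR j).
    pose proof (Hstep (A + INR j * h) h ltac:(nra) Hh); lra. }
apply le_epsilon; intros eps He.
destruct (INR_unbounded (C0 * (B - A) ^ 2 / eps)) as [m Hm'].
assert (Hnum : 0 < C0 * (B - A) ^ 2) by (apply Rmult_lt_0_compat; nra).
assert (Hq : 0 < C0 * (B - A) ^ 2 / eps) by (apply Rdiv_lt_0_compat; lra).
assert (HmR : 0 < INR m) by lra.
(* The quadratic errors of [m] steps of length [(B - A) / m] add up to [C0 (B - A)^2 / m], which is
   at most [eps]. *)
specialize (Hm ((B - A) / INR m) m ltac:(apply Rdiv_lt_0_compat; lra)).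
replace (A + INR m * ((B - A) / INR m)) with B in Hm by (field; lra).
replace (INR m * (C0 * ((B - A) / INR m) ^ 2)) with (C0 * (B - A) ^ 2 / INR m) in Hm by (field; lra).
assert (C0 * (B - A) ^ 2 / INR m <= eps).
{ apply Rmult_le_reg_r with (INR m); [easy|]; unfold Rdiv at 1; rewrite Rmult_assoc, Rinv_l by lra.
  apply (Rmult_lt_compat_r eps) in Hm'; [|easy].
  unfold Rdiv in Hm'; rewrite Rmult_assoc, Rinv_l in Hm' by lra; lra. }
lra.
Qed.

Lemma cts_bounds (u : R -> R) : cts u ->
  exists A B : R, forall t : R, 0 <= t <= 2 * PI -> A <= u t <= B.
Proof.
intros Hu; destruct (cts_bounded_above u Hu) as [B HB].
destruct (cts_bounded_above (fun t => (-1) * u t) (cts_scal (-1) u Hu)) as [A HA].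
exists (- A), B; intros t Ht; specialize (HA t Ht); specialize (HB t Ht); lra.
Qed.

Lemma inj_scal (f : C -> C) (c : C) : c <> 0 -> inj_disk f -> inj_disk (fun z => c * f z)%C.
Proof.
intros Hc Hf z w Hz Hw E; apply Hf; try easy.
replace (f z) with (c * f z / c)%C by (field; easy); rewrite E; field; easy.
Qed.

(** As [min (x, tau) = x - ln (max (exp (x - tau), 1))], the mean of the truncated [ln |f|] is the
    mean of [ln |f|], growing exactly like [ln r], minus one that grows at most like [ln r]. It thus
    increases with [r] for each [tau], as [mean_exp_le] asks. *)
Lemma mean_neg_power_le (f : C -> C) (s r1 r2 : R) : holo 1 f -> inj_disk f -> f 0 = 0 ->
  0 < s -> 0 < r1 < r2 -> r2 < 1 ->
  mean (fun t => exp (- s * ln (Cmod (f (circ r2 t))))) <= mean (fun t => exp (- s * ln (Cmod (f (circ r1 t))))).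
Proof.
intros Hf Hinj Hf0 Hs Hr Hr2.
destruct (inj_factor f 0 Hf Hinj) as [q [Hq [Hqn Eq]]]; [rewrite Cmod_0; lra|].
assert (Hfq : forall w : C, Cmod w < 1 -> f w = (w * q w)%C) by (intros w Hw; rewrite Eq, Hf0 by easy; ring).
assert (Hcirc : forall r t : R, 0 < r < 1 -> Cmod (circ r t) < 1) by (intros; rewrite Cmod_circ; lra).
assert (Hfn : forall r t : R, 0 < r < 1 -> f (circ r t) <> 0).
{ intros r t Hr'; rewrite Hfq by now apply Hcirc.
  apply Cmult_neq_0; [apply circ_neq_0; lra|now apply Hqn, Hcirc]. }
assert (HL : forall r : R, 0 < r < 1 -> cts (fun t => ln (Cmod (f (circ r t))))).
{ intros r Hr'; apply (holo_cts_ln 1); [easy|lra|]; intros; now apply Hfn. }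
assert (HM : forall r : R, 0 < r < 1 -> mean (fun t => ln (Cmod (f (circ r t)))) = ln r + ln (Cmod (q 0))).
{ intros r Hr'; rewrite <- (mean_ln_nonvanishing 1 r q Hq) by (try easy; lra).
  rewrite <- (mean_const (ln r)), <- mean_plus.
  - apply mean_ext; intros t; rewrite Hfq by now apply Hcirc.
    rewrite ln_mult_Cmod, Cmod_circ; [easy|lra|apply circ_neq_0; lra|now apply Hqn, Hcirc].
  - apply cts_const.
  - apply (holo_cts_ln 1); [easy|lra|]; intros; now apply Hqn, Hcirc. }
destruct (cts_bounds _ (HL r1 ltac:(lra))) as [A1 [B1 H1]]; destruct (cts_bounds _ (HL r2 ltac:(lra))) as [A2 [B2 H2]].
(* The added 1 makes the interval nondegenerate even if [ln |f|] is constant on the circles. *)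
apply (mean_exp_le s (Rmin A1 A2) (Rmax B1 B2 + 1)); [easy| |apply HL; lra|apply HL; lra| | |].
- pose proof two_PI_pos as H2p; specialize (H1 0 ltac:(lra)); pose proof (Rmin_l A1 A2); pose proof (Rmax_l B1 B2); lra.
- intros t Ht; specialize (H1 t Ht); pose proof (Rmin_l A1 A2); pose proof (Rmax_l B1 B2); lra.
- intros t Ht; specialize (H2 t Ht); pose proof (Rmin_r A1 A2); pose proof (Rmax_r B1 B2); lra.
- intros tau.
  (* Rescaling moves the truncation level [exp tau] of [|f|] to the level 1 of [mean_ln_Rmax_le]. *)
  set (g := fun z => (RtoC (exp (- tau)) * f z)%C).
  assert (Hg : holo 1 g) by (apply holo_mult; [apply holo_const|easy]).
  pose proof (exp_pos (- tau)) as Hep.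
  assert (Hginj : inj_disk g).
  { apply inj_scal; [|easy]; intros E; apply RtoC_inj in E; lra. }
  assert (Hmin : forall r : R, 0 < r < 1 -> mmin (fun t => ln (Cmod (f (circ r t)))) tau =
    ln r + ln (Cmod (q 0)) - mean (fun t => ln (Rmax (Cmod (g (circ r t))) 1))).
  { intros r Hr'; rewrite <- HM, <- mean_minus; [|now apply HL|now apply cts_ln_Rmax|easy].
    apply mean_ext; intros t; assert (Hp : 0 < Cmod (f (circ r t))) by now apply Cmod_gt_0, Hfn.
    unfold g; rewrite Cmod_mult, Cmod_R, Rabs_pos_eq by lra.
    set (x := Cmod (f (circ r t))) in *.
    assert (Ex : exp (- tau) * x = exp (ln x - tau)).
    { unfold Rminus; rewrite exp_plus, exp_ln by easy; ring. }
    rewrite Ex; destruct (Rle_dec (ln x) tau) as [Hle|Hgt].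
    - rewrite Rmin_left, Rmax_right, ln_1; [ring| |easy].
      rewrite <- exp_0; destruct (Req_dec (ln x) tau) as [->|]; [right; f_equal; ring|left; apply exp_increasing; lra].
    - rewrite Rmin_right, Rmax_left, ln_exp; [ring| |lra].
      rewrite <- exp_0; left; apply exp_increasing; lra. }
  rewrite !Hmin by lra; pose proof (mean_ln_Rmax_le g r1 r2 Hg Hginj Hr Hr2); lra.
Qed.

(** * Parseval's identity for polynomials on circles *)

Fixpoint rsum (u : nat -> R) (n : nat) : R :=
  match n with O => 0 | S m => rsum u m + u m end.

Lemma ccont_conj (z : C) : ccont Cconj z.
Proof.
intros eps He; exists eps; split; [easy|]; intros w Hw; rewrite <- Cminus_conj, Cmod_conj; easy.
Qed.

Lemma ccont_csum (c : nat -> C) (n : nat) (z : C) : ccont (fun w => psum c w n) z.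
Proof.
induction n as [|n IH]; [apply (ccont_const 0)|]; simpl; apply ccont_plus; [easy|].
apply ccont_mult; [apply ccont_const|apply ccont_pow, ccont_id].
Qed.

Lemma Cconj_circ (r t : R) : (Cconj (circ r t) * circ r t)%C = RtoC (r ^ 2).
Proof.
rewrite circ_polar; pose proof (sin2_cos2 t) as H; unfold Rsqr in H.
apply injective_projections; simpl; nra.
Qed.

(** On the circle [conj z * z] is the constant [r ^ 2], so the conjugate of [z^k] times [z^n] is a
    constant times the positive power [z^(n-k)], whose mean is 0. *)
Lemma Cmean_orthogonal (c : nat -> C) (r : R) (n m : nat) : (m <= n)%nat ->
  Cmean (fun t => Cconj (psum c (circ r t) m) * circ r t ^ n)%C = 0.
Proof.
induction m as [|m IH]; intros Hm.
- rewrite (Cmean_ext _ (fun _ => RtoC 0)), Cmean_const; [easy|].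
  intros t; simpl; apply injective_projections; simpl; ring.
- assert (Hconj : forall k : nat, ccts (fun w => Cconj (psum c (circ r w) k))%C).
  { intros k t; apply (ccont_comp Cconj); [|apply ccont_conj].
    apply (ccont_comp (fun w => psum c w k) (circ r)); [apply ccont_circ|apply ccont_csum]. }
  assert (Hpow : forall k : nat, ccts (fun w => circ r w ^ k)%C) by (intros k t; apply ccont_pow, ccont_circ).
  set (a := (Cconj (c m) * RtoC (r ^ 2) ^ m)%C).
  rewrite (Cmean_ext _ (fun t => Cconj (psum c (circ r t) m) * circ r t ^ n + a * circ r t ^ (n - m))%C).
  + rewrite (Cmean_plus (fun w => Cconj (psum c (circ r w) m) * circ r w ^ n)%C (fun w => a * circ r w ^ (n - m))%C).
    * rewrite IH by lia; rewrite (Cmean_scal a (fun w => circ r w ^ (n - m))%C) by apply Hpow.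
      rewrite Cmean_circ_pow by lia; ring.
    * now apply ccts_mult.
    * apply ccts_mult; [intros t; apply ccont_const|apply Hpow].
  + intros t; simpl csum; rewrite Cplus_conj, Cmult_conj, Cpow_conj; unfold a.
    rewrite <- (Cconj_circ r t), Cpow_mult_l.
    assert (En : (circ r t ^ n = circ r t ^ m * circ r t ^ (n - m))%C) by (rewrite <- Cpow_add_r; f_equal; lia).
    rewrite En; ring.
Qed.

Lemma Cmod2_plus (a b : C) : Cmod (a + b) ^ 2 = Cmod a ^ 2 + Cmod b ^ 2 + 2 * Re (Cconj a * b).
Proof. rewrite !Cmod2_alt; unfold Re, Im; simpl; ring. Qed.

Lemma mean_Cmod2_csum (c : nat -> C) (r : R) (n : nat) : 0 <= r ->
  mean (fun t => Cmod (psum c (circ r t) n) ^ 2) = rsum (fun k => Cmod (c k) ^ 2 * r ^ (2 * k)) n.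
Proof.
intros Hr; induction n as [|n IH].
- rewrite (mean_ext _ (fun _ => 0)), mean_const; [easy|]; intros t; simpl; rewrite Cmod_0; ring.
- change (rsum (fun k => Cmod (c k) ^ 2 * r ^ (2 * k)) (S n))
    with (rsum (fun k => Cmod (c k) ^ 2 * r ^ (2 * k)) n + Cmod (c n) ^ 2 * r ^ (2 * n)); rewrite <- IH.
  assert (Hc : ccts (fun w => psum c (circ r w) n)).
  { intros t; apply (ccont_comp (fun w => psum c w n) (circ r)); [apply ccont_circ|apply ccont_csum]. }
  assert (HR : ccts (fun w => Cconj (psum c (circ r w) n) * circ r w ^ n)%C).
  { apply ccts_mult; [|intros t; apply ccont_pow, ccont_circ].
    intros t; apply (ccont_comp Cconj); [apply Hc|apply ccont_conj]. }
  assert (HcR : ccts (fun w => c n * (Cconj (psum c (circ r w) n) * circ r w ^ n))%C).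
  { apply ccts_mult; [intros t; apply ccont_const|easy]. }
  assert (Hsq : cts (fun t => Cmod (psum c (circ r t) n) ^ 2)).
  { apply (cts_comp (fun x => x ^ 2)); [intros t|now apply (ccts_Cmod (fun w => psum c (circ r w) n))].
    set (y := Cmod _); apply (continuous_of_derivable (fun x => x ^ 2) y (INR 2 * 1 * y ^ 1)); auto_derive; [easy|simpl; ring]. }
  set (X := fun w => (c n * (Cconj (psum c (circ r w) n) * circ r w ^ n))%C) in *.
  pose proof (ccts_Re X HcR) as HRe.
  rewrite (mean_ext _ (fun t => Cmod (psum c (circ r t) n) ^ 2 + (Cmod (c n) ^ 2 * r ^ (2 * n)
    + 2 * Re (X (RtoC t))))).
  + rewrite mean_plus, mean_plus, mean_const, mean_scal;
      [|easy|apply cts_const|now apply cts_scal|easy|now apply cts_plus; [apply cts_const|apply cts_scal]].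
    change (mean (fun t => Re (X (RtoC t)))) with (Re (Cmean (fun t => X (RtoC t)))); unfold X.
    rewrite (Cmean_scal (c n) (fun w => Cconj (psum c (circ r w) n) * circ r w ^ n)%C HR).
    rewrite Cmean_orthogonal by lia; rewrite Cmult_0_r; change (Re 0) with 0; ring.
  + intros t; simpl csum; rewrite Cmod2_plus, Cmod_mult, Cmod_pow, Cmod_circ by easy.
    rewrite Rpow_mult_distr, <- pow_mult, (Nat.mul_comm n 2), Rplus_assoc; do 4 f_equal; unfold X; ring.
Qed.

(** * Prawitz' inequality *)

Lemma ccts_cts_Cmod2 (H : C -> C) : ccts H -> cts (fun t => Cmod (H (RtoC t)) ^ 2).
Proof.
intros Hc; apply (cts_comp (fun x => x ^ 2)); [intros t|now apply ccts_Cmod].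
set (y := Cmod _); apply (continuous_of_derivable (fun x => x ^ 2) y (INR 2 * 1 * y ^ 1)).
auto_derive; [easy|simpl; ring].
Qed.

(** On a circle inside the disk the partial sums converge uniformly, hence so do their squared
    moduli, and the identity for polynomials passes to the limit. *)
Lemma mean_Cmod2_pser (c : nat -> C) (g : C -> C) (r eps : R) : pser 1 c g -> 0 < r < 1 -> 0 < eps ->
  exists N0 : nat, forall N : nat, (N0 <= N)%nat ->
    Rabs (mean (fun t => Cmod (g (circ r t)) ^ 2) - rsum (fun k => Cmod (c k) ^ 2 * r ^ (2 * k)) N) <= eps.
Proof.
intros Hg Hr He.
assert (Hgc : ccts (fun w => g (circ r w))) by (apply holo_ccts_circ with 1; [now apply pser_holo with c|lra]).
set (rho := (1 + r) / 2); set (q := r / rho).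
assert (Hq : 0 <= q < 1).
{ unfold q; rewrite <- (Rabs_pos_eq r), <- Cmod_R by lra; apply ratio_bounds.
  rewrite Cmod_R, Rabs_pos_eq; unfold rho; lra. }
destruct (pser_coef_bound 1 rho c g Hg) as [M [HM HB]]; [unfold rho; lra|].
set (B := M * / (1 - q)).
assert (HB0 : 0 < B) by (apply Rmult_lt_0_compat; [easy|apply Rinv_0_lt_compat; lra]).
assert (Hrem : forall (N : nat) (t : R), Cmod (g (circ r t) - psum c (circ r t) N) <= B * q ^ N).
{ intros N t; assert (Hc : Cmod (circ r t) = r) by (apply Cmod_circ; lra).
  pose proof (pser_remainder 1 rho M c g (circ r t) N Hg ltac:(unfold rho; lra)) as H.
  rewrite Hc in H; specialize (H ltac:(unfold rho; lra) HB); fold q in H; unfold B; lra. }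
assert (Hgb : forall t : R, Cmod (g (circ r t)) <= B).
{ intros t; specialize (Hrem O t); simpl in Hrem; replace (g (circ r t) - 0)%C with (g (circ r t)) in Hrem by ring; lra. }
(* The difference of squares is at most [B q^N] times the sum of the moduli, and these are at most
   [B] for [g] and [2 B] for the partial sum. *)
destruct (pow_lim_0 q (eps / (3 * B * B)) Hq) as [N0 HN0]; [apply Rdiv_lt_0_compat; nra|].
exists N0; intros N HN; rewrite <- mean_Cmod2_csum by lra.
assert (HPc : ccts (fun w => psum c (circ r w) N)).
{ intros t; apply (ccont_comp (fun w => psum c w N) (circ r)); [apply ccont_circ|apply ccont_csum]. }
pose proof (ccts_cts_Cmod2 _ Hgc) as Hc1; pose proof (ccts_cts_Cmod2 _ HPc) as Hc2.
rewrite <- mean_minus by easy.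
assert (Hd : forall t : R, - eps <= Cmod (g (circ r t)) ^ 2 + (-1) * Cmod (psum c (circ r t) N) ^ 2 <= eps).
{ intros t; specialize (Hrem N t); specialize (Hgb t); specialize (HN0 N HN).
  set (x := g (circ r t)) in *; set (y := psum c (circ r t) N) in *.
  pose proof (Cmod_minus_le x y) as Hxy; pose proof (Cmod_ge_0 x); pose proof (Cmod_ge_0 y).
  assert (Hqn : 0 <= q ^ N <= 1).
  { split; [apply pow_le; lra|rewrite <- (pow1 N); apply pow_incr; lra]. }
  assert (Hbq : B * q ^ N * (3 * B) <= eps).
  { apply (Rmult_lt_compat_r (3 * B * B)) in HN0; [|nra].
    replace (eps / (3 * B * B) * (3 * B * B)) with eps in HN0 by (field; lra); nra. }
  assert (Hd' : Rabs (Cmod x - Cmod y) <= B * q ^ N) by lra.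
  assert (Hy : Cmod y <= 2 * B).
  { apply Rabs_le_between in Hd'; nra. }
  apply Rabs_le_between; replace (Cmod x ^ 2 + -1 * Cmod y ^ 2) with ((Cmod x - Cmod y) * (Cmod x + Cmod y)) by ring.
  rewrite Rabs_mult, (Rabs_pos_eq (Cmod x + Cmod y)) by lra.
  eapply Rle_trans; [|exact Hbq]; apply Rmult_le_compat; try lra; apply Rabs_pos. }
assert (Hcd : cts (fun t => Cmod (g (circ r t)) ^ 2 + (-1) * Cmod (psum c (circ r t) N) ^ 2)).
{ apply cts_plus; [easy|now apply (cts_scal (-1))]. }
rewrite (mean_ext _ (fun t => Cmod (g (circ r t)) ^ 2 + (-1) * Cmod (psum c (circ r t) N) ^ 2)) by (intros; ring).
apply Rabs_le; split.
- rewrite <- (mean_const (- eps)); apply mean_le; [apply cts_const|easy|intros; apply Hd].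
- rewrite <- (mean_const eps); apply mean_le; [easy|apply cts_const|intros; apply Hd].
Qed.

Lemma rsum_lin (a b : R) (v w : nat -> R) (N : nat) :
  rsum (fun k => a * v k - b * w k) N = a * rsum v N - b * rsum w N.
Proof. induction N as [|N IH]; simpl; [ring|rewrite IH; ring]. Qed.

Lemma rsum_two_terms (u : nat -> R) (n N : nat) : (forall k : nat, (1 <= k)%nat -> 0 <= u k) ->
  (1 <= n < N)%nat -> u O + u n <= rsum u N.
Proof.
intros Hu; assert (H0 : forall m : nat, (1 <= m)%nat -> u O <= rsum u m).
{ induction m as [|m IH]; [lia|]; intros _; simpl; destruct m as [|m]; [simpl; lra|].
  specialize (IH ltac:(lia)); specialize (Hu (S m) ltac:(lia)); lra. }
induction N as [|N IH]; intros Hn; [lia|]; simpl.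
destruct (Nat.eq_dec n N) as [->|]; [specialize (H0 N ltac:(lia)); lra|].
specialize (IH ltac:(lia)); specialize (Hu N ltac:(lia)); lra.
Qed.

(** The function [exp (- s x) + a exp (b x)] is assumed nonincreasing for [x < 0]; the conclusion is
    the sign of its slope at 0, reached through chords. *)
Lemma exp_balance (a b s : R) : 0 <= a -> 0 < b -> 0 < s ->
  (forall x1 x2 : R, x1 < x2 -> x2 < 0 ->
    exp (- s * x2) - exp (- s * x1) + a * (exp (b * x2) - exp (b * x1)) <= 0) -> a * b <= s.
Proof.
intros Ha Hb Hs H.
(* The chord from [x] to [x / 2], with both exponentials bounded below by their tangents; after
   division by [exp (- s x)] the factor [exp ((b + s) x)] remains, and it is at least
   [1 + (b + s) x]. *)
assert (H1 : forall x : R, x < 0 -> a * b * (1 + (b + s) * x) <= s).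
{ intros x Hx; specialize (H x (x / 2) ltac:(lra) ltac:(lra)); set (y := - x / 2) in *.
  assert (Hy : 0 < y) by (unfold y; lra).
  replace (exp (- s * (x / 2))) with (exp (- s * x) * exp (- s * y)) in H by (rewrite <- exp_plus; f_equal; unfold y; lra).
  replace (exp (b * (x / 2))) with (exp (b * x) * exp (b * y)) in H by (rewrite <- exp_plus; f_equal; unfold y; lra).
  pose proof (exp_ineq1_le (- s * y)); pose proof (exp_ineq1_le (b * y)).
  pose proof (exp_ineq1_le ((b + s) * x)) as Hbs.
  assert (E : exp (b * x) = exp (- s * x) * exp ((b + s) * x)) by (rewrite <- exp_plus; f_equal; ring).
  rewrite E in H; set (p := exp (- s * x)) in *; assert (Hp : 0 < p) by apply exp_pos.
  set (w := exp ((b + s) * x)) in *; assert (Hw : 0 < w) by apply exp_pos.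
  assert (H3 : exp (- s * y) - 1 + a * w * (exp (b * y) - 1) <= 0) by nra.
  assert (H4 : a * w * (b * y) <= a * w * (exp (b * y) - 1)).
  { apply Rmult_le_compat_l; [apply Rmult_le_pos; lra|lra]. }
  assert (H5 : a * w * b <= s) by nra.
  assert (0 <= a * b) by (apply Rmult_le_pos; lra); nra. }
apply le_epsilon; intros eps He.
assert (Hab : 0 <= a * b) by (apply Rmult_le_pos; lra).
assert (HK : 0 < (a * b + 1) * (b + s)) by (apply Rmult_lt_0_compat; lra).
(* At this point the defect [a b (b + s) |x|] is at most [eps]. *)
specialize (H1 (- (eps / ((a * b + 1) * (b + s))))).
assert (Hq : 0 < eps / ((a * b + 1) * (b + s))) by now apply Rdiv_lt_0_compat.
assert (E : (a * b + 1) * ((b + s) * (eps / ((a * b + 1) * (b + s)))) = eps) by (field; lra).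
nra.
Qed.

Lemma prawitz_coefficients (lambda : R) (f : C -> C) : 0 < lambda < 1 -> holo 1 f -> inj_disk f -> f 0 = 0 ->
  exists (l : C -> C) (c : nat -> C), holo 1 l /\
    (forall w : C, Cmod w < 1 -> f w = (w * Cexp (l w))%C) /\
    pser 1 c (fun z => Cexp (RtoC lambda * (l 0 - l z))%C) /\ c O = 1 /\
    forall n : nat, (1 <= n)%nat -> (INR n - lambda) * Cmod (c n) ^ 2 <= lambda.
Proof.
intros Hl Hf Hinj Hf0.
destruct (inj_factor f 0 Hf Hinj) as [q [Hq [Hqn Eq]]]; [rewrite Cmod_0; lra|].
destruct (Cexp_surj (q 0)) as [b Hb]; [apply Hqn; rewrite Cmod_0; lra|].
destruct (holo_log 1 q b Rlt_0_1 Hq Hqn Hb) as [l [Hlh [_ El]]].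
(* Since [f z = z * Cexp (l z)], this is the branch of [(f'(0) z / f z)^lambda] that equals 1 at
   0. *)
set (g := fun z => Cexp (RtoC lambda * (l 0 - l z))%C).
assert (Hg : holo 1 g).
{ apply holo_Cexp, holo_mult; [apply holo_const|apply holo_minus; [apply holo_const|easy]]. }
destruct (holo_pser 1 g Rlt_0_1 Hg) as [c Hc].
assert (Hfl : forall w : C, Cmod w < 1 -> f w = (w * Cexp (l w))%C).
{ intros w Hw; rewrite Eq, Hf0, El by easy; ring. }
assert (Hc0 : c O = 1).
{ rewrite <- (pser_at_0 1 c g Rlt_0_1 Hc); unfold g; rewrite <- Cexp_0; f_equal; ring. }
exists l, c; split; [easy|split; [easy|split; [easy|split; [easy|]]]]; intros n Hn.
assert (HnR : 1 <= INR n) by now apply (le_INR 1).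
(* [|g|^2] is [|f'(0) z / f z|^(2 lambda)], so Parseval for [g] describes the means of
   [|f|^(- s)]. *)
set (s := 2 * lambda).
assert (Hmean : forall x : R, x < 0 -> mean (fun t => exp (- s * ln (Cmod (f (circ (exp x) t))))) =
  exp (- s * Re (l 0)) * (exp (- s * x) * mean (fun t => Cmod (g (circ (exp x) t)) ^ 2))).
{ intros x Hx; assert (Hr : 0 < exp x < 1) by (split; [apply exp_pos|rewrite <- exp_0; now apply exp_increasing]).
  rewrite <- Rmult_assoc, <- mean_scal.
  - apply mean_ext; intros t; assert (Hct : Cmod (circ (exp x) t) = exp x) by (apply Cmod_circ; lra).
    rewrite Hfl, Cmod_mult, Hct, Cmod_Cexp, <- exp_plus, ln_exp by lra.
    unfold g; rewrite Cmod_Cexp; simpl pow; rewrite Rmult_1_r, <- !exp_plus; f_equal.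
    unfold s, Re; simpl; ring.
  - apply (ccts_cts_Cmod2 (fun w => g (circ (exp x) w))), holo_ccts_circ with 1; [easy|lra]. }
(* [exp_balance] is applied to the terms of index 0 and [n], with the logarithm of the radius as
   variable. Parseval holds up to [eta] on each circle, scaled so that the two errors amount to
   [eps]. *)
assert (Hdec : (Cmod (c n) ^ 2) * (2 * INR n - s) <= s).
{ apply exp_balance; [apply pow2_ge_0|unfold s; lra|unfold s; lra|]; intros x1 x2 Hx Hx2.
  assert (Hr1 : 0 < exp x1 < 1) by (split; [apply exp_pos|rewrite <- exp_0; apply exp_increasing; lra]).
  assert (Hr2 : 0 < exp x2 < 1) by (split; [apply exp_pos|rewrite <- exp_0; apply exp_increasing; lra]).
  pose proof (mean_neg_power_le f s (exp x1) (exp x2) Hf Hinj Hf0 ltac:(unfold s; lra)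
    (conj (proj1 Hr1) (exp_increasing _ _ Hx)) (proj2 Hr2)) as Hmono.
  rewrite !Hmean in Hmono by lra.
  apply Rmult_le_reg_l in Hmono; [|apply exp_pos].
  set (S1 := mean (fun t => Cmod (g (circ (exp x1) t)) ^ 2)) in *.
  set (S2 := mean (fun t => Cmod (g (circ (exp x2) t)) ^ 2)) in *.
  set (e1 := exp (- s * x1)) in *; set (e2 := exp (- s * x2)) in *.
  assert (He1 : 0 < e1) by apply exp_pos; assert (He2 : 0 < e2) by apply exp_pos.
  apply le_epsilon; intros eps Heps; rewrite Rplus_0_l.
  set (eta := eps / (e1 + e2)); assert (Heta : 0 < eta) by (apply Rdiv_lt_0_compat; lra).
  assert (Ee : e1 * eta + e2 * eta = eps) by (unfold eta; field; lra).
  destruct (mean_Cmod2_pser c g (exp x1) eta Hc Hr1 Heta) as [N1 H1].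
  destruct (mean_Cmod2_pser c g (exp x2) eta Hc Hr2 Heta) as [N2 H2].
  set (N := (N1 + N2 + n + 1)%nat).
  specialize (H1 N ltac:(lia)); specialize (H2 N ltac:(lia)).
  fold S1 in H1; fold S2 in H2.
  apply Rabs_le_between in H1; apply Rabs_le_between in H2.
  set (u := fun k : nat => e2 * (Cmod (c k) ^ 2 * exp x2 ^ (2 * k)) - e1 * (Cmod (c k) ^ 2 * exp x1 ^ (2 * k))).
  assert (Hexp : forall (k : nat) (x : R), exp (- s * x) * exp x ^ (2 * k) = exp ((2 * INR k - s) * x)).
  { intros k x; rewrite <- Rpower_pow by apply exp_pos; unfold Rpower; rewrite ln_exp, <- exp_plus, mult_INR.
    f_equal; simpl; ring. }
  assert (Hu : forall k : nat, u k = Cmod (c k) ^ 2 * (exp ((2 * INR k - s) * x2) - exp ((2 * INR k - s) * x1))).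
  { intros k; unfold u; rewrite <- !Hexp; fold e1 e2; ring. }
  (* From [lambda < 1] the exponent [2 k - s] is positive for [k >= 1], so these terms increase with
     the radius and may be dropped. *)
  assert (Hupos : forall k : nat, (1 <= k)%nat -> 0 <= u k).
  { intros k Hk; apply (le_INR 1) in Hk; simpl in Hk; rewrite Hu; apply Rmult_le_pos; [apply pow2_ge_0|].
    assert (exp ((2 * INR k - s) * x1) < exp ((2 * INR k - s) * x2)); [|lra].
    apply exp_increasing; unfold s; nra. }
  pose proof (rsum_two_terms u n N Hupos ltac:(unfold N; lia)) as Htwo.
  unfold u in Htwo at 3; rewrite rsum_lin in Htwo; rewrite !Hu, Hc0, Cmod_1 in Htwo; simpl INR in Htwo.
  replace ((2 * 0 - s) * x2) with (- s * x2) in Htwo by ring.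
  replace ((2 * 0 - s) * x1) with (- s * x1) in Htwo by ring.
  fold e1 e2 in Htwo.
  assert (e2 * rsum (fun k => Cmod (c k) ^ 2 * exp x2 ^ (2 * k)) N <= e2 * (S2 + eta)) by (apply Rmult_le_compat_l; lra).
  assert (e1 * (S1 - eta) <= e1 * rsum (fun k => Cmod (c k) ^ 2 * exp x1 ^ (2 * k)) N) by (apply Rmult_le_compat_l; lra).
  lra. }
unfold s in Hdec; lra.
Qed.

(** * Uniqueness of the expansion and coefficient identities *)

Lemma pow_n_Cpow (x : C) (k : nat) : pow_n (K := C_Ring) x k = (x ^ k)%C.
Proof. induction k as [|k IH]; [easy|simpl; now rewrite IH]. Qed.

Lemma sum_n_csum (u : nat -> C) (n : nat) : sum_n (G := C_AbelianMonoid) u n = csum u (S n).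
Proof.
induction n as [|n IH]; [rewrite sum_O; simpl; now rewrite Cplus_0_l|].
rewrite sum_Sn, IH; easy.
Qed.

Lemma C_ball_of_Cmod (x y : C) (eps : R) : Cmod (y - x) < eps -> ball (M := C_UniformSpace) x eps y.
Proof.
intros H; split; eapply Rle_lt_trans; try exact H; [exact (re_le_Cmod (y - x))|exact (im_le_Cmod (y - x))].
Qed.

(** The halved radius accounts for the square shape of the balls of [C_UniformSpace]. *)
Lemma Cmod_of_C_ball (x y : C) (eps : R) : ball (M := C_UniformSpace) x (eps / 2) y -> Cmod (y - x) < eps.
Proof.
intros [H1 H2]; eapply Rle_lt_trans; [apply Cmod_le_sum|].
change (Rabs (Re y - Re x) < eps / 2) in H1; change (Rabs (Im y - Im x) < eps / 2) in H2.
unfold Re, Im in *; simpl; unfold Rminus in *; lra.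
Qed.

Lemma is_pseries_clim (a : nat -> C) (x l : C) :
  is_pseries (K := C_AbsRing) (V := C_NormedModule) a x l <-> clim (psum a x) l.
Proof.
assert (E : forall n : nat, sum_n (G := C_AbelianMonoid) (fun k => scal (pow_n (K := C_Ring) x k) (a k)) n =
  psum a x (S n)).
{ intros n; rewrite sum_n_csum; apply csum_ext; intros k _; rewrite pow_n_Cpow; apply Cmult_comm. }
unfold is_pseries, is_series; split; intros H.
- intros eps He; assert (He2 : 0 < eps / 2) by lra.
  pose proof (proj1 (filterlim_locally _ _) H (mkposreal _ He2)) as [N HN].
  exists (S N); intros n Hn; destruct n as [|n]; [lia|]; rewrite <- E.
  apply Cmod_of_C_ball, HN; lia.
- apply filterlim_locally; intros eps; destruct (H eps (cond_pos eps)) as [N HN].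
  exists N; intros n Hn; apply C_ball_of_Cmod.
  match goal with |- Cmod (?X - l) < _ => replace X with (psum a x (S n)) by (symmetry; apply E) end.
  apply HN; lia.
Qed.

Lemma ccont_continuous (L : C -> C) (w : C) :
  ccont L w <-> continuous (T := C_UniformSpace) (U := C_UniformSpace) L w.
Proof.
unfold continuous; split; intros H.
- apply filterlim_locally; intros eps; destruct (H eps (cond_pos eps)) as [d [Hd H']].
  assert (Hd2 : 0 < d / 2) by lra.
  exists (mkposreal _ Hd2); intros y Hy; now apply C_ball_of_Cmod, H', Cmod_of_C_ball.
- intros eps He; assert (He2 : 0 < eps / 2) by lra.
  pose proof (proj1 (filterlim_locally _ _) H (mkposreal _ He2)) as [d Hd].
  exists d; split; [apply cond_pos|]; intros y Hy; now apply Cmod_of_C_ball, Hd, C_ball_of_Cmod.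
Qed.

Lemma analytic_holo (f : C -> C) : analytic_in_disk f -> holo 1 f.
Proof.
intros Hf; apply holo_local; intros z Hz; destruct (Hf z Hz) as [a [r [Hr Ha]]].
assert (Hp : pser r a (fun h => f (z + h)%C)).
{ intros h Hh; apply is_pseries_clim; specialize (Ha (z + h)%C).
  replace (z + h - z)%C with h in Ha by ring; now apply Ha. }
destruct (pser_holo r a _ Hp) as [g Hg].
exists r, f, (fun w => g (w - z)%C); split; [easy|]; intros w Hw; split; [easy|].
destruct (Hg (w - z)%C Hw) as [H1 H2]; split.
- apply cdiff_ext_loc with (fun v => f (z + (v - z))%C) 1; [lra|intros; f_equal; ring|].
  eapply cdiff_eq; [|apply (cdiff_comp (fun h => f (z + h)%C) (fun v => v - z)%C); [|exact H1]].
  2:{ apply cdiff_minus; [apply cdiff_id|apply cdiff_const]. }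
  ring.
- apply (ccont_comp g (fun w => w - z)%C); [|easy].
  apply ccont_minus; [apply ccont_id|apply ccont_const].
Qed.

(** [C_derive] unfolds to the limits of the two components of the difference quotient along the
    horizontal line through [z]. *)
Lemma cdiff_C_derive (f : C -> C) (z l : C) : cdiff f z l -> C_derive f z = l.
Proof.
intros Hf.
assert (A : forall p : C -> R, (forall a b : C, Rabs (p a - p b) <= Cmod (a - b)) ->
  Lim (fun x : R => p ((f (x, snd z) - f z) / ((x, snd z) - z))%C) (fst z) = p l).
{ intros p Hp; rewrite (is_lim_unique _ _ (p l)); [easy|]; apply is_lim_spec; intros eps.
  destruct (cdiff_lim_eps f z l Hf (eps / 2)) as [d [Hd H]]; [pose proof (cond_pos eps); lra|].
  exists (mkposreal d Hd); intros x Hx Hxz; simpl in Hxz.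
  assert (E : ((x, snd z) - z)%C = RtoC (x - fst z)).
  { destruct z as [a b]; apply injective_projections; simpl; ring. }
  assert (Hm : Cmod ((x, snd z) - z) = Rabs (x - fst z)) by (rewrite E; apply Cmod_R).
  assert (Hx' : Rabs (x - fst z) < d) by exact Hx.
  assert (Hp0 : 0 < Rabs (x - fst z)) by (apply Rabs_pos_lt; lra).
  specialize (H (x, snd z)); rewrite Hm in H.
  eapply Rle_lt_trans; [exact (Hp ((f (x, snd z) - f z) / ((x, snd z) - z))%C l)|].
  assert (Hn : ((x, snd z) - z)%C <> 0) by (apply Cmod_gt_0; rewrite Hm; easy).
  replace ((f (x, snd z) - f z) / ((x, snd z) - z) - l)%C
    with ((f (x, snd z) - f z - l * ((x, snd z) - z)) / ((x, snd z) - z))%C by (field; exact Hn).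
  rewrite Cmod_div, Hm by easy; apply Rle_lt_trans with (eps / 2); [|pose proof (cond_pos eps); lra].
  apply Rmult_le_reg_r with (Rabs (x - fst z)); [easy|].
  unfold Rdiv at 1; rewrite Rmult_assoc, Rinv_l by lra; lra. }
unfold C_derive, C_lim; rewrite (surjective_pairing l); f_equal.
- exact (f_equal real (A Re Re_minus_le)).
- exact (f_equal real (A Im Im_minus_le)).
Qed.

(** Both logarithms are continuous and vanish at [z], so near [z] they are small and coincide by
    [Cexp_inj]; the expansions of the powers then agree. This determines the sequence chosen in
    [mixed_aharonov]. *)
Lemma mixed_aharonov_expansion_unique (lambda : R) (f : C -> C) (z : C) (a b : nat -> C) :
  mixed_aharonov_expansion lambda f z a -> mixed_aharonov_expansion lambda f z b ->
  forall k : nat, a k = b k.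
Proof.
intros [r1 [L1 [Hr1 [Hz1 H1]]]] [r2 [L2 [Hr2 [Hz2 H2]]]].
assert (HL : forall (r : R) (L : C -> C), 0 < r -> L z = 0 ->
  (forall w : C, Cmod (w - z) < r -> continuous (T := C_UniformSpace) (U := C_UniformSpace) L w) ->
  exists d : R, 0 < d /\ forall w : C, Cmod (w - z) < d -> Cmod (L w) < 1).
{ intros r L Hr Hz H; specialize (H z); rewrite Cmod_0_minus in H.
  destruct (proj2 (ccont_continuous L z) (H Hr) 1 Rlt_0_1) as [d [Hd H']].
  exists d; split; [easy|]; intros w Hw; specialize (H' w Hw); rewrite Hz in H'.
  now replace (L w - 0)%C with (L w) in H' by ring. }
destruct (HL r1 L1 Hr1 Hz1 (fun w Hw => proj1 (H1 w Hw))) as [d1 [Hd1 HL1]].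
destruct (HL r2 L2 Hr2 Hz2 (fun w Hw => proj1 (H2 w Hw))) as [d2 [Hd2 HL2]].
assert (Htr : forall t : C, (z + t - z)%C = t) by (intros; ring).
apply (pser_unique r1 r2 (Rmin (Rmin r1 r2) (Rmin d1 d2)) a b
  (fun t => Cexp (RtoC lambda * L1 (z + t))%C) (fun t => Cexp (RtoC lambda * L2 (z + t))%C)); try easy.
- repeat apply Rmin_glb_lt; easy.
- intros t Ht; apply is_pseries_clim; destruct (H1 (z + t)%C) as [_ [_ H]]; [now rewrite Htr|].
  now rewrite Htr in H.
- intros t Ht; apply is_pseries_clim; destruct (H2 (z + t)%C) as [_ [_ H]]; [now rewrite Htr|].
  now rewrite Htr in H.
- intros t Ht; do 2 f_equal.
  pose proof (Rmin_l (Rmin r1 r2) (Rmin d1 d2)); pose proof (Rmin_r (Rmin r1 r2) (Rmin d1 d2)).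
  pose proof (Rmin_l r1 r2); pose proof (Rmin_r r1 r2); pose proof (Rmin_l d1 d2); pose proof (Rmin_r d1 d2).
  apply Cexp_inj.
  + destruct (H1 (z + t)%C) as [_ [E1 _]]; [rewrite Htr; lra|].
    destruct (H2 (z + t)%C) as [_ [E2 _]]; [rewrite Htr; lra|]; now rewrite E1, E2.
  + apply HL1; rewrite Htr; lra.
  + apply HL2; rewrite Htr; lra.
Qed.

(** * Coefficients of products, compositions and binomial powers *)

Lemma pser_plus (rad : R) (a b : nat -> C) (f g : C -> C) : pser rad a f -> pser rad b g ->
  pser rad (fun k => a k + b k)%C (fun z => f z + g z)%C.
Proof.
intros Hf Hg z Hz; apply clim_ext with (fun n => psum a z n + psum b z n)%C.
- intros n; rewrite <- csum_plus; apply csum_ext; intros; ring.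
- apply clim_plus; auto.
Qed.

Lemma pser_scal (rad : R) (c : C) (a : nat -> C) (f : C -> C) : pser rad a f ->
  pser rad (fun k => c * a k)%C (fun z => c * f z)%C.
Proof.
intros Hf z Hz; apply clim_ext with (fun n => c * psum a z n)%C.
- intros n; rewrite <- csum_scal; apply csum_ext; intros; ring.
- apply clim_scal; auto.
Qed.

Definition shift_coef (a : nat -> C) (k : nat) : C := match k with O => 0 | S j => a j end.

Lemma clim_unshift (u : nat -> C) (l : C) : clim (fun n => u (S n)) l -> clim u l.
Proof.
intros H eps He; destruct (H eps He) as [N HN]; exists (S N); intros [|n] Hn; [lia|]; apply HN; lia.
Qed.

Lemma pser_shift (rad : R) (a : nat -> C) (f : C -> C) : pser rad a f ->
  pser rad (shift_coef a) (fun z => z * f z)%C.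
Proof.
intros Hf z Hz; apply clim_unshift, clim_ext with (fun n => z * psum a z n)%C.
- intros n; rewrite csum_shift, <- csum_scal; simpl shift_coef; rewrite Cmult_0_l, Cplus_0_l.
  apply csum_ext; intros k _; rewrite Cpow_S; ring.
- now apply clim_scal, Hf.
Qed.

Lemma pser_mult_linear (rad : R) (b : C) (a : nat -> C) (f : C -> C) : pser rad a f ->
  pser rad (fun k => a k + (- b) * shift_coef a k)%C (fun z => (1 - b * z) * f z)%C.
Proof.
intros Hf; apply pser_ext with (fun z => f z + (- b) * (z * f z))%C; [intros; ring|].
now apply pser_plus, pser_scal, pser_shift.
Qed.

(** The Cauchy product, written by peeling off the constant term of [a] to match the induction in
    [pser_mult_coef]; [conv_csum] gives the usual form. *)
Fixpoint conv (a b : nat -> C) (n : nat) : C :=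
  match n with
  | O => (a O * b O)%C
  | S m => (a O * b (S m) + conv (fun k => a (S k)) b m)%C
  end.

Lemma conv_csum (a b : nat -> C) (n : nat) : conv a b n = csum (fun i => a i * b (n - i)%nat)%C (S n).
Proof.
revert a; induction n as [|n IH]; intros a; [simpl; ring|].
rewrite csum_shift, Nat.sub_0_r; simpl conv; now rewrite IH.
Qed.

(** Holomorphy already provides a series for the product, and only its coefficients have to be
    identified: writing [f = a 0 + z q] gives [f g = a 0 g + z (q g)], which lowers [n]. *)
Lemma pser_mult_coef (rad : R) (a b d : nat -> C) (f g : C -> C) : 0 < rad ->
  pser rad a f -> pser rad b g -> pser rad d (fun z => f z * g z)%C -> forall n : nat, d n = conv a b n.
Proof.
intros Hrad Hf Hg Hd n; revert a d f Hf Hd; induction n as [|n IH]; intros a d f Hf Hd.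
all: destruct (pser_factor_0 rad a f Hrad Hf) as [q [Hq E]].
all: destruct (holo_pser rad (fun z => q z * g z)%C Hrad) as [d' Hd'];
  [apply holo_mult; eapply pser_holo; eassumption|].
all: assert (Ed : forall k : nat, d k = (a O * b k + shift_coef d' k)%C)
  by (apply (pser_unique rad rad rad d _ (fun z => f z * g z)%C (fun z => a O * g z + z * (q z * g z))%C); try easy;
    [apply pser_plus; [now apply pser_scal|now apply (pser_shift rad d')]|intros t Ht; rewrite E by easy; ring]).
- rewrite Ed; simpl; ring.
- rewrite Ed; simpl; f_equal; now apply (IH (fun k => a (S k)) d' q).
Qed.

Lemma pser_low_coef (rad : R) (m j : nat) (d : nat -> C) (h : C -> C) : 0 < rad -> holo rad h ->
  pser rad d (fun z => z ^ m * h z)%C -> (j < m)%nat -> d j = 0.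
Proof.
intros Hrad Hh; revert d j; induction m as [|m IH]; intros d j Hd Hj; [lia|].
destruct (holo_pser rad (fun z => z ^ m * h z)%C Hrad) as [d' Hd'].
{ apply holo_mult; [|easy]; clear; induction m as [|m IH]; [apply (holo_const rad 1)|].
  apply (holo_mult rad (fun z => z) (fun z => z ^ m)%C); [apply holo_id|easy]. }
rewrite (pser_unique rad rad rad d (shift_coef d') (fun z => z ^ S m * h z)%C
  (fun z => z * (z ^ m * h z))%C); try easy.
- destruct j as [|j]; [easy|]; simpl; apply (IH d'); [easy|lia].
- now apply pser_shift.
- intros t _; rewrite Cpow_S; ring.
Qed.

Lemma holo_pow (rad : R) (f : C -> C) (m : nat) : holo rad f -> holo rad (fun z => f z ^ m)%C.
Proof.
intros Hf; induction m as [|m IH]; [apply (holo_const rad 1)|].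
now apply (holo_mult rad f (fun z => f z ^ m)%C).
Qed.

(* [xi = t u], so the terms [c k xi^k] with [k > j] do not contribute to the coefficient of [t^j]. *)
Lemma pser_comp_coef (rad : R) (u xi : C -> C) (p : nat -> nat -> C) : 0 < rad -> holo rad u ->
  (forall t : C, Cmod t < rad -> xi t = (t * u t)%C) -> (forall t : C, Cmod t < rad -> Cmod (xi t) < 1) ->
  (forall k : nat, pser rad (p k) (fun t => xi t ^ k)%C) ->
  forall (i m j : nat) (g : C -> C) (c d : nat -> C), (m + i = S j)%nat -> pser 1 c g ->
  pser rad d (fun t => xi t ^ m * g (xi t))%C -> d j = csum (fun k => c k * p (m + k)%nat j)%C i.
Proof.
intros Hrad Hu Exi Hxi Hp.
assert (Hxih : holo rad xi).
{ apply holo_ext with (fun t => t * u t)%C; [intros; now rewrite Exi|apply holo_mult; [apply holo_id|easy]]. }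
(* [m] counts the powers of [xi] already factored out and [i] the coefficients of [g] still to be
   read. At [i = 0] one has [m = j + 1], and the factor [t ^ m] kills the coefficient of [t ^ j]. *)
induction i as [|i IH]; intros m j g c d Hm Hg Hd.
- simpl; apply (pser_low_coef rad m j d (fun t => u t ^ m * g (xi t))%C); [easy| | |lia].
  + apply holo_mult; [now apply holo_pow|].
    apply (holo_comp rad 1 g xi); [now apply pser_holo with c|easy|easy].
  + apply pser_ext with (fun t => xi t ^ m * g (xi t))%C; [|easy].
    intros t Ht; rewrite (Exi t Ht) at 1; rewrite Cpow_mult_l; ring.
- destruct (pser_factor_0 1 c g Rlt_0_1 Hg) as [g1 [Hg1 E]].
  destruct (holo_pser rad (fun t => xi t ^ S m * g1 (xi t))%C Hrad) as [d' Hd'].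
  { apply holo_mult; [now apply holo_pow|].
    apply (holo_comp rad 1 g1 xi); [now apply pser_holo with (fun k => c (S k))|easy|easy]. }
  rewrite (pser_unique rad rad rad d (fun k => c O * p m k + d' k)%C (fun t => xi t ^ m * g (xi t))%C
    (fun t => c O * xi t ^ m + xi t ^ S m * g1 (xi t))%C); try easy.
  + rewrite csum_shift, Nat.add_0_r; f_equal.
    rewrite (IH (S m) j g1 (fun k => c (S k)) d'); [|lia|easy|easy].
    apply csum_ext; intros k _; do 2 f_equal; lia.
  + apply pser_plus; [now apply pser_scal|easy].
  + intros t Ht; rewrite E by (now apply Hxi); rewrite Cpow_S; ring.
Qed.

Lemma falling_succ (x : R) (m : nat) : falling (x + 1) (S m) = (x + 1) * falling x m.
Proof.
induction m as [|m IH]; [simpl; ring|].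
change (falling (x + 1) (S (S m))) with (falling (x + 1) (S m) * (x + 1 - INR (S m))).
rewrite IH, S_INR; simpl; ring.
Qed.

Lemma gbinom_succ (x : R) (m : nat) : gbinom x (S m) = gbinom x m * (x - INR m) / INR (S m).
Proof.
unfold gbinom; rewrite fact_simpl, mult_INR; simpl falling; field; split.
- apply INR_fact_neq_0.
- now apply not_0_INR.
Qed.

Lemma gbinom_pascal (x : R) (m : nat) : gbinom (x + 1) (S m) = gbinom x m + gbinom x (S m).
Proof.
unfold gbinom; rewrite falling_succ, fact_simpl, mult_INR, S_INR; simpl falling; field; split.
- apply INR_fact_neq_0.
- pose proof (pos_INR m); lra.
Qed.

Lemma gbinom_0 (x : R) : gbinom x 0 = 1.
Proof. unfold gbinom; simpl; field. Qed.

Lemma falling_nat_zero (i m : nat) : (i < m)%nat -> falling (INR i) m = 0.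
Proof.
induction m as [|m IH]; [lia|]; intros H; simpl.
destruct (Nat.eq_dec i m) as [->|]; [ring|rewrite IH by lia; ring].
Qed.

Lemma falling_nat_pos (i m : nat) : 0 <= falling (INR i) m.
Proof.
destruct (Nat.lt_ge_cases i m) as [H|H]; [rewrite falling_nat_zero; [lra|easy]|].
induction m as [|m IH]; simpl; [lra|]; apply Rmult_le_pos; [apply IH; lia|].
apply (le_INR (S m)) in H; rewrite S_INR in H; lra.
Qed.

(** For [j = 0] the upper entry is -1, but then [m = 0] and the value is 1; otherwise the upper
    entry is a natural number. *)
Lemma gbinom_pred_pos (j m : nat) : (m <= j)%nat -> 0 <= gbinom (INR j - 1) m.
Proof.
intros H; destruct j as [|j].
- replace m with O by lia; rewrite gbinom_0; lra.
- rewrite S_INR; replace (INR j + 1 - 1) with (INR j) by ring.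
  apply Rmult_le_pos; [apply falling_nat_pos|left; apply Rinv_0_lt_compat, INR_fact_lt_0].
Qed.

Lemma pser_const (rad : R) (c : C) : pser rad (fun k => match k with O => c | S _ => 0 end) (fun _ => c).
Proof.
intros z _ eps He; exists 1%nat; intros [|n] Hn; [lia|].
rewrite csum_shift, (csum_ext _ (fun k => 0 * 0)%C), csum_scal by (intros; ring).
simpl; replace (_ - c)%C with (RtoC 0) by ring; now rewrite Cmod_0.
Qed.

(** Comparing coefficients in [(1 - b t) xi^(k+1) = t xi^k] gives a recurrence in [k] and [j] that
    is Pascal's rule weighted by powers of [b]. *)
Lemma moebius_power_coef (rad : R) (b : C) (xi : C -> C) (p : nat -> nat -> C) : 0 < rad ->
  (forall t : C, Cmod t < rad -> ((1 - b * t) * xi t = t)%C) ->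
  (forall k : nat, pser rad (p k) (fun t => xi t ^ k)%C) ->
  forall k j : nat, p k j = if le_dec k j then (RtoC (gbinom (INR j - 1) (j - k)) * b ^ (j - k))%C else 0.
Proof.
intros Hrad Hxi Hp.
assert (H0 : forall j : nat, p O j = match j with O => 1 | S _ => 0 end).
{ apply (pser_unique rad rad rad _ _ (fun t => xi t ^ O)%C (fun _ => RtoC 1)); try easy; apply pser_const. }
assert (Hrec : forall k j : nat, (p (S k) j + (- b) * shift_coef (p (S k)) j)%C = shift_coef (p k) j).
{ intros k; apply (pser_unique rad rad rad _ _ (fun t => (1 - b * t) * xi t ^ S k)%C (fun t => t * xi t ^ k)%C); try easy.
  - now apply (pser_mult_linear rad b (p (S k)) (fun t => xi t ^ S k)%C).
  - now apply (pser_shift rad (p k) (fun t => xi t ^ k)%C).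
  - intros t Ht; rewrite <- (Hxi t Ht) at 3; rewrite Cpow_S; ring. }
assert (HS0 : forall k : nat, p (S k) O = 0).
{ intros k; specialize (Hrec k O); simpl in Hrec; rewrite <- Hrec; ring. }
assert (HSS : forall k j : nat, p (S k) (S j) = (b * p (S k) j + p k j)%C).
{ intros k j; specialize (Hrec k (S j)); simpl shift_coef in Hrec; rewrite <- Hrec; ring. }
induction k as [|k IHk]; intros j.
- rewrite H0; destruct j as [|j].
  + destruct (le_dec 0 0) as [_|]; [|lia]; rewrite gbinom_0; simpl; ring.
  + destruct (le_dec 0 (S j)) as [_|]; [|lia]; rewrite Nat.sub_0_r, S_INR.
    replace (INR j + 1 - 1) with (INR j) by ring.
    unfold gbinom; rewrite falling_nat_zero by lia; unfold Rdiv; rewrite Rmult_0_l; ring.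
- induction j as [|j IHj]; [rewrite HS0; destruct (le_dec (S k) 0); [lia|easy]|].
  rewrite HSS, IHj, IHk; destruct (le_dec (S k) (S j)) as [Hkj|Hkj].
  + destruct (le_dec k j) as [_|]; [|lia]; rewrite S_INR; replace (S j - S k)%nat with (j - k)%nat by lia.
    destruct (le_dec (S k) j) as [Hlt|Hge].
    * replace (j - k)%nat with (S (j - S k)) by lia; set (m := (j - S k)%nat).
      replace (INR j + 1 - 1) with (INR j - 1 + 1) by ring.
      rewrite gbinom_pascal, RtoC_plus, Cpow_S; ring.
    * replace (j - k)%nat with O by lia; rewrite !gbinom_0; ring.
  + destruct (le_dec (S k) j); [lia|]; destruct (le_dec k j); [lia|]; ring.
Qed.

(** Newton's binomial series: [E = (1 - b t)^lambda] solves [(1 - b t) E' = - lambda b E], which is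
    a two-term recurrence for its coefficients. *)
Lemma binomial_power_coef (rad lambda : R) (b : C) (l : C -> C) (e : nat -> C) : 0 < rad -> holo rad l -> l 0 = 0 ->
  (forall t : C, Cmod t < rad -> Cexp (l t) = (1 - b * t)%C) ->
  pser rad e (fun t => Cexp (RtoC lambda * l t)) ->
  forall m : nat, e m = (RtoC (gbinom lambda m) * (- b) ^ m)%C.
Proof.
intros Hrad [l' Hl] Hl0 El He.
assert (Hl' : forall t : C, Cmod t < rad -> ((1 - b * t) * l' t = - b)%C).
{ intros t Ht; apply cdiff_unique with (fun t => Cexp (l t)) t.
  - rewrite <- El by easy; apply (cdiff_comp Cexp l); [now apply Hl|apply cdiff_Cexp].
  - apply cdiff_ext_loc with (fun t => 1 - b * t)%C (rad - Cmod t); [lra| |].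
    + intros w Hw; symmetry; apply El.
      pose proof (Cmod_le_shift w t); lra.
    + eapply cdiff_eq; [|apply cdiff_minus; [apply cdiff_const|apply cdiff_scal, cdiff_id]]; ring. }
set (E := fun t => Cexp (RtoC lambda * l t)) in *.
assert (HE : hol rad E (fun t => E t * (RtoC lambda * l' t))%C).
{ intros t Ht; destruct (Hl t Ht) as [H1 H2]; split.
  - apply (cdiff_comp Cexp (fun t => RtoC lambda * l t)%C); [now apply cdiff_scal|apply cdiff_Cexp].
  - apply ccont_mult; [|apply ccont_mult; [apply ccont_const|easy]].
    apply (ccont_comp Cexp (fun t => RtoC lambda * l t)%C); [|apply ccont_Cexp].
    apply ccont_mult; [apply ccont_const|now apply cdiff_cont with (l' t)]. }
pose proof (hol_derive_pser rad e E _ He HE) as HE'.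
assert (Hrec : forall m : nat, (dcoef e m + (- b) * shift_coef (dcoef e) m)%C = (- (RtoC lambda * b) * e m)%C).
{ apply (pser_unique rad rad rad _ _ (fun t => (1 - b * t) * (E t * (RtoC lambda * l' t)))%C
    (fun t => - (RtoC lambda * b) * E t)%C); try easy.
  - now apply (pser_mult_linear rad b (dcoef e)).
  - now apply pser_scal.
  - intros t Ht; replace ((1 - b * t) * (E t * (lambda * l' t)))%C
      with (RtoC lambda * E t * ((1 - b * t) * l' t))%C by ring.
    rewrite Hl' by easy; ring. }
assert (Hne : forall m : nat, RtoC (INR (S m)) <> 0).
{ intros m E0; apply RtoC_inj in E0; pose proof (lt_0_INR (S m) ltac:(lia)); lra. }
induction m as [|m IH].
- rewrite <- (pser_at_0 rad e E Hrad He); unfold E; rewrite Hl0, gbinom_0, Cmult_0_r, Cexp_0; simpl; ring.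
- assert (Hstep : (RtoC (INR (S m)) * e (S m) = - b * RtoC (lambda - INR m) * e m)%C).
  { specialize (Hrec m); unfold dcoef in Hrec at 1; destruct m as [|m].
    - simpl shift_coef in Hrec; simpl INR in *; rewrite Rminus_0_r.
      rewrite <- (Cplus_0_r (RtoC 1 * e 1%nat)), <- (Cmult_0_r (- b)), Hrec; ring.
    - simpl shift_coef in Hrec; unfold dcoef in Hrec.
      replace (RtoC (INR (S (S m))) * e (S (S m)))%C
        with (RtoC (INR (S (S m))) * e (S (S m)) + - b * (RtoC (INR (S m)) * e (S m)) + b * (RtoC (INR (S m)) * e (S m)))%C by ring.
      rewrite Hrec, RtoC_minus; ring. }
  replace (e (S m)) with (RtoC (INR (S m)) * e (S m) / RtoC (INR (S m)))%C by (field; apply Hne).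
  rewrite Hstep, IH, gbinom_succ.
  unfold Rdiv; rewrite !RtoC_mult, RtoC_inv, Cpow_S by (apply not_0_INR; lia); field; apply Hne.
Qed.

(** * The Koebe transform *)

Definition moebius (z x : C) : C := ((x + z) / (1 + Cconj z * x))%C.

Lemma one_minus_neq_0 (u : C) : Cmod u < 1 -> (1 - u)%C <> 0.
Proof. intros Hu; apply Cminus_neq_0; intros E; rewrite <- E, Cmod_1 in Hu; lra. Qed.

Lemma moebius_den_neq_0 (z x : C) : Cmod z < 1 -> Cmod x < 1 -> (1 + Cconj z * x)%C <> 0.
Proof.
intros Hz Hx; replace (1 + Cconj z * x)%C with (1 - (- (Cconj z * x)))%C by ring.
apply one_minus_neq_0; rewrite Cmod_opp, Cmod_mult, Cmod_conj.
pose proof (Cmod_ge_0 x); nra.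
Qed.

Lemma Cmod_moebius (z x : C) : Cmod z < 1 -> Cmod x < 1 -> Cmod (moebius z x) < 1.
Proof.
intros Hz Hx; pose proof (moebius_den_neq_0 z x Hz Hx) as Hd; unfold moebius.
rewrite Cmod_div by easy; apply Cmod_gt_0 in Hd.
apply Rmult_lt_reg_r with (Cmod (1 + Cconj z * x)); [easy|].
unfold Rdiv; rewrite Rmult_assoc, Rinv_l, Rmult_1_r, Rmult_1_l by lra.
assert (E : Cmod (1 + Cconj z * x) ^ 2 - Cmod (x + z) ^ 2 = (1 - Cmod z ^ 2) * (1 - Cmod x ^ 2)).
{ rewrite !Cmod2_alt; unfold Re, Im; simpl; ring. }
pose proof (Cmod_ge_0 z); pose proof (Cmod_ge_0 x).
assert (0 < (1 - Cmod z ^ 2) * (1 - Cmod x ^ 2)) by (apply Rmult_lt_0_compat; nra).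
nra.
Qed.

Lemma moebius_inj (z x y : C) : Cmod z < 1 -> Cmod x < 1 -> Cmod y < 1 -> moebius z x = moebius z y -> x = y.
Proof.
intros Hz Hx Hy E; pose proof (moebius_den_neq_0 z x Hz Hx); pose proof (moebius_den_neq_0 z y Hz Hy).
assert (E2 : ((x + z) * (1 + Cconj z * y) = (y + z) * (1 + Cconj z * x))%C).
{ unfold moebius in E; replace (x + z)%C with ((x + z) / (1 + Cconj z * x) * (1 + Cconj z * x))%C by (field; easy).
  rewrite E; field; easy. }
assert (Hs : (1 - z * Cconj z)%C <> 0).
{ apply one_minus_neq_0; rewrite Cmod_mult, Cmod_conj; pose proof (Cmod_ge_0 z); nra. }
assert (E3 : ((x - y) * (1 - z * Cconj z) = 0)%C).
{ replace ((x - y) * (1 - z * Cconj z))%C with ((x + z) * (1 + Cconj z * y) - (y + z) * (1 + Cconj z * x))%C by ring.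
  rewrite E2; ring. }
destruct (Ceq_dec x y) as [|Hn]; [easy|exfalso].
now apply (Cmult_neq_0 _ _ (Cminus_neq_0 x y Hn) Hs).
Qed.

Lemma holo_moebius (z : C) : Cmod z < 1 -> holo 1 (moebius z).
Proof.
intros Hz; apply (holo_div 1 (fun x => x + z)%C (fun x => 1 + Cconj z * x)%C).
- apply holo_plus; [apply holo_id|apply holo_const].
- apply holo_plus; [apply holo_const|apply holo_mult; [apply holo_const|apply holo_id]].
- intros x Hx; now apply moebius_den_neq_0.
Qed.

Lemma Cmult_conj_Cmod2 (z : C) : (z * Cconj z)%C = RtoC (Cmod z ^ 2).
Proof. now rewrite Cmod2_conj. Qed.

Lemma cdiff_moebius_0 (z : C) : cdiff (moebius z) 0 (RtoC (1 - Cmod z ^ 2)).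
Proof.
assert (H1 : (1 + Cconj z * 0)%C <> 0) by (rewrite Cmult_0_r, Cplus_0_r; apply Cmod_gt_0; rewrite Cmod_1; lra).
eapply cdiff_eq; [|apply (cdiff_div (fun x => x + z)%C (fun x => 1 + Cconj z * x)%C); [| |easy]].
2:{ apply cdiff_plus; [apply cdiff_id|apply cdiff_const]. }
2:{ apply cdiff_plus; [apply cdiff_const|apply cdiff_scal, cdiff_id]. }
cbv beta; rewrite RtoC_minus, <- Cmult_conj_Cmod2; field; easy.
Qed.

Lemma moebius_preimage (z t : C) : (1 - Cconj z * t)%C <> 0 -> Cmod z < 1 ->
  moebius z (t / (1 - Cconj z * t)) = (z + RtoC (1 - Cmod z ^ 2) * t)%C.
Proof.
intros Ht Hz; unfold moebius; rewrite RtoC_minus, <- Cmult_conj_Cmod2; field; split; [easy|].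
replace (1 - Cconj z * t + Cconj z * t)%C with (RtoC 1) by ring.
apply Cmod_gt_0; rewrite Cmod_1; lra.
Qed.

(* The expansion at [z] is that of the Koebe transform at 0 in the variable
   [t = (w - z) / (1 - |z|^2)], with [xi = t / (1 - conj z t)] the Möbius preimage of [w];
   the factor [1 - conj z t] comes from [w - z = (1 - |z|^2) xi (1 - conj z t)]. *)
Lemma mixed_aharonov_coefficients (lambda : R) (f : C -> C) (z : C) : 0 < lambda < 1 ->
  analytic_in_disk f -> univalent_in_disk f -> Cmod z < 1 ->
  exists (a c : nat -> C), mixed_aharonov_expansion lambda f z a /\ c O = 1 /\
    (forall n : nat, (1 <= n)%nat -> (INR n - lambda) * Cmod (c n) ^ 2 <= lambda) /\
    forall n : nat, (RtoC ((1 - Cmod z ^ 2) ^ n) * a n)%C =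
      csum (fun j => csum (fun k => c k * (RtoC (gbinom (INR j - 1) (j - k)) * Cconj z ^ (j - k))) (S j) *
        (RtoC (gbinom lambda (n - j)) * (- Cconj z) ^ (n - j)))%C (S n).
Proof.
intros Hl Hf Hinj Hz; pose proof (analytic_holo f Hf) as Hfh.
set (b := Cconj z); set (s := 1 - Cmod z ^ 2).
assert (Hb : Cmod b < 1) by (unfold b; now rewrite Cmod_conj).
assert (Hs : 0 < s) by (unfold s; pose proof (Cmod_ge_0 z); nra).
assert (HsC : RtoC s <> 0) by (intros E; apply RtoC_inj in E; lra).
set (F := fun x => (f (moebius z x) - f z)%C).
assert (HF : holo 1 F).
{ apply holo_minus; [|apply holo_const].
  apply (holo_comp 1 1 f (moebius z)); [easy|now apply holo_moebius|intros; now apply Cmod_moebius]. }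
assert (HFinj : inj_disk F).
{ intros x y Hx Hy E; apply (moebius_inj z); try easy.
  apply Hinj; try (now apply Cmod_moebius).
  replace (f (moebius z x)) with (F x + f z)%C by (unfold F; ring); rewrite E; unfold F; ring. }
assert (Hm0 : moebius z 0 = z) by (unfold moebius; field; rewrite Cmult_0_r, Cplus_0_r; apply Cmod_gt_0; rewrite Cmod_1; lra).
assert (HF0 : F 0 = 0) by (unfold F; rewrite Hm0; ring).
destruct (prawitz_coefficients lambda F Hl HF HFinj HF0) as [l [c [Hlh [HFl [Hc [Hc0 Hcn]]]]]].
set (g := fun x => Cexp (RtoC lambda * (l 0 - l x))%C) in *.
assert (Hden : forall t : C, Cmod t < 1 -> (1 - b * t)%C <> 0).
{ intros t Ht; apply one_minus_neq_0; rewrite Cmod_mult; pose proof (Cmod_ge_0 t); nra. }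
assert (Hlin : holo 1 (fun t => 1 - b * t)%C).
{ apply holo_minus; [apply holo_const|apply holo_mult; [apply holo_const|apply holo_id]]. }
destruct (holo_log 1 (fun t => 1 - b * t)%C 0 Rlt_0_1 Hlin Hden) as [l1 [Hl1 [Hl10 El1]]].
{ rewrite Cexp_0; ring. }
set (u := fun t => (/ (1 - b * t))%C); set (xi := fun t => (t / (1 - b * t))%C).
assert (Hu : holo (1 / 2) u).
{ apply (holo_inv (1 / 2) (fun t => 1 - b * t)%C); [apply holo_sub with 1; [lra|easy]|intros; apply Hden; lra]. }
(* For [|t| < 1/2] one has [|1 - b t| > 1/2 > |t|]. The radius 1/2 serves all expansions in [t],
   since coefficients are determined by any disk around 0. *)
assert (Hxi1 : forall t : C, Cmod t < 1 / 2 -> Cmod (xi t) < 1).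
{ intros t Ht; unfold xi; rewrite Cmod_div by (apply Hden; lra).
  assert (H : 1 / 2 < Cmod (1 - b * t)).
  { pose proof (Cmod_rev_triangle 1 (b * t)) as Htr; rewrite Cmod_1, Cmod_mult in Htr.
    pose proof (Cmod_ge_0 t); nra. }
  apply Rmult_lt_reg_r with (Cmod (1 - b * t)); [lra|].
  unfold Rdiv; rewrite Rmult_assoc, Rinv_l by lra; lra. }
assert (Hxih : holo (1 / 2) xi) by (apply (holo_mult (1 / 2) (fun t => t) u); [apply holo_id|easy]).
assert (Hgxi : holo (1 / 2) (fun t => g (xi t))).
{ apply (holo_comp (1 / 2) 1 g xi); [now apply pser_holo with c|easy|easy]. }
set (E := fun t => Cexp (RtoC lambda * l1 t)%C).
assert (HE : holo (1 / 2) E).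
{ apply holo_Cexp, holo_mult; [apply holo_const|apply holo_sub with 1; [lra|easy]]. }
assert (Hhalf : 0 < 1 / 2) by lra.
destruct (holo_pser (1 / 2) (fun t => g (xi t) * E t)%C Hhalf) as [A HA]; [now apply holo_mult|].
destruct (holo_pser (1 / 2) (fun t => g (xi t)) Hhalf Hgxi) as [h Hh].
destruct (holo_pser (1 / 2) E Hhalf HE) as [e He].
(* The derivative of [F] at 0 is [s f'(z)] by the chain rule and [Cexp (l 0)] by the factorization
   of [F]. *)
assert (Hder : C_derive f z = (Cexp (l 0) / RtoC s)%C).
{ destruct Hfh as [f' Hf']; destruct (Hf' z Hz) as [Hfz _].
  rewrite (cdiff_C_derive f z (f' z) Hfz).
  assert (Hd1 : cdiff F 0 (f' z * RtoC s - 0)).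
  { apply cdiff_minus; [|apply cdiff_const].
    apply (cdiff_comp f (moebius z)); [apply cdiff_moebius_0|now rewrite Hm0]. }
  assert (Hd2 : cdiff F 0 (Cexp (l 0))).
  { apply cdiff_ext_loc with (fun w => w * Cexp (l w))%C 1; [lra| |].
    - intros w Hw; symmetry; apply HFl; now replace (w - 0)%C with w in Hw by ring.
    - destruct Hlh as [l' Hl']; destruct (Hl' 0) as [Hl0 _]; [rewrite Cmod_0; lra|].
      eapply cdiff_eq; [|apply cdiff_mult; [apply cdiff_id|apply (cdiff_comp Cexp l); [exact Hl0|apply cdiff_Cexp]]].
      cbv beta; ring. }
  rewrite (cdiff_unique F 0 _ _ Hd2 Hd1); field; easy. }
(* Passing from the variable [t = (w - z) / s] back to [w - z] divides the [k]-th coefficient by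
   [s ^ k]. *)
set (a := fun k => (A k / RtoC s ^ k)%C).
exists a, c; split; [|split; [easy|split; [easy|]]].
(* The first two terms are a logarithm of [F'(0) xi / F(xi)], the last one of the factor
   [1 - conj z t]; at [w = z] they cancel. *)
- set (L := fun w => (l 0 - l (xi ((w - z) / RtoC s)) + l1 ((w - z) / RtoC s))%C).
  exists (s / 2), L; split; [lra|]; split.
  { unfold L; replace ((z - z) / RtoC s)%C with (RtoC 0) by (field; easy).
    rewrite Hl10; unfold xi; replace (0 / (1 - b * 0))%C with (RtoC 0); [ring|].
    field; apply Hden; rewrite Cmod_0; lra. }
  intros w Hw; set (t := ((w - z) / RtoC s)%C).
  assert (Ht : Cmod t < 1 / 2).
  { unfold t; rewrite Cmod_div, Cmod_R, Rabs_pos_eq by (easy || lra).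
    apply Rmult_lt_reg_r with s; [lra|]; unfold Rdiv at 1; rewrite Rmult_assoc, Rinv_l by lra; lra. }
  assert (Hwt : w = (z + RtoC s * t)%C) by (unfold t; field; easy).
  assert (Hdt : (1 - b * t)%C <> 0) by (apply Hden; lra).
  split; [|split].
  + apply ccont_continuous; unfold L.
    assert (Hct : ccont (fun w => (w - z) / RtoC s)%C w).
    { apply ccont_div; [apply ccont_minus; [apply ccont_id|apply ccont_const]|apply ccont_const|easy]. }
    apply ccont_plus; [apply ccont_minus; [apply ccont_const|]|].
    * apply (ccont_comp l (fun w => xi ((w - z) / RtoC s)%C)).
      -- apply (ccont_comp xi (fun w => (w - z) / RtoC s)%C); [easy|].
         now apply holo_ccont with (1 / 2).
      -- apply holo_ccont with 1; [easy|now apply Hxi1].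
    * apply (ccont_comp l1 (fun w => (w - z) / RtoC s)%C); [easy|].
      apply holo_ccont with 1; [easy|fold t; lra].
  + unfold L; fold t; rewrite Cexp_plus, Cexp_minus, El1 by lra.
    unfold aharonov_quotient; destruct (Ceq_dec w z) as [Ewz|Hwz].
    * assert (Ht0 : t = 0) by (unfold t; rewrite Ewz; field; easy).
      rewrite Ht0; unfold xi; replace (0 / (1 - b * 0))%C with (RtoC 0) by
        (field; apply Hden; rewrite Cmod_0; lra).
      field; apply Cexp_neq_0.
    * assert (Ht0 : t <> 0).
      { intros Ht0; apply Hwz; rewrite Hwt, Ht0; ring. }
      assert (EF : (f w - f z)%C = (xi t * Cexp (l (xi t)))%C).
      { rewrite <- HFl by (now apply Hxi1); unfold F, xi, b.
        rewrite moebius_preimage by easy; fold s; now rewrite <- Hwt. }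
      rewrite EF, Hder, Hwt; unfold xi at 2; field.
      repeat split; try easy; apply Cexp_neq_0.
  + apply is_pseries_clim.
    replace (Cexp (RtoC lambda * L w)) with (g (xi t) * E t)%C.
    * apply clim_ext with (psum A t); [|now apply HA].
      intros n; apply csum_ext; intros k _; rewrite Hwt; unfold a.
      replace (z + RtoC s * t - z)%C with (RtoC s * t)%C by ring.
      rewrite Cpow_mult_l; field; now apply Cpow_nz.
    * unfold g, E, L; fold t; rewrite <- Cexp_plus; f_equal; ring.
- intros n; unfold a; rewrite RtoC_pow.
  replace (RtoC s ^ n * (A n / RtoC s ^ n))%C with (A n) by (field; now apply Cpow_nz).
  rewrite (pser_mult_coef (1 / 2) h e A (fun t => g (xi t)) E Hhalf Hh He HA), conv_csum.
  apply csum_ext; intros j _; f_equal.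
  (* [pser_comp_coef] takes the expansions of all powers of [xi] as one family, hence the choice. *)
  + set (p := fun k => epsilon (inhabits (fun _ : nat => RtoC 0)) (fun q => pser (1 / 2) q (fun t => xi t ^ k)%C)).
    assert (Hp : forall k : nat, pser (1 / 2) (p k) (fun t => xi t ^ k)%C).
    { intros k; unfold p; apply epsilon_spec, holo_pser; [easy|now apply holo_pow]. }
    rewrite (pser_comp_coef (1 / 2) u xi p Hhalf Hu (fun t _ => eq_refl) Hxi1 Hp (S j) 0 j g c h); [|lia|easy|].
    * apply csum_ext; intros k Hk; f_equal.
      rewrite (moebius_power_coef (1 / 2) b xi p Hhalf); [|intros t Ht; unfold xi; field; apply Hden; lra|easy].
      change (0 + k)%nat with k; destruct (le_dec k j); [reflexivity|lia].
    * apply pser_ext with (fun t => g (xi t)); [intros; simpl; ring|easy].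
  + apply (binomial_power_coef (1 / 2) lambda b l1 e); try easy; [apply holo_sub with 1; [lra|easy]|].
    intros t Ht; apply El1; lra.
Qed.

(** * The final estimate *)

Lemma Cmod_csum_le (u : nat -> C) (v : nat -> R) (n : nat) :
  (forall k : nat, (k <= n)%nat -> Cmod (u k) <= v k) -> Cmod (csum u (S n)) <= sum_f_R0 v n.
Proof.
induction n as [|n IH]; intros H.
- simpl; rewrite Cplus_0_l; now apply H.
- change (csum u (S (S n))) with (csum u (S n) + u (S n))%C; simpl sum_f_R0.
  eapply Rle_trans; [apply Cmod_triangle|apply Rplus_le_compat]; [apply IH; intros; apply H; lia|apply H; lia].
Qed.

(** For [k = 0] the absolute value makes the right side equal to 1, which is [|c 0|]; so one formula
    serves all indices. *)
Lemma prawitz_coefficient_bound (lambda : R) (c : nat -> C) (k : nat) : 0 < lambda < 1 -> c O = 1 ->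
  (forall n : nat, (1 <= n)%nat -> (INR n - lambda) * Cmod (c n) ^ 2 <= lambda) ->
  Cmod (c k) <= sqrt lambda / sqrt (Rabs (INR k - lambda)).
Proof.
intros Hl Hc0 Hc; destruct k as [|k].
- rewrite Hc0, Cmod_1; simpl; rewrite Rabs_left by lra.
  replace (- (0 - lambda)) with lambda by ring.
  assert (0 < sqrt lambda) by (apply sqrt_lt_R0; lra); right; field; lra.
- specialize (Hc (S k) ltac:(lia)); assert (Hk : 1 <= INR (S k)) by (apply (le_INR 1); lia).
  rewrite Rabs_pos_eq, <- sqrt_div_alt by lra.
  rewrite <- (sqrt_pow2 (Cmod (c (S k)))) by apply Cmod_ge_0; apply sqrt_le_1_alt.
  apply Rmult_le_reg_r with (INR (S k) - lambda); [lra|].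
  unfold Rdiv; rewrite (Rmult_assoc lambda), Rinv_l by lra; lra.
Qed.

Theorem proposition4p4 (lambda : R) (f : C -> C)
    (hlambda : 0 < lambda < 1)
    (hf : analytic_in_disk f) (hinj : univalent_in_disk f) :
  forall (z : C) (n : nat), in_disk z -> (1 <= n)%nat ->
    (1 - Cmod z ^ 2) ^ n * Cmod (mixed_aharonov lambda n f z) <=
    sum_f_R0 (fun j : nat =>
      Rabs (gbinom lambda (n - j)) *
      sum_f_R0 (fun k : nat =>
        gbinom (INR j - 1) (j - k) *
        (sqrt lambda / sqrt (Rabs (INR k - lambda))) *
        Cmod z ^ (n - k)) j) n.
Proof.
intros z n hz _.
destruct (mixed_aharonov_coefficients lambda f z hlambda hf hinj hz) as [a [c [Ha [Hc0 [Hc Hcoef]]]]].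
assert (Hs : 0 <= 1 - Cmod z ^ 2) by (pose proof (Cmod_ge_0 z); unfold in_disk in hz; nra).
assert (Ea : mixed_aharonov lambda n f z = a n).
{ apply (mixed_aharonov_expansion_unique lambda f z); [|easy].
  apply (epsilon_spec (inhabits (fun _ : nat => RtoC 0)) (mixed_aharonov_expansion lambda f z)); now exists a. }
rewrite Ea.
rewrite <- (Rabs_pos_eq ((1 - Cmod z ^ 2) ^ n)), <- Cmod_R, <- Cmod_mult by (now apply pow_le).
rewrite Hcoef; apply Cmod_csum_le; intros j Hj.
rewrite !Cmod_mult, Cmod_R, Cmod_pow, Cmod_opp, Cmod_conj.
(* Only the triangle inequality and the bound on [c k] are used: the binomials of upper entry
   [j - 1] are nonnegative, those of upper entry [lambda] may change sign and keep their absolute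
   values. *)
apply Rle_trans with (Rabs (gbinom lambda (n - j)) * (Cmod z ^ (n - j) *
  sum_f_R0 (fun k => gbinom (INR j - 1) (j - k) * (sqrt lambda / sqrt (Rabs (INR k - lambda))) * Cmod z ^ (j - k)) j)).
- rewrite (Rmult_comm (Cmod (csum _ _))), Rmult_assoc.
  apply Rmult_le_compat_l; [apply Rabs_pos|]; apply Rmult_le_compat_l; [apply pow_le, Cmod_ge_0|].
  apply Cmod_csum_le; intros k Hk.
  rewrite !Cmod_mult, Cmod_R, Cmod_pow, Cmod_conj, Rabs_pos_eq by (apply gbinom_pred_pos; lia).
  rewrite <- Rmult_assoc, (Rmult_comm (Cmod (c k))).
  apply Rmult_le_compat_r; [apply pow_le, Cmod_ge_0|].
  apply Rmult_le_compat_l; [apply gbinom_pred_pos; lia|now apply prawitz_coefficient_bound].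
(* The two powers of [|z|] combine as [(n - j) + (j - k) = n - k]. *)
- apply Rmult_le_compat_l; [apply Rabs_pos|]; right.
  rewrite scal_sum; apply sum_eq; intros k Hk.
  rewrite Rmult_assoc, <- pow_add; do 2 f_equal; lia.
Qed.
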